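(* Let $\mathcal{R}_c^{(\mathrm{inf\text{-}div})}$ denote the set of all $R$-diagonal distributions in $\mathcal{D}_c(1,* )$ that are $\boxplus$-infinitely divisible. For every $\nu,\nu'\in\mathcal{R}_c^{(\mathrm{inf\text{-}div})}$ we have $\nu\boxtimes\nu'\in\mathcal{R}_c^{(\mathrm{inf\text{-}div})}$.
   Context: $\mathbb{C}\langle Z,Z^*\rangle$ is the algebra of complex polynomials in two non-commuting variables. $\mathcal{W}^+=\bigsqcup_{n\ge1}\{1,*\}^n$ is the set of non-empty words over $\{1,*\}$; for $w=(\ell_1,\dots,\ell_n)$ let $|w|=n$, $Z^w=Z^{\ell_1}\cdots Z^{\ell_n}$, $a^w=a^{\ell_1}\cdots a^{\ell_n}$ (with $a^1=a$), $z^w=z^{\ell_1}\cdots z^{\ell_n}$ (non-commuting formal indeterminates $z,z^*$). A $C^*$-probability space $(\mathcal{A},\varphi)$ is a unital $C^*$-algebra with a positive linear functional $\varphi$, $\varphi(1)=1$ (not assumed to be a trace). The $*$-distribution of $a\in\mathcal{A}$ is the linear functional $\mu$ on $\mathbb{C}\langle Z,Z^*\rangle$ with $\mu(1)=1$, $\mu(Z^w)=\varphi(a^w)$. $\mathcal{D}_c(1,* )$ is the set of all such $*$-distributions. Free additive (resp. multiplicative) convolution $\boxplus$ (resp. $\boxtimes$) on $\mathcal{D}_c(1,* )$: if $a,a'$ are elements of a $C^*$-probability space with $*$-distributions $\mu,\mu'$ and $\{a,a^*\}$ is free from $\{a',(a')^*\}$, then $\mu\boxplus\mu'$ (resp. $\mu\boxtimes\mu'$)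 is the $*$-distribution of $a+a'$ (resp. $aa'$). $\mu\in\mathcal{D}_c(1,* )$ is $\boxplus$-infinitely divisible if for every $n\in\mathbb{N}$ there is $\mu_n\in\mathcal{D}_c(1,* )$ whose $n$-fold $\boxplus$-convolution is $\mu$. The $R$-transform $R_\mu$ is the unique formal power series in $z,z^*$ with zero constant term such that for all $w$ with $|w|=n$, $\mu(Z^w)=\sum_{\pi\in NC(n)}\prod_{B\in\pi}\mathrm{Cf}_{w|B}(R_\mu)$, where $NC(n)$ is the set of non-crossing partitions of $\{1,\dots,n\}$, $\mathrm{Cf}_v(f)$ is the coefficient of $z^v$ in $f$, and $w|B$ is the subword of $w$ with positions in $B$. $\mu$ is $R$-diagonal if $\mathrm{Cf}_w(R_\mu)=0$ for every $w$ not of the form $(1,* )^m$ or $( *,1)^m$, $m\ge1$. *)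

(* Defs.v *)
From HB Require Import structures.
From mathcomp Require Import all_boot all_order all_algebra.
From mathcomp Require Import complex.
From mathcomp Require Import all_classical all_reals all_analysis.
(* Its notations clash with those of the analysis library. *)
From mathcomp Require Import -(notations) monalg.

Set Implicit Arguments.
Unset Strict Implicit.
Unset Printing Implicit Defensive.

Import Order.TTheory GRing.Theory Num.Theory.
Import numFieldNormedType.Exports.

Local Open Scope classical_set_scope.
Local Open Scope ring_scope.
Local Open Scope complex_scope.

(* The field of complex numbers is R[i] for R : realType; 0 <= z in R[i] means
   that z is real and nonnegative. *)

(* Unital C^*-algebras. The norm is a field of the structure, because the
   normed modules of the library cannot be joined with its algebras. *)
HB.mixin Record isCStarAlgebra (R : realType) A of GRing.Algebra R[i] A := {
  star : A -> A;
  starK : involutive star;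
  starD : {morph star : x y / x + y};
  starZ : forall (c : R[i]) (x : A), star (c *: x) = Num.conj c *: star x;
  starM : forall x y : A, star (x * y) = star y * star x;
  cstar_norm : A -> R;
  cstar_norm0_eq0 : forall x : A, cstar_norm x = 0 -> x = 0;
  cstar_normD : forall x y : A,
    cstar_norm (x + y) <= cstar_norm x + cstar_norm y;
  cstar_normZ : forall (c : R[i]) (x : A),
    (cstar_norm (c *: x))%:C = `|c| * (cstar_norm x)%:C;
  cstar_normM : forall x y : A,
    cstar_norm (x * y) <= cstar_norm x * cstar_norm y;
  cstar_norm_star : forall x : A, cstar_norm (star x * x) = cstar_norm x ^+ 2;
  cstar_complete : forall u : nat -> A,
    (forall e : R, 0 < e -> exists N : nat, forall m n : nat,
       (N <= m)%N -> (N <= n)%N -> cstar_norm (u m - u n) < e) ->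
    exists l : A, forall e : R, 0 < e -> exists N : nat, forall n : nat,
       (N <= n)%N -> cstar_norm (u n - l) < e
}.

#[short(type="cstarAlgType")]
HB.structure Definition CStarAlgebra (R : realType) :=
  {A of isCStarAlgebra R A & GRing.Algebra R[i] A}.

Record cstar_prob_space (R : realType) := CStarProbSpace {
  cps_alg :> cstarAlgType R;
  state : {scalar cps_alg};
  state_ge0 : forall a : cps_alg, 0 <= state (star a * a);
  state1 : state 1 = 1
}.

(* Words over {1, *}: the letter [false] stands for 1 and [true] for *. *)
Definition word := seq bool.

(* The algebra C<Z, Z^*>, as the monoid algebra of the free monoid on the
   letters; the generators [Zletter R false] and [Zletter R true] are Z and
   Z^*. *)
Definition ncpoly (R : realType) : lalgType R[i] :=
  malg (fmonom bool) R[i].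

Definition Zletter (R : realType) (l : bool) : ncpoly R :=
  mkmalgU (fmu l) 1.

Definition Zword (R : realType) (w : word) : ncpoly R :=
  \prod_(l <- w) Zletter R l.

Definition star_letter (R : realType) (A : cstarAlgType R) (a : A) (l : bool)
  : A := if l then star a else a.

Definition star_word (R : realType) (A : cstarAlgType R) (a : A) (w : word)
  : A := \prod_(l <- w) star_letter a l.

(* The case of the empty word is the normalization mu(1) = 1. *)
Definition is_star_distribution (R : realType) (P : cstar_prob_space R)
    (a : P) (mu : {scalar ncpoly R}) : Prop :=
  forall w : word, mu (Zword R w) = state P (star_word a w).

Definition Dc (R : realType) : set {scalar ncpoly R} :=
  [set mu | exists (P : cstar_prob_space R) (a : P), is_star_distribution a mu].

Definition unital_subalg_gen (R : realType) (A : algType R[i]) (S : set A) :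
  set A := smallest [set B : set A | GRing.subalg_closed (mem B)] S.

Definition free_sets (R : realType) (P : cstar_prob_space R) (I : eqType)
    (S : I -> set P) : Prop :=
  forall s : seq (I * P),
    s != [::] -> sorted (fun p q => p.1 != q.1) s ->
    (forall p, p \in s ->
       unital_subalg_gen (S p.1) p.2 /\ state P p.2 = 0) ->
    state P (\prod_(p <- s) p.2) = 0.

Definition star_free (R : realType) (P : cstar_prob_space R) (a a' : P) :
  Prop :=
  free_sets (fun b : bool =>
    if b then [set a; star a] else [set a'; star a']).

Definition is_free_add_conv (R : realType) (mu mu' rho : {scalar ncpoly R}) :
  Prop :=
  exists (P : cstar_prob_space R) (a a' : P),
    [/\ is_star_distribution a mu, is_star_distribution a' mu',
        star_free a a' & is_star_distribution (a + a') rho].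

Definition is_free_mul_conv (R : realType) (mu mu' rho : {scalar ncpoly R}) :
  Prop :=
  exists (P : cstar_prob_space R) (a a' : P),
    [/\ is_star_distribution a mu, is_star_distribution a' mu',
        star_free a a' & is_star_distribution (a * a') rho].

(* On Dc these are the unique rho as above: it exists by the free product
   construction, and freeness determines it. The default value of [xget], the
   zero functional, is outside Dc. *)
Definition free_add_conv (R : realType) (mu mu' : {scalar ncpoly R}) :
  {scalar ncpoly R} :=
  xget (\0 : {scalar ncpoly R}) [set rho | is_free_add_conv mu mu' rho].

Definition free_mul_conv (R : realType) (mu mu' : {scalar ncpoly R}) :
  {scalar ncpoly R} :=
  xget (\0 : {scalar ncpoly R}) [set rho | is_free_mul_conv mu mu' rho].

Section NonCrossing.
Variable n : nat.
Implicit Type pi : {set {set 'I_n}}.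

Definition noncrossing pi : bool :=
  [forall B in pi, forall B' in pi, (B != B') ==>
    ~~ [exists a in B, exists b in B', exists c in B, exists d in B',
          (a < b < c)%N && (c < d)%N]].

(* NC n is the set of non-crossing partitions of {0, ..., n - 1}. *)
Definition NC : {set {set {set 'I_n}}} :=
  finset (fun pi => finset.partition pi (finset.setTfor 'I_n) && noncrossing pi).

End NonCrossing.

Definition subword (w : word) (B : {set 'I_(size w)}) : word :=
  [seq tnth (in_tuple w) i | i <- enum B].

(* A formal power series in z, z^* is given by its coefficients: [f w] is the
   coefficient of z^w. *)
Definition ncseries (R : realType) := word -> R[i].

Definition is_R_transform (R : realType) (mu : {scalar ncpoly R})
    (f : ncseries R) : Prop :=
  f [::] = 0 /\
  forall w : word, w != [::] ->
    mu (Zword R w) =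
    \sum_(pi in NC (size w)) \prod_(B in pi) f (subword B).

Definition R_transform (R : realType) (mu : {scalar ncpoly R}) : ncseries R :=
  xget (fun=> 0) [set f : word -> R[i] | is_R_transform mu f].

Definition alternating (w : word) : Prop :=
  exists m : nat, (0 < m)%N /\
    (w = flatten (nseq m [:: false; true]) \/
     w = flatten (nseq m [:: true; false])).

Definition R_diagonal (R : realType) (mu : {scalar ncpoly R}) : Prop :=
  forall w : word, ~ alternating w -> R_transform mu w = 0.

(* [n.-1] further convolutions by mu: the n-fold convolution, for n >= 1. *)
Definition free_add_conv_pow (R : realType) (n : nat)
    (mu : {scalar ncpoly R}) : {scalar ncpoly R} :=
  iter n.-1 (fun rho => free_add_conv rho mu) mu.

Definition free_add_inf_div (R : realType) (mu : {scalar ncpoly R}) : Prop :=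
  forall n : nat, (0 < n)%N ->
    exists2 mun : {scalar ncpoly R}, Dc mun & free_add_conv_pow n mun = mu.

Definition Rc_inf_div (R : realType) : set {scalar ncpoly R} :=
  [set mu | [/\ Dc mu, R_diagonal mu & free_add_inf_div mu]].

(* Main.v *)
(**
Moments are computed from cumulants by a stack: a word is read from the right,
and each letter opens a block, extends the innermost open block of its colour,
or extends and closes it, the last at the cost of a cumulant.  Sums over
non-crossing partitions obey the same recursion (split off the block of the
first letter that is read), and the centred alternating products vanish in the
stack model, so it gives the mixed moments of free elements.

Let x, y be R-diagonal with cumulants t k, t k' and let p be a projection of
state t, with x, y, p free.  A power of t is then attached to every nested group
of blocks, once for each occurrence of p inside it, and it compensates the
factors t of the cumulants, so that t^-1 x p y has cumulants t k'' with k''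
independent of t.  R-diagonality is what makes the open blocks alternate, so
that this bookkeeping closes up and k'' is again R-diagonal.  For t = 1 and
p = 1 this describes the product of nu and nu'.  For t = 1/n, with x and y n-th
additive roots of nu and nu', the element n x p y is an n-th additive root of
the product.

Free families exist: the free product of states is a positive definite kernel on
reduced words (Schur's product theorem), left multiplication is bounded, and the
norm closure of the algebra of bounded operators is a C*-algebra.
*)
Require Import Defs.
From HB Require Import structures.
From mathcomp Require Import all_boot all_order all_algebra.
From mathcomp Require Import ring lra zify.

Set Implicit Arguments.
Unset Strict Implicit.
Unset Printing Implicit Defensive.

Import Order.TTheory GRing.Theory Num.Theory.

Local Open Scope ring_scope.

(** Infinite divisibility is a matter of positivity: cumulants can always be divided by [n], but the
    quotient must be the distribution of an operator. The product of two [n]-th roots does not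
    provide it. A cumulant of a product is a sum of monomials in the cumulants of the factors, and
    monomials of different degrees scale differently.

    The projection restores homogeneity. For [m] factors [t^-1 x p y], a term with [b] cumulants of
    [x] and [y] and [c] classes of merged projections has weight [t^(b + c - m)]. For R-diagonal
    elements every contributing term satisfies [b + c = m + 1], which leaves one factor [t]. In
    general this fails: the product of two first cumulants already has [m = 1], [b = 2], [c = 1].

    The relation is not proved on partitions, where it would need complements and connectedness. The
    model acts on functionals on stacks, and each comparison of two models is an operator that
    commutes with reading one letter, so a balance of powers of [t] per letter is enough. *)

(** * The stack model of mixed moments *)

(* [Some (c, l)] is the letter [l] (an element or its adjoint) of colour [c];
   [None] is the projection. *)
Definition letter := option (bool * bool).
Definition color (l : letter) : option bool := omap fst l.
(* [Some (c, v)] is an open block of colour [c] that carries the word [v];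
   [None] is the mark left by the projection, of weight [t]. *)
Definition stack := seq (option (bool * seq bool)).

Definition marked (S : stack) := if S is None :: _ then true else false.
Definition topped (c : bool) (S : stack) :=
  if S is Some b :: _ then b.1 == c else false.
Definition pure (c : bool) (S : stack) :=
  all (fun b => if b is Some b then b.1 == c else false) S.

Definition mono (x : option bool) (w : seq letter) :=
  (w != [::]) && all (fun y => color y == x) w.

Definition chunk_color (w : seq letter) := color (head None w).

Section StackModel.
Variables (F : comNzRingType) (t : F) (k : bool -> seq bool -> F).
Implicit Types (g h : stack -> F) (S : stack).

Definition extend (c l : bool) g S : F :=
  if S is Some (c', v) :: S' then
    if c' == c then g (Some (c, l :: v) :: S') + k c (l :: v) * g S' else 0
  else 0.

(* The letters act on functionals on stacks, so the last letter of a word is the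
   first to act on the stack. *)
Definition step (x : letter) g S : F :=
  if x is Some (c, l) then
    g (Some (c, [:: l]) :: S) + k c [:: l] * g S +
    (if S is None :: S' then t * extend c l g S' else extend c l g S)
  else if marked S then g S else g (None :: S).

Definition run (w : seq letter) g : stack -> F := foldl (fun g x => step x g) g w.

(** At the left end of the word a remaining mark is a complete group of projections, of state [t],
    while a block that is still open belongs to no partition. *)
Fixpoint vac S : F :=
  match S with
  | [::] => 1
  | None :: S' => t * vac S'
  | Some _ :: _ => 0
  end.

Definition model (w : seq letter) : F := run w vac [::].

Lemma run_rcons w x g : run (rcons w x) g = step x (run w g).
Proof. by rewrite /run -cats1 foldl_cat. Qed.

Lemma run_cat w1 w2 g : run (w1 ++ w2) g = run w2 (run w1 g).
Proof. by rewrite /run foldl_cat. Qed.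

Lemma eq_step x g h : g =1 h -> step x g =1 step x h.
Proof.
move=> e S; case: x => [[c l]|] /=; rewrite ?e //.
by congr (_ + _); case: S => [|[[c' v]|] [|[[c'' v'] |] S]] //=; rewrite ?e.
Qed.

Lemma eq_run w g h : g =1 h -> run w g =1 run w h.
Proof. by elim: w g h => //= x w IH g h e; apply: IH; apply: eq_step. Qed.

(* The letters of colour [c] only see the part of the stack that they pushed
   themselves: [L] is the resulting local functional. *)
Lemma run_local c w (L : (stack -> F) -> stack -> F) g :
  (forall x g' S, color x = Some c -> pure c S -> L (step x g') S = step x (L g') S) ->
  all (fun x => color x == Some c) w ->
  forall S, pure c S -> L (run w g) S = run w (L g) S.
Proof.
move=> Lstep; elim/last_ind: w => [|w x IH] //.
rewrite all_rcons => /andP[/eqP cx cw] S pS.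
rewrite !run_rcons Lstep //; case: x cx => [[c0 l]|] //= [->].
rewrite !IH //=; last by rewrite eqxx.
congr (_ + _); case: S pS => [|[[c' v]|] S] //= /andP[/eqP-> pS].
by rewrite eqxx !IH //= eqxx.
Qed.

(** On pure stacks such a [g] is [g [::]] times [vac]. Restricting to pure stacks and rescaling both
    commute with the letters of colour [c], so [run_local] carries the identity through the run. *)
Lemma run_pure c w g : all (fun x => color x == Some c) w ->
  (forall S, pure c S -> S != [::] -> g S = 0) ->
  run w g [::] = model w * g [::].
Proof.
move=> cw g0.
pose L (g' : stack -> F) S := if pure c S then g' S else 0.
have e1 : L g =1 (fun S => L (fun S => g [::] * vac S) S).
  move=> S; rewrite /L; case: ifP => // pS.
  case: S pS => [|[b|] S] //= pS; first by rewrite mulr1.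
  by rewrite g0 // mulr0.
have Lst g' : forall x (g' : stack -> F) S, color x = Some c -> pure c S ->
    L (step x g') S = step x (L g') S.
  move=> [[c0 l]|] //= g'' S [->] pS; rewrite /L pS /= eqxx pS /=.
  congr (_ + _); case: S pS => [|[[c' v]|] S] //= /andP[/eqP-> pS].
  by rewrite /= !eqxx /= pS.
have -> : run w g [::] = L (run w g) [::] by [].
rewrite (run_local _ (Lst g) cw) // (eq_run _ e1) -(run_local _ (Lst g) cw) //.
rewrite /L /= /model mulrC.
pose M (g' : stack -> F) S := g [::] * g' S.
have -> : run w (fun S => g [::] * vac S) [::] = run w (M vac) [::] by [].
rewrite -(@run_local c w M) // => x g' S cx pS; rewrite /M.
case: x cx => [[c0 l]|] //= [->].
case: S pS => [_|[[c' v]|] S] //=; first by ring.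
by move=> /andP[/eqP-> _]; rewrite !eqxx; ring.
Qed.

(** The model counterpart of multiplying by a chunk minus its state. *)
Definition cstep (w : seq letter) g S : F := run w g S - model w * g S.

Definition crun (ws : seq (seq letter)) g : stack -> F :=
  foldl (fun g w => cstep w g) g ws.

Lemma run_mark w g S : mono None w -> run w g S = if marked S then g S else g (None :: S).
Proof.
case/andP; elim/last_ind: w S => [|w x IH] S // _.
rewrite all_rcons => /andP[/eqP]; case: x => [//|_ cw].
rewrite run_rcons; case: (altP (w =P [::])) => [->//|w0] /=.
by rewrite !IH //=; case: ifP => [->|].
Qed.

Lemma model_mark w : mono None w -> model w = t.
Proof. by move=> mw; rewrite /model run_mark //= mulr1. Qed.

(** Centring by a chunk of colour [c] produces a functional that vanishes on stacks with neither a
    mark nor a block of colour [c] on top, in particular on the empty stack. For a next chunk of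
    another colour the functional therefore vanishes as soon as that chunk leaves a block open; then
    [run_pure] applies, and centring subtracts what is left. Projections are handled in the same
    way, with marks instead of blocks. *)
Lemma crun_free ws : (0 < size ws)%N ->
  all (fun w => mono (chunk_color w) w) ws ->
  sorted (fun w w' => chunk_color w != chunk_color w') ws ->
  crun ws vac [::] = 0.
Proof.
(* [good x G]: what the innermost chunk of colour [x] forces on [G]. *)
pose good x (G : stack -> F) := if x is Some c then
    (forall S, ~~ marked S -> ~~ topped c S -> G S = 0) /\
    (forall S, ~~ marked S -> G (None :: S) = t * G S)
  else forall S, ~~ marked S -> G S = 0.
pose next x (G : stack -> F) := if x is Some c then
    forall S S', pure c S -> S != [::] -> G (S ++ S') = 0
  else forall S, ~~ marked S -> G (None :: S) = t * G S.
have good_next x y G : y != x -> good x G -> next y G.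
  case: x y => [c|] [c'|] //= ne.
  - case=> G1 _ [|[b|] S] S' //= /andP[/eqP bc pS] _; rewrite G1 //= bc.
    by apply: contra ne => /eqP->.
  - by case.
  - by move=> G1 [|[b|] S] S' //= pS _; rewrite G1.
have next_good w G : mono (chunk_color w) w -> next (chunk_color w) G ->
    good (chunk_color w) (cstep w G).
  move=> mw; move: (mw) => /andP[w0]; case e : (chunk_color w) mw => [c|] mw cw nG.
  - split=> S mS.
      move=> tS; rewrite /cstep.
      (* For this chunk [S] is frozen: it has no block of colour [c] on top that the chunk could
         extend. *)
      pose L (g : stack -> F) S' := g (S' ++ S).
      have -> : run w G S = L (run w G) [::] by [].
      rewrite (@run_local c w L) //; first last.
        move=> [[c0 l]|] //= g [|[[c' v]|] S'] [->] //=.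
        by rewrite {}/L /=; case: S mS tS => [|[[c1 v]|] S] //= _ /negbTE->.
      rewrite (run_pure cw) ?subrr // => S' pS' S'0; exact: nG.
    rewrite /cstep.
    (* A mark below the blocks of the chunk should be worth a factor [t]; the defect [L] of this
       rule commutes with the letters of the chunk. *)
    pose L (g : stack -> F) S' := g (S' ++ None :: S) - t * g (S' ++ S).
    have eL g : g (None :: S) = L g [::] + t * g S by rewrite /L /=; ring.
    rewrite (eL (run w G)) (@run_local c w L) //; first last.
      move=> [[c0 l]|] //= g [|[[c' v]|] S'] [->] //= pS'; rewrite /L /=.
        by case: S mS {L eL} => [|[[c1 v]|] S] //= _; ring.
      by case/andP: pS' => /eqP-> _; rewrite !eqxx; ring.
    rewrite (run_pure cw); last by move=> S' pS' S'0; rewrite /L !nG // mulr0 subr0.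
    by rewrite /L /=; ring.
  - move=> S mS; rewrite /cstep run_mark // (negbTE mS) nG // model_mark //.
    by rewrite subrr.
have next_vac x : next x vac.
  by case: x => [c|] //= [|[b|] S].
move=> ws0 mws sws.
suff: good (chunk_color (last [::] ws)) (crun ws vac).
  by case: (chunk_color _) => [c [+ _]|]; apply.
elim/last_ind: ws ws0 mws sws => [//|ws w IH] _.
rewrite all_rcons last_rcons => /andP[mw mws] sws.
rewrite /crun -cats1 foldl_cat /= -/(crun ws vac).
apply: next_good => //.
case/lastP: ws IH mws sws => [|ws w' IH mws sws]; first by move=> *; exact: next_vac.
have /andP[sw' ww'] : sorted (fun w w' => chunk_color w != chunk_color w') (rcons ws w') &&
    (chunk_color w' != chunk_color w).
  move: sws; case: (ws) => [|w1 ws1] /=; first by rewrite andbT.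
  by rewrite !rcons_path last_rcons.
apply: (@good_next (chunk_color w')); first by rewrite eq_sym.
have := IH _ mws sw'; rewrite last_rcons; apply; by rewrite size_rcons.
Qed.

Lemma step_linear a x g h S :
  step x (fun S => g S + a * h S) S = step x g S + a * step x h S.
Proof.
case: x => [[c l]|] /=; last by case: ifP.
case: S => [|[[c' v]|] [|[[c1 v1]|] S]] //=; do ?case: ifP => _; ring.
Qed.

Lemma run_linear a w g h S :
  run w (fun S => g S + a * h S) S = run w g S + a * run w h S.
Proof.
elim/last_ind: w S => [|w x IH] S //; rewrite !run_rcons.
by rewrite (eq_step _ IH) step_linear.
Qed.

Lemma eq_crun ws g h : g =1 h -> crun ws g =1 crun ws h.
Proof.
elim: ws g h => //= w ws IH g h e; apply: IH => S.
by rewrite /cstep (eq_run _ e) e.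
Qed.

Lemma crun_linear a ws g h S :
  crun ws (fun S => g S + a * h S) S = crun ws g S + a * crun ws h S.
Proof.
elim: ws g h => //= w ws IH g h; rewrite -IH; apply: eq_crun => S'.
by rewrite /cstep run_linear; ring.
Qed.

End StackModel.

(** * Mixed moments of free elements *)

Section FreeMoments.
Variables (F : comNzRingType) (A : algType F) (phi : {scalar A}).
Variables (t : F) (k : bool -> seq bool -> F) (el : letter -> A).

Definition eword (w : seq letter) : A := \prod_(x <- w) el x.

Definition centred (w : seq letter) : A := eword w - (phi (eword w))%:A.

Hypothesis phi1 : phi 1 = 1.
Hypothesis phi_mono : forall w, mono (chunk_color w) w -> phi (eword w) = model t k w.
Hypothesis phi_free : forall ws, (0 < size ws)%N ->
  all (fun w => mono (chunk_color w) w) ws ->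
  sorted (fun w w' => chunk_color w != chunk_color w') ws ->
  phi (\prod_(w <- ws) centred w) = 0.

Lemma eword_cat u v : eword (u ++ v) = eword u * eword v.
Proof. by rewrite /eword big_cat. Qed.

Lemma chunksP w : w != [::] -> exists ws, [/\ flatten ws = w, (0 < size ws)%N,
  all (fun w => mono (chunk_color w) w) ws &
  sorted (fun w w' => chunk_color w != chunk_color w') ws].
Proof.
elim: w => [//|x w IH] _; case: (altP (w =P [::])) => [->|/IH].
  by exists [:: [:: x]]; rewrite /= /mono /chunk_color /= !eqxx.
case=> -[|v ws] [//= <- _ /andP[mv mws] sws].
case: (altP (color x =P chunk_color v)) => e.
  exists ((x :: v) :: ws); split=> //=.
    by rewrite mws andbT /mono /chunk_color /= eqxx e; case/andP: mv.
  by move: sws; case: (ws) => //= v' ws'; rewrite -e.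
exists ([:: x] :: v :: ws); split=> //=; last by rewrite e.
by rewrite mv mws /mono /chunk_color /= eqxx.
Qed.

(** Both sides expand in the same way when the centring of the chunks is multiplied out. Every term
    but the full word concerns a shorter word, on which state and model agree, so only the
    difference at the full word survives. The prefix [u] collects the chunks already expanded. *)
Lemma centred_diff ws u :
  (forall w, (size w < size (u ++ flatten ws))%N -> phi (eword w) = model t k w) ->
  all (fun w => mono (chunk_color w) w) ws ->
  phi (eword u * \prod_(w <- ws) centred w) - crun t k ws (run t k u (vac t)) [::] =
  phi (eword (u ++ flatten ws)) - model t k (u ++ flatten ws).
Proof.
elim: ws u => [|w ws IH] u hyp /=; first by rewrite big_nil mulr1 cats0.
case/andP=> mw mws.
have e : crun t k ws (cstep t k w (run t k u (vac t))) [::] =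
    crun t k ws (run t k (u ++ w) (vac t)) [::] -
    model t k w * crun t k ws (run t k u (vac t)) [::].
  rewrite -mulNr -crun_linear; apply: eq_crun => S.
  by rewrite /cstep run_cat mulNr.
have := IH (u ++ w); rewrite -catA => /(_ hyp mws) <-.
rewrite big_cons mulrA /centred phi_mono // mulrBr mulrBl.
rewrite -eword_cat -scalerAr -scalerAl mulr1 raddfB /= linearZ /= e.
have := IH u; rewrite -/(centred w) => IHu.
have small v : (size v < size (u ++ flatten ws))%N -> phi (eword v) = model t k v.
  move=> lv; apply: hyp; apply: (leq_trans lv).
  by rewrite !size_cat leq_add2l leq_addl.
have shorter : (size (u ++ flatten ws) < size (u ++ flatten (w :: ws)))%N.
  rewrite !size_cat ltn_add2l /= ?size_cat -[ltnLHS]add0n ltn_add2r.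
  by case/andP: mw; case: (w).
have := IHu small mws; rewrite hyp // subrr => /subr0_eq ->.
by ring.
Qed.

(** Induction on the length: cut at the changes of colour, the centred product vanishes by freeness
    on one side and by [crun_free] on the other, and [centred_diff] turns this into equality at
    [w]. *)
Lemma phi_model w : phi (eword w) = model t k w.
Proof.
have [n] := ubnP (size w); elim: n w => // n IH w.
rewrite ltnS => lw; case: (altP (w =P [::])) => [->|/chunksP[ws [e ws0 mws sws]]].
  by rewrite /eword big_nil phi1.
have := @centred_diff ws [::]; rewrite /= e => /(_ _ mws).
rewrite [eword [::]]/eword big_nil mul1r phi_free // crun_free // subrr => h.
apply/subr0_eq/esym/h => v lv.
by apply: IH; apply: leq_trans lw.
Qed.

End FreeMoments.

(** * Sums of two free elements *)

Section Sum.
Variables (F : comNzRingType) (t : F) (k : bool -> seq bool -> F).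

Definition sum_cumulant (_ : bool) w := k true w + k false w.

Definition sumstep (l : bool) (g : stack -> F) S :=
  step t k (Some (true, l)) g S + step t k (Some (false, l)) g S.

Definition sumrun (w : seq bool) (g : stack -> F) := foldl (fun g l => sumstep l g) g w.

(** The sum of [g] over all colourings of the open blocks. It intertwines the one-colour model of
    the sum with the choice of a summand for each letter. The clause for marks makes [vac] a fixed
    point. *)
Fixpoint recolour (g : stack -> F) (S : stack) : F :=
  match S with
  | [::] => g [::]
  | Some (_, v) :: S' => recolour (fun S => g (Some (true, v) :: S) + g (Some (false, v) :: S)) S'
  | None :: S' => t * recolour g S'
  end.

Lemma eq_recolour g g' S : g =1 g' -> recolour g S = recolour g' S.
Proof.
elim: S g g' => [|[[c u]|] S IH] g g' e //=; last by rewrite (IH _ _ e).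
by apply: IH => S'; rewrite !e.
Qed.

Lemma recolour_linear a g g' S :
  recolour (fun S => g S + a * g' S) S = recolour g S + a * recolour g' S.
Proof.
elim: S g g' => [|[[c u]|] S IH] g g' //=; last by rewrite IH; ring.
by rewrite -IH; apply: eq_recolour => S'; ring.
Qed.

Lemma recolour_step l g S : pure true S ->
  step t sum_cumulant (Some (true, l)) (recolour g) S = recolour (sumstep l g) S.
Proof.
case: S => [|[[[] v]|] S] //= pS; first by rewrite /sumstep /sum_cumulant /=; ring.
rewrite -recolour_linear -[X in _ + X]mul1r -!recolour_linear.
by apply: eq_recolour => S'; rewrite /sumstep /sum_cumulant /=; ring.
Qed.

Lemma recolour_run w g S : pure true S ->
  run t sum_cumulant (map (fun l => Some (true, l)) w) (recolour g) S = recolour (sumrun w g) S.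
Proof.
elim/last_ind: w S => [|w l IH] S // pS.
rewrite map_rcons run_rcons /sumrun -cats1 foldl_cat /= -/(sumrun w g) -recolour_step //.
by case: S pS => [|[[[] v]|] S] //= pS; rewrite ?eqxx !IH.
Qed.

Lemma sumrun_model w :
  sumrun w (vac t) [::] = model t sum_cumulant (map (fun l => Some (true, l)) w).
Proof.
have rv : vac t =1 recolour (vac t).
  elim=> [|[[c v]|] S IH] //=; last by rewrite IH.
  apply/esym; elim: S {IH} => [|[[c' v'] |] S IH] //=; rewrite ?IH ?mulr0 ?addr0 //.
  by rewrite (@eq_recolour _ (fun=> 0 + 0)) // => S'; rewrite addr0.
by rewrite /model (eq_run t sum_cumulant _ rv) recolour_run.
Qed.

End Sum.

Section SumMoments.
Variables (F : comNzRingType) (A : algType F) (phi : {scalar A}).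
Variables (t : F) (k : bool -> seq bool -> F) (el : letter -> A).
Hypothesis phi_model : forall w, phi (eword el w) = model t k w.

Lemma sumstep_linear l g h S a : sumstep t k l (fun S => g S + a * h S) S =
  sumstep t k l g S + a * sumstep t k l h S.
Proof. by rewrite /sumstep !step_linear; ring. Qed.

Lemma eq_sumrun w g h : g =1 h -> sumrun t k w g =1 sumrun t k w h.
Proof.
elim: w g h => //= l w IH g h e; apply: IH => S.
by rewrite /sumstep !(eq_step _ _ _ e).
Qed.

Lemma sumrunD w g h S : sumrun t k w (fun S => g S + h S) S =
  sumrun t k w g S + sumrun t k w h S.
Proof.
elim: w g h => //= l w IH g h; rewrite -IH; apply: eq_sumrun => S'.
rewrite -[sumstep t k l h S']mul1r -sumstep_linear /sumstep.
by congr (_ + _); apply: eq_step => S2; rewrite mul1r.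
Qed.

Lemma sum_moment w :
  phi (\prod_(l <- w) (el (Some (true, l)) + el (Some (false, l)))) =
  model t (sum_cumulant k) (map (fun l => Some (true, l)) w).
Proof.
rewrite -sumrun_model.
suff h u : phi (eword el u * \prod_(l <- w) (el (Some (true, l)) + el (Some (false, l)))) =
    sumrun t k w (run t k u (vac t)) [::].
  by have := h [::]; rewrite /eword big_nil mul1r.
elim: w u => [|l w IH] u; first by rewrite big_nil mulr1 phi_model.
rewrite big_cons mulrA mulrDr mulrDl raddfD /=.
have e x : eword el u * el x = eword el (rcons u x).
  by rewrite /eword -cats1 big_cat big_seq1.
rewrite !e !IH -sumrunD; apply: eq_sumrun => S.
by rewrite !run_rcons.
Qed.

End SumMoments.

(** * The product of two free R-diagonal elements *)

Definition altb (w : seq bool) : bool :=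
  if w is l :: u then path (fun x y => x != y) l u && (last l u != l) else false.

Definition rdiag (F : nzRingType) (k : seq bool -> F) := forall w, ~~ altb w -> k w = 0.

Section ProductCumulants.
Variables (F : fieldType) (k : bool -> seq bool -> F).
Hypothesis kdiag : forall c, rdiag (k c).

Definition chain := seq (bool * seq bool).
Implicit Types (U : chain) (h : chain -> F).

(* [grow] is the part of the action of [x p y] or its adjoint [y^* p x^*] that
   does not open a new nested group; [chains] runs a word through it. *)
Definition grow (l : bool) h U : F :=
  if U is (c1, v1) :: U1 then
    if c1 == l then
      h ((~~ l, [:: l]) :: (l, l :: v1) :: U1) +
      k l (l :: v1) * (if U1 is (c2, v2) :: U2 then
        h ((~~ l, [:: l]) :: U1) +
        (if c2 == ~~ l then
          h ((~~ l, l :: v2) :: U2) + k (~~ l) (l :: v2) * h U2 else 0)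
      else 0)
    else 0
  else 0.

Definition proper h U : F := if U is [::] then 0 else h U.
Definition closed U : F := (U == [::])%:R.

Fixpoint chains (u : seq bool) h : F :=
  match u with
  | [::] => 0
  | [:: l] => h [:: (~~ l, [:: l]); (l, [:: l])]
  | l :: u' => chains u' (grow l (proper h))
  end.

(** The formula for cumulants with products as entries: [proper] keeps the group open until the
    first letter of the word, and [closed] empties it there, so exactly the partitions that connect
    all factors are counted. *)
Definition prod_cumulant (w : seq bool) : F :=
  if w is l :: u then chains u (grow l closed) else 0.

(** The shape of the chains that occur. The letter [l0], read first, opened the bottom block; all
    other blocks were opened by the letter opposite to their colour. In [irred] the top block has
    just received [l], as second half of a product, while an inner block last received a letter
    equal to its colour, as first half. *)
Fixpoint inner (l0 : bool) U : bool :=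
  if U is (c, v) :: U' then
    [&& v != [::], head false v == c,
        last false v == (if U' is [::] then c else ~~ c),
        (U' == [::]) ==> (c == l0) & inner l0 U']
  else true.

Definition irred (l l0 : bool) U : bool :=
  if U is (c, v) :: U' then
    [&& c == ~~ l, v != [::], head false v == l,
        last false v == (if U' is [::] then c else ~~ c),
        (U' == [::]) ==> (c == l0) & inner l0 U']
  else false.

Lemma last_cons_ne (l : bool) v : v != [::] -> last l v = last false v.
Proof. by case: v. Qed.

Lemma kdiag_same c l v : v != [::] -> last false v = l -> k c (l :: v) = 0.
Proof.
move=> v0 e; apply: kdiag => /=; case: v v0 e => //= x v _ ->.
by rewrite eqxx andbF.
Qed.

(** Only one branch leaves the invariant: closing two blocks and exposing a third. The second closed
    block then begins and ends with the same letter, and its cumulant vanishes by R-diagonality. *)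
Lemma eq_grow m l l0 h h' U : irred m l0 U ->
  (forall U', irred l l0 U' -> h U' = h' U') -> h [::] = h' [::] ->
  grow l h U = grow l h' U.
Proof.
case: U => [|[c1 v1] U1] //= /and5P[/eqP ec v0 hv lv /andP[bot inU]] hh h0.
case: eqP => // ecl; rewrite ecl in lv bot.
rewrite hh; last first.
  by rewrite /= !eqxx /= bot inU last_cons_ne // lv negbK eqxx.
congr (_ + _ * _); case: U1 lv bot inU => [|[c2 v2] U2] //= lv bot.
case/and5P=> v20 hv2 lv2 bot2 inU2.
rewrite hh; last by rewrite /= !eqxx v20 hv2 lv2 bot2 inU2 negbK eqxx.
congr (_ + _); case: eqP => // ec2; rewrite -ec2.
rewrite hh; last first.
  by rewrite /= ec2 !eqxx /= last_cons_ne // -ec2 lv2 bot2 inU2.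
congr (_ + _); case: U2 lv2 {bot2 inU2} => [|b U2] /eqP lv2; first by rewrite h0.
by rewrite kdiag_same ?mul0r // lv2 ec2 negbK.
Qed.

Lemma eq_chains u h h' : (forall U, irred (head false u) (last false u) U -> h U = h' U) ->
  chains u h = chains u h'.
Proof.
elim: u h h' => [|l u IH] h h' //= hh.
case: u IH hh => [|l' u] IH hh.
  by apply: hh; rewrite /= !eqxx negbK eqxx.
apply: IH => U iU; apply: (eq_grow iU) => // -[|b V] // iV.
exact: (hh (b :: V) iV).
Qed.

Lemma chains_linear a u h h' :
  chains u (fun U => h U + a * h' U) = chains u h + a * chains u h'.
Proof.
elim: u h h' => [|l u IH] h h' /=; first by rewrite mulr0 addr0.
case: u IH => [|l' u] IH //; rewrite -IH; apply: eq_chains => U _.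
case: U => [|[c1 v1] [|[c2 v2] [|b U]]] //=; do ?case: ifP => _ /=; ring.
Qed.

Lemma chains0 u h : (forall U, irred (head false u) (last false u) U -> h U = 0) ->
  chains u h = 0.
Proof.
move=> h0; rewrite (@eq_chains u h (fun U => h U + (-1) * h U)).
  by rewrite chains_linear; ring.
by move=> U iU; rewrite h0 //; ring.
Qed.

(** A letter [l'] leaves a block of colour [~~ l'] on top, whereas growing by [l] needs one of
    colour [l]. *)
Lemma chains_path u h : ~~ sorted (fun x y => x != y) u -> chains u h = 0.
Proof.
elim: u h => [|l u IH] h //=; case: u IH => [|l' u] //= IH.
rewrite negb_and => /orP[|/IH ->//]; rewrite negbK => /eqP ell.
apply: (@chains0 (l' :: u)) => -[|[c v] U] //= /and5P[/eqP-> _ _ _ _].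
by rewrite ell; case: (l').
Qed.

(** By [chains_path] the letters alternate. The chain can be emptied by [l] only when it consists of
    two blocks, the bottom one of colour [~~ l]; that colour is the last letter of the word. *)
Lemma prod_cumulant_diag : rdiag prod_cumulant.
Proof.
move=> [|l u] //=; case: (boolP (sorted (fun x y => x != y) u)) => [su|/chains_path ->//].
case: u su => [|l' u] //= su nalt.
apply: (@chains0 (l' :: u)) => -[|[c v] U] //= /and5P[/eqP-> v0 hv lv /andP[bot inU]].
case: eqP => // ell; case: U lv bot inU => [|[c2 v2] U2] /=;
  first by rewrite /closed /= mulr0 addr0.
move=> lv bot /and5P[v20 hv2 lv2 bot2 inU2].
rewrite /closed /= !add0r; case: eqP => ec2; last by rewrite mulr0.
case: U2 lv2 bot2 {inU2} => [|b U2] lv2 /= bot2; last by rewrite !mulr0.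
case/negP: nalt; rewrite su -(eqP bot2) ec2 -ell negbK; by case: (l').
Qed.

(** * The compressed product and the balance of powers of [t] *)

Section Scaled.
Variable t : F.
Hypothesis t0 : t != 0.

Definition sk c w : F := t * k c w.

(** With [x] of colour [true] and [y] of colour [false], the letter [false] gives [x p y] and the
    letter [true] gives its adjoint. *)
Definition bletters (l : bool) : seq letter := [:: Some (~~ l, l); None; Some (l, l)].

Definition bstep (l : bool) (g : stack -> F) (S : stack) : F :=
  t^-1 * run t sk (bletters l) g S.

Fixpoint emb U : stack :=
  match U with
  | [::] => [::]
  | b :: U' => Some b :: (if U' is [::] then [::] else None :: emb U')
  end.

(* A chain of [m] open blocks has [m - 1] marks in between. *)
Definition weight U : F := t ^- (size U).-1.

Definition glue (g : stack -> F) (S : stack) U : F := weight U * g (emb U ++ S).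

(** The powers of [t] balance in every branch. Opening a block adds a mark to [weight], which
    absorbs the [t^-1] of [bstep]. Closing a block yields the factor [t] of [sk]. Reaching below a
    mark yields another [t] and removes that mark from [weight]. When the last two blocks close, one
    factor [t] remains: it is the [t] in front of the new cumulant. *)
Lemma bstep_irred m l l0 g S U : irred m l0 U ->
  weight U * bstep l g (emb U ++ S) =
  weight U * (t^-1 * g (Some (~~ l, [:: l]) :: None :: Some (l, [:: l]) :: emb U ++ S)) +
  grow l (proper (glue g S)) U + t * grow l closed U * g S.
Proof.
have ks c x : k c [:: x] = 0 by apply: kdiag; rewrite /= eqxx.
case: U => [|[c1 v1] U1] //= /and5P[/eqP ec v0 hv lv /andP[bot inU]].
rewrite /bstep /= /sk !ks /= /glue /closed /weight.
case: U1 lv bot inU => [|[c2 v2] U2] /= /eqP lv bot.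
  move=> _; have := @kdiag_same c1 c1 v1 v0 lv.
  pose simpl0 := (mulr0, mul0r, addr0, add0r, expr0, invr1, mul1r).
  by case: (l) c1 ec lv bot => [] [] //= _ _ _ E; rewrite ?E ?simpl0 //; field.
pose simpl0 := (mulr0, mul0r, addr0, add0r).
case/and5P=> v20 /eqP hv2 /eqP lv2 bot2 inU2.
case: U2 lv2 bot2 inU2 => [|b U2] lv2 bot2 inU2.
  by case: (l) c1 c2 ec lv bot hv2 lv2 bot2 => [] [] [] //= *;
     rewrite ?simpl0 ?expr0 ?invr1 ?mulr1 ?mul1r //; field.
(* With three or more blocks the second one cannot close, for the reason given at [eq_grow]. *)
have E c : k c (~~ c2 :: v2) = 0 by apply: kdiag_same.
rewrite /= !exprS !invfM; move: (t ^+ size U2)^-1 => X.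
by case: (l) c1 c2 ec lv bot hv2 lv2 bot2 E => [] [] [] //= _ _ _ _ _ _ E;
   rewrite ?E ?simpl0 //; field.
Qed.

(* [spread] intertwines the three-letter model of [t^-1 x p y] with the one-letter
   model of [prod_cumulant]: an open block stands for the chains it may hide. *)
Fixpoint spread (g : stack -> F) (S : stack) : F :=
  match S with
  | [::] => g [::]
  | Some (_, u) :: S' => spread (fun S => chains u (glue g S)) S'
  | None :: S' => t * spread g S'
  end.

Definition fed (S : stack) :=
  all (fun b => if b is Some (c, u) then c && (u != [::]) else false) S.

Definition pk (_ : bool) w := t * prod_cumulant w.

Lemma eq_spread g g' S : g =1 g' -> spread g S = spread g' S.
Proof.
elim: S g g' => [|[[c u]|] S IH] g g' e //=; last by rewrite (IH _ _ e).
by apply: IH => S'; apply: eq_chains => U _; rewrite /glue e.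
Qed.

Lemma spread_linear a g g' S :
  spread (fun S => g S + a * g' S) S = spread g S + a * spread g' S.
Proof.
elim: S g g' => [|[[c u]|] S IH] g g' //=; last by rewrite IH; ring.
rewrite -IH; apply: eq_spread => S'; rewrite -chains_linear.
by apply: eq_chains => U _; rewrite /glue; ring.
Qed.

Lemma spread0 S : spread (fun=> 0) S = 0.
Proof. by rewrite (@eq_spread _ (fun=> 0 + (-1) * 0)) ?spread_linear => [|S']; ring. Qed.

Lemma spread_scale a g S : spread (fun S => a * g S) S = a * spread g S.
Proof.
by rewrite -[RHS]add0r -(spread0 S) -spread_linear; apply: eq_spread => S'; rewrite add0r.
Qed.

(** The three terms of [bstep_irred] are the three moves of the one-letter model: opening a nested
    group, growing the top one, closing it. Opening and closing with one letter is absent on both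
    sides, since first cumulants vanish. *)
Lemma spread_step l g S : fed S ->
  step t pk (Some (true, l)) (spread g) S = spread (bstep l g) S.
Proof.
case: S => [|[[c u]|] S] //=.
  rewrite /pk /= /glue /weight /= /bstep /= /sk !kdiag /= ?eqxx // .
  by case: (l) => /=; rewrite !(mulr0, mul0r, addr0) expr1.
case/andP=> /andP[-> u0] fS /=.
have -> : pk true [:: l] = 0 by rewrite /pk /= mulr0.
rewrite mul0r addr0 -spread_linear -[X in _ + X]mul1r -spread_linear.
apply: eq_spread => S'.
transitivity (chains u (fun U => weight U *
    (t^-1 * g (Some (~~ l, [:: l]) :: None :: Some (l, [:: l]) :: emb U ++ S'))) +
    1 * (chains (l :: u) (glue g S') + g S' * t * chains u (grow l closed))).
  congr (_ + 1 * (_ + _)); last by rewrite /pk /=; ring.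
have -> : chains (l :: u) (glue g S') = chains u (grow l (proper (glue g S'))) by case: (u) u0.
rewrite -chains_linear -chains_linear; apply: eq_chains => U iU.
rewrite [glue (bstep l g) S' U]/glue (bstep_irred _ _ _ iU) /glue; ring.
Qed.

Definition bword (w : seq bool) : seq letter := flatten (map bletters w).

Lemma spread_run w g S : fed S ->
  run t pk (map (fun l => Some (true, l)) w) (spread g) S =
  t ^- size w * spread (run t sk (bword w) g) S.
Proof.
elim/last_ind: w S => [|w l IH] S fS; first by rewrite /= expr0 invr1 mul1r.
rewrite map_rcons run_rcons.
pose G S := t ^- size w * spread (run t sk (bword w) g) S.
transitivity (step t pk (Some (true, l)) G S).
  case: S fS => [|[[[] u]|] S] // fS; rewrite /step /extend ?eqxx !IH //.
  - by case/andP: fS.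
  - by case/andP: fS => _ fS; apply/andP.
have -> : step t pk (Some (true, l)) G S =
    t ^- size w * step t pk (Some (true, l)) (spread (run t sk (bword w) g)) S.
  by case: S fS => [|[[[] u]|] S] //= _; rewrite /G /=; ring.
rewrite spread_step // /bword map_rcons flatten_rcons run_cat size_rcons.
by rewrite exprSr invfM spread_scale; ring.
Qed.

Lemma model_prod w : model t sk (bword w) =
  t ^+ size w * model t pk (map (fun l => Some (true, l)) w).
Proof.
(* A chain starts with an open block or is empty, and an open block kills [vac]; the empty chain is
   not [irred]. *)
have sv : vac t =1 spread (vac t).
  elim=> [|[[c u]|] S IH] //=; last by rewrite IH.
  rewrite -(spread0 S); apply: eq_spread => S'; apply/esym/chains0.
  by case=> [|[c' v] [|b U]] // _; rewrite /glue /= mulr0.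
rewrite /model (eq_run t pk _ sv) spread_run //= mulrA divff ?mul1r //.
exact: expf_neq0.
Qed.

End Scaled.
End ProductCumulants.

(** * Non-crossing sums and the stack *)

Section OrderedSets.
Variable n : nat.
Implicit Types (A B C X Y : {set 'I_n}) (pi : {set {set 'I_n}}).

Lemma enum_sorted A : sorted (fun i j : 'I_n => (i < j)%N) (enum A).
Proof.
rewrite /enum_mem; apply: sorted_filter; first by move=> y x z; apply: ltn_trans.
have : sorted ltn (map val (enum 'I_n)) by rewrite val_enum_ord iota_ltn_sorted.
by rewrite sorted_map enumT.
Qed.

Lemma eq_enum_sorted A (s : seq 'I_n) : sorted (fun i j : 'I_n => (i < j)%N) s ->
  s =i A -> enum A = s.
Proof.
move=> ss e; apply: (@irr_sorted_eq _ (fun i j : 'I_n => (i < j)%N)) => //.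
- by move=> y x z; apply: ltn_trans.
- by move=> x; rewrite /= ltnn.
- exact: enum_sorted.
- by move=> x; rewrite mem_enum e.
Qed.

Definition before A B := forall i j, i \in A -> j \in B -> (i < j)%N.

Lemma enum_before A B : before A B -> enum (A :|: B) = enum A ++ enum B.
Proof.
move=> AB; apply: eq_enum_sorted; last by move=> x; rewrite mem_cat !mem_enum inE.
have tr : transitive (fun i j : 'I_n => (i < j)%N) by move=> y x z; apply: ltn_trans.
rewrite (sorted_pairwise tr) pairwise_cat -!(sorted_pairwise tr) !enum_sorted !andbT.
by apply/allrelP => x y; rewrite !mem_enum; apply: AB.
Qed.

Lemma enum1 (j : 'I_n) : enum [set j] = [:: j].
Proof. by apply: eq_enum_sorted => // x; rewrite !inE. Qed.

Lemma noncrossingP pi : reflect (forall B B', B \in pi -> B' \in pi -> B != B' ->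
    forall a b c d, a \in B -> b \in B' -> c \in B -> d \in B' ->
    (a < b)%N -> (b < c)%N -> (c < d)%N -> False) (noncrossing pi).
Proof.
apply: (iffP forall_inP) => [h B B' Bp B'p BB' a b c d aB bB cB dB ab bc cd|h B Bp].
  have /forall_inP/(_ _ B'p)/implyP/(_ BB')/negP[] := h _ Bp.
  apply/exists_inP; exists a => //; apply/exists_inP; exists b => //.
  by apply/exists_inP; exists c => //; apply/exists_inP; exists d; rewrite ?ab ?bc.
apply/forall_inP => B' B'p; apply/implyP => BB'; apply/negP.
case/exists_inP=> a aB /exists_inP[b bB] /exists_inP[c cB] /exists_inP[d dB].
by case/andP => /andP[ab bc] cd; apply: (h B B' Bp B'p BB' a b c d).
Qed.

Definition NCp A : {set {set {set 'I_n}}} :=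
  [set pi | finset.partition pi A && noncrossing pi].

Definition splits X Y pi := [forall B in pi, (B \subset X) || (B \subset Y)].

Lemma partitionU X Y pi1 pi2 : [disjoint X & Y] ->
  finset.partition pi1 X -> finset.partition pi2 Y -> finset.partition (pi1 :|: pi2) (X :|: Y).
Proof.
move=> XY /and3P[/eqP c1 t1 n1] /and3P[/eqP c2 t2 n2].
apply/and3P; split.
- by rewrite /cover bigcup_setU -c1 -c2.
- apply/trivIsetP => B B'; rewrite !inE.
  have sub pi Z D : cover pi = Z -> D \in pi -> D \subset Z.
    by move=> <- Dp; apply: bigcup_sup.
  case/orP=> Bp /orP[] B'p BB'.
  + by move/trivIsetP: t1; apply.
  + by apply: disjointWl (sub _ _ _ c1 Bp) _; apply: disjointWr (sub _ _ _ c2 B'p) _.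
  + rewrite disjoint_sym; apply: disjointWl (sub _ _ _ c1 B'p) _.
    by apply: disjointWr (sub _ _ _ c2 Bp) _.
  + by move/trivIsetP: t2; apply.
- by rewrite inE (negbTE n1).
Qed.

Lemma block_sub pi X B : finset.partition pi X -> B \in pi -> B \subset X.
Proof. by move=> /cover_partition <- Bp; apply: bigcup_sup. Qed.

Lemma block_neq0 pi X B : finset.partition pi X -> B \in pi -> exists x, x \in B.
Proof.
case/and3P=> _ _ n0 Bp; apply/set0Pn; apply: contraNneq n0 => <-; exact: Bp.
Qed.

Lemma block_eq pi X B B' x : finset.partition pi X -> B \in pi -> B' \in pi ->
  x \in B -> x \in B' -> B = B'.
Proof.
case/and3P=> _ /trivIsetP tp _ Bp B'p xB xB'; apply/eqP; apply: contraT => BB'.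
by have /pred0P/(_ x) := tp _ _ Bp B'p BB'; rewrite /= xB xB'.
Qed.

Definition within X pi := [set B in pi | B \subset X].

Lemma partition_within X Y pi : [disjoint X & Y] -> finset.partition pi (X :|: Y) ->
  splits X Y pi -> finset.partition (within X pi) X.
Proof.
move=> XY pp /forall_inP sp; apply/and3P; split.
- apply/eqP/setP => x; apply/bigcupP/idP => [[B]|xX].
    by rewrite inE => /andP[_ /subsetP h] /h.
  have : x \in X :|: Y by rewrite inE xX.
  rewrite -(cover_partition pp) => /bigcupP[B Bp xB]; exists B => //.
  rewrite inE Bp /=; case/orP: (sp _ Bp) => // /subsetP/(_ _ xB) xY.
  by have /pred0P/(_ x) := XY; rewrite /= xX xY.
- apply/trivIsetP => B B'; rewrite !inE => /andP[Bp _] /andP[B'p _].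
  by case/and3P: pp => _ /trivIsetP + _; apply.
- by rewrite inE; case/and3P: pp => _ _ /negbTE->.
Qed.

Lemma withinU X Y pi1 pi2 : [disjoint X & Y] ->
  finset.partition pi1 X -> finset.partition pi2 Y -> within X (pi1 :|: pi2) = pi1.
Proof.
move=> XY p1 p2; apply/setP => B; rewrite !inE.
apply/andP/idP => [[/orP[//|Bp] BX]|Bp]; last by rewrite Bp (block_sub p1).
have [x xB] := block_neq0 p2 Bp.
have /pred0P/(_ x) := XY; rewrite /= (subsetP BX) //.
by rewrite (subsetP (block_sub p2 Bp)).
Qed.

Definition convex X Y := forall x y z, x \in X -> y \in Y -> z \in X ->
  (x < y)%N -> (y < z)%N -> False.

(** Whichever of the two blocks lies in [X], a crossing would put a point of [Y] between two points
    of [X]. *)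
Lemma noncrossingU X Y pi1 pi2 : convex X Y ->
  finset.partition pi1 X -> finset.partition pi2 Y ->
  noncrossing pi1 -> noncrossing pi2 -> noncrossing (pi1 :|: pi2).
Proof.
move=> XY p1 p2 /noncrossingP n1 /noncrossingP n2; apply/noncrossingP.
move=> B B'; rewrite !inE => /orP[] Bp /orP[] B'p BB' a b c d aB bB cB dB ab bc cd.
- exact: (n1 _ _ Bp B'p BB' a b c d).
- apply: (XY a b c) => //; first exact: (subsetP (block_sub p1 Bp)).
    exact: (subsetP (block_sub p2 B'p)).
  exact: (subsetP (block_sub p1 Bp)).
- apply: (XY b c d) => //; first exact: (subsetP (block_sub p1 B'p)).
    exact: (subsetP (block_sub p2 Bp)).
  exact: (subsetP (block_sub p1 B'p)).
- exact: (n2 _ _ Bp B'p BB' a b c d).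
Qed.

Lemma noncrossing_within X pi : noncrossing pi -> noncrossing (within X pi).
Proof.
move=> /noncrossingP np; apply/noncrossingP => B B'; rewrite !inE.
by case/andP=> Bp _ /andP[B'p _]; apply: np.
Qed.

Variable (F : comNzRingType).

(** Taking unions and taking [within] are mutually inverse on the partitions that split. The
    condition [Q] may constrain the part on [Y] only, which leaves a full sum over [X]. *)
Lemma split_sum X Y (f : {set 'I_n} -> F) (Q Q' : pred {set {set 'I_n}}) :
  [disjoint X & Y] -> convex X Y ->
  (forall pi1 pi2, pi1 \in NCp X -> pi2 \in NCp Y -> Q (pi1 :|: pi2) = Q' pi2) ->
  (forall pi, pi \in NCp (X :|: Y) -> Q pi -> splits X Y pi) ->
  \sum_(pi in NCp (X :|: Y) | Q pi) \prod_(B in pi) f B =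
  (\sum_(pi in NCp X) \prod_(B in pi) f B) *
  (\sum_(pi in NCp Y | Q' pi) \prod_(B in pi) f B).
Proof.
move=> XY cXY QU Qs; rewrite big_distrlr /= pair_big /=.
have YX : [disjoint Y & X] by rewrite disjoint_sym.
rewrite (reindex_onto (fun p => p.1 :|: p.2) (fun pi => (within X pi, within Y pi))) /=.
  apply: eq_big => [[pi1 pi2]|[pi1 pi2]] /=; last first.
    case/andP=> /andP[/[!inE] /andP[pp np] Qp] /eqP[e1 e2].
    have sp : splits X Y (pi1 :|: pi2) by apply: Qs => //; rewrite inE pp.
    have p1 : finset.partition pi1 X by rewrite -e1; apply: partition_within XY pp sp.
    have p2 : finset.partition pi2 Y.
      rewrite -e2; apply: partition_within YX _ _; first by rewrite [Y :|: X]setUC.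
      by apply/forall_inP => B /(forall_inP sp); rewrite orbC.
    rewrite (eq_bigl [in [predU pi1 & pi2]]) => [|B]; last by rewrite !inE.
    rewrite bigU //; apply/pred0P => B /=; apply/negbTE/negP => /andP[B1 B2].
    have [x xB] := block_neq0 p1 B1; have /pred0P/(_ x) := XY.
    by rewrite /= (subsetP (block_sub p1 B1)) // (subsetP (block_sub p2 B2)).
  apply/idP/idP.
    case/andP=> /andP[/[!inE] /andP[pp np] Qp] /eqP[e1 e2].
    have sp : splits X Y (pi1 :|: pi2) by apply: Qs => //; rewrite inE pp.
    have p1 : pi1 \in NCp X.
      rewrite -e1 inE noncrossing_within // andbT.
      by apply: partition_within XY pp sp.
    have p2 : pi2 \in NCp Y.
      rewrite -e2 inE noncrossing_within // andbT.
      apply: partition_within YX _ _; first by rewrite [Y :|: X]setUC.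
      by apply/forall_inP => B /(forall_inP sp); rewrite orbC.
    move: (p1) (p2); rewrite !inE => -> ->.
    by rewrite -(QU _ _ p1 p2) Qp.
  case/andP=> p1 /andP[p2 q2]; rewrite QU //.
  move: p1 p2; rewrite !inE => /andP[p1 n1] /andP[p2 n2].
  rewrite partitionU // (noncrossingU cXY) // q2 (withinU XY) //.
  by rewrite [pi1 :|: pi2]setUC (withinU YX) // !eqxx.
move=> pi /andP[/[!inE] /andP[pp np] Qp].
have sp : splits X Y pi by apply: Qs => //; rewrite inE pp.
apply/setP => B; rewrite !inE -andb_orr; apply: andb_idr => Bp.
exact: (forall_inP sp).
Qed.

Definition wsum (f : {set 'I_n} -> F) A := \sum_(pi in NCp A) \prod_(B in pi) f B.

Definition touching (C : {set 'I_n}) pi := [exists B in pi, C \subset B].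

(** Here [C] is a partially read block that may still receive elements of [A]. *)
Definition psum (f : {set 'I_n} -> F) A C :=
  \sum_(pi in NCp (A :|: C) | touching C pi) \prod_(B in pi) f B.

Definition above (j : 'I_n) : {set 'I_n} := [set i : 'I_n | (j < i)%N].
Definition below (j : 'I_n) : {set 'I_n} := [set i : 'I_n | (i < j)%N].

Lemma NCp_single C : C != set0 ->
  (fun pi => (pi \in NCp C) && (C \in pi)) =1 pred1 [set C].
Proof.
move=> C0 pi; rewrite !inE; apply/idP/eqP => [/andP[/andP[pp _] Cp]|->].
  apply/setP => B; rewrite inE; apply/idP/eqP => [Bp|->//].
  have [x xB] := block_neq0 pp Bp.
  by apply: (block_eq pp Bp Cp xB); apply: (subsetP (block_sub pp Bp)).
rewrite inE eqxx andbT; apply/andP; split.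
  apply/and3P; split; first by rewrite /cover big_set1.
    by apply/trivIsetP => B B'; rewrite !inE => /eqP-> /eqP->; rewrite eqxx.
  by rewrite inE eq_sym.
by apply/noncrossingP => B B'; rewrite !inE => /eqP-> /eqP->; rewrite eqxx.
Qed.

Lemma psum_closed f A C : before A C -> C != set0 ->
  \sum_(pi in NCp (A :|: C) | C \in pi) \prod_(B in pi) f B = wsum f A * f C.
Proof.
move=> AC C0; have [c cC] := set0Pn _ C0.
have dAC : [disjoint A & C].
  apply/pred0P => x /=; apply/negbTE/negP => /andP[xA xC].
  by have := AC _ _ xA xC; rewrite ltnn.
rewrite (split_sum f (Q' := fun pi => C \in pi)) //.
- congr (_ * _); rewrite (eq_bigl _ _ (NCp_single C0)) big_pred1_eq.
  by rewrite big_set1.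
- move=> x y z xA yC zA _ yz; have := AC _ _ zA yC.
  by rewrite ltnNge ltnW.
- move=> pi1 pi2; rewrite !inE => /andP[p1 _] /andP[p2 _].
  case: (boolP (C \in pi1)) => // Cp; have := subsetP (block_sub p1 Cp) _ cC => cA.
  by have /pred0P/(_ c) := dAC; rewrite /= cA cC.
- move=> pi; rewrite inE => /andP[pp _] Cp; apply/forall_inP => B Bp.
  case: (altP (B =P C)) => [->|BC]; first by rewrite subxx orbT.
  apply/orP; left; apply/subsetP => x xB.
  have := subsetP (block_sub pp Bp) _ xB; rewrite inE => /orP[//|xC].
  by rewrite (block_eq pp Bp Cp xB xC) eqxx in BC.
Qed.

(** The point [j] is the last element of [A] in the block of [C], hence the next one to join it when
    reading from the right. *)
Definition next_in A (C : {set 'I_n}) (j : 'I_n) pi :=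
  [exists B in pi, (j |: C \subset B) && (B :&: (A :&: above j) == set0)].

(** A block with points on both sides of [j] would cross the block that contains [j] and [C]. The
    points of [A] above [j] therefore form a separate partition. *)
Lemma psum_next f A C j : before A C -> C != set0 -> j \in A ->
  \sum_(pi in NCp (A :|: C) | next_in A C j pi) \prod_(B in pi) f B =
  wsum f (A :&: above j) * psum f (A :&: below j) (j |: C).
Proof.
move=> AC C0 jA; have [c cC] := set0Pn _ C0.
have eA : A :|: C = (A :&: above j) :|: ((A :&: below j) :|: (j |: C)).
  apply/setP => i; rewrite !inE; case: (ltngtP i j) => [||/val_inj->].
  - by rewrite andbF andbT /=; case: eqP => // ->; rewrite jA.
  - by rewrite andbF andbT /=; case: eqP => // ->; rewrite jA.
  - by rewrite eqxx jA orbT.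
have dXY : [disjoint A :&: above j & (A :&: below j) :|: (j |: C)].
  apply/pred0P => x /=; apply/negbTE/negP; rewrite !inE.
  case/andP=> /andP[xA jx] /or3P[/andP[_ xj]|/eqP e|xC].
  - by have := ltn_trans jx xj; rewrite ltnn.
  - by rewrite e ltnn in jx.
  - by have := AC _ _ xA xC; rewrite ltnn.
rewrite eA (split_sum f (Q' := touching (j |: C))) //.
- move=> x y z; rewrite !inE => /andP[xA jx] yY /andP[zA jz] xy yz.
  case/or3P: yY => [/andP[_ yj]|/eqP e|yC]; move: jx xy yz; rewrite ?e; try lia.
  by have := AC _ _ zA yC; lia.
- move=> pi1 pi2; rewrite !inE => /andP[p1 _] /andP[p2 _].
  apply/exists_inP/exists_inP => -[B Bp].
    case/andP=> jB dB; exists B => //; move: Bp; rewrite inE => /orP[Bp|//].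
    have [x xB] := block_neq0 p1 Bp; have xX := subsetP (block_sub p1 Bp) _ xB.
    by have := in_set0 x; rewrite -(eqP dB) !inE xB; move: xX; rewrite !inE => ->.
  move=> jB; exists B; first by rewrite inE Bp orbT.
  rewrite jB /=; apply/set0Pn => -[x]; rewrite inE => /andP[xB xX].
  have /pred0P/(_ x) := dXY; rewrite /= xX.
  by rewrite (subsetP (block_sub p2 Bp) _ xB).
move=> pi; rewrite -eA inE => /andP[pp /noncrossingP np].
case/exists_inP=> B Bp /andP[/subsetP jCB dB]; apply/forall_inP => B' B'p.
have jB : j \in B by apply: jCB; rewrite !inE eqxx.
have cB : c \in B by apply: jCB; rewrite !inE cC orbT.
case: (boolP (B' \subset A :&: above j)) => //= /subsetPn[y yB' yX].
apply/subsetP => x xB'.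
have := subsetP (block_sub pp B'p) _ xB'; rewrite eA inE => /orP[xX|//].
have BB' : B' != B.
  apply: contraTneq xX => e; rewrite -e in dB.
  by apply/negP => xX; have := in_set0 x; rewrite -(eqP dB) in_setI xB' xX.
have yj : (y < j)%N.
  have := subsetP (block_sub pp B'p) _ yB'; rewrite eA inE (negbTE yX) /= !inE.
  case/or3P=> [/andP[]//|/eqP e|yC].
    by rewrite (block_eq pp B'p Bp yB' _) ?eqxx // e in BB'.
  have yB : y \in B by apply: jCB; rewrite !inE yC orbT.
  by rewrite (block_eq pp B'p Bp yB' yB) eqxx in BB'.
move: xX; rewrite !inE => /andP[xA jx].
by case: (np _ _ B'p Bp BB' y j x c) => //; apply: AC.
Qed.

(** Either the block of [C] is complete, or it has a largest element [j] in [A]; the sum over [j]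
    has exactly one term for each partition of the second kind. This is the recursion that the stack
    obeys. *)
Lemma psum_rec f A C : before A C -> C != set0 ->
  psum f A C = wsum f A * f C +
    \sum_(j in A) wsum f (A :&: above j) * psum f (A :&: below j) (j |: C).
Proof.
move=> AC C0; have [c cC] := set0Pn _ C0.
rewrite -psum_closed // /psum (bigID (fun pi => C \in pi)) /=; congr (_ + _).
  apply: eq_bigl => pi; rewrite -andbA; congr (_ && _).
  by apply: andb_idl => Cp; apply/exists_inP; exists C.
rewrite (eq_bigr (fun j => \sum_(pi in NCp (A :|: C) | next_in A C j pi) \prod_(B in pi) f B));
  last by move=> j jA; rewrite psum_next.
rewrite (exchange_big_dep (fun pi => pi \in NCp (A :|: C))) /=; last by move=> j pi _ /andP[].
rewrite (eq_bigl (fun pi => (pi \in NCp (A :|: C)) && (touching C pi && (C \notin pi))));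
  last by move=> pi; rewrite andbA.
rewrite big_mkcondr; apply: eq_bigr => pi piN.
move: (piN); rewrite inE => /andP[pp np].
have jC j : j \in A -> j \in C -> False by move=> jA /(AC _ _ jA); rewrite ltnn.
case: ifPn => [/andP[/exists_inP[B Bp CB] Cp]|no]; last first.
  rewrite big_pred0 // => j; apply/negbTE; apply: contra no => /andP[jA /andP[_]].
  case/exists_inP=> B Bp /andP[jCB _]; apply/andP; split.
    by apply/exists_inP; exists B => //; apply: subset_trans jCB; apply: subsetUr.
  apply/negP => Cp; apply: (jC j jA).
  have -> : C = B.
    by apply: (block_eq pp Cp Bp cC); apply: (subsetP jCB); rewrite !inE cC orbT.
  by apply: (subsetP jCB); rewrite !inE eqxx.
have /set0Pn[i0 i0D] : B :&: A != set0.
  apply: contra Cp => /eqP BA; suff -> : C = B by [].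
  apply/eqP; rewrite eqEsubset CB; apply/subsetP => x xB.
  have := subsetP (block_sub pp Bp) _ xB; rewrite inE => /orP[xA|//].
  by have := in_set0 x; rewrite -BA inE xB xA.
case: (@arg_maxnP _ i0 [in B :&: A] (@nat_of_ord n) i0D) => j /= jBA jmax.
rewrite (big_pred1 j) // => j'; apply/andP/eqP => [[j'A /andP[_]]|->].
  case/exists_inP=> B' B'p /andP[jCB dB].
  have e : B' = B.
    apply: (block_eq pp B'p Bp (x := c)); last exact: (subsetP CB).
    by apply: (subsetP jCB); rewrite !inE cC orbT.
  rewrite {}e {B' B'p} in jCB dB.
  have j'B : j' \in B by apply: (subsetP jCB); rewrite !inE eqxx.
  have le : (j' <= j)%N by apply: jmax; rewrite inE j'B.
  apply/val_inj/eqP; rewrite eqn_leq le /= leqNgt; apply/negP => lt.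
  have := in_set0 j; rewrite -(eqP dB) !inE lt.
  by move: jBA; rewrite inE => /andP[-> ->].
move: jBA; rewrite inE => /andP[jB jA]; split=> //; rewrite pp np /=.
apply/exists_inP; exists B => //; apply/andP; split.
  by apply/subsetP => x; rewrite !inE => /orP[/eqP->//|/(subsetP CB)].
apply/set0Pn => -[x]; rewrite !inE => /and3P[xB xA jx].
by have := jmax x; rewrite inE xB xA leqNgt jx => /(_ isT).
Qed.

End OrderedSets.

(** * Non-crossing sums computed by the one-colour model *)

Section Bridge.
Variables (F : comNzRingType) (t : F) (f : seq bool -> F).

Definition kmono (_ : bool) w := f w.
Definition mword (w : seq bool) : seq letter := map (fun l => Some (true, l)) w.
Definition mmodel (w : seq bool) : F := model t kmono (mword w).

(** The counterpart of [psum]: the block [v] has just received a letter and either stays open or is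
    closed before [w] is read. *)
Definition ends (w v : seq bool) : F :=
  run t kmono (mword w) (vac t) [:: Some (true, v)] + f v * mmodel w.

Lemma mmodel_rcons w l : mmodel (rcons w l) = ends w [:: l].
Proof. by rewrite /mmodel /mword map_rcons /model run_rcons /= addr0. Qed.

(** An open bottom block must be extended by some later letter. If [j] is the first to do so,
    everything above has been closed by the letters to the right of [j], which see only [S], and the
    letters to the left start from the extended block. *)
Lemma run_bottom n (b : 'I_n -> bool) (s : seq 'I_n) (S : stack) u :
  sorted (fun i j : 'I_n => (i < j)%N) s -> pure true S ->
  run t kmono (mword (map b s)) (vac t) (S ++ [:: Some (true, u)]) =
  \sum_(j <- s) run t kmono (mword (map b [seq i : 'I_n <- s | (j < i)%N])) (vac t) S *
     ends (map b [seq i : 'I_n <- s | (i < j)%N]) (b j :: u).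
Proof.
elim/last_ind: s S => [|s l IH] S.
  by case: S => [|[[c v]|] S] //=; rewrite big_nil.
move=> ss pS.
have tr : transitive (fun i j : 'I_n => (i < j)%N) by move=> y x z; apply: ltn_trans.
have [sl ssort] : all (fun i : 'I_n => (i < l)%N) s /\ sorted (fun i j : 'I_n => (i < j)%N) s.
  move: ss; rewrite !(sorted_pairwise tr) pairwise_rcons => /andP[].
  by move=> h1 h2; split=> //; apply: sub_all h1.
rewrite big_rcons /=.
have -> : [seq i : 'I_n <- rcons s l | (l < i)%N] = [::].
  rewrite filter_rcons ltnn; apply/eqP; rewrite -size_eq0 size_filter -leqn0 leqNgt -has_count.
  by apply/hasPn => i /(allP sl); rewrite -leqNgt; apply: ltnW.
have -> : [seq i : 'I_n <- rcons s l | (i < l)%N] = s.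
  by rewrite filter_rcons ltnn; apply/all_filterP.
rewrite (eq_big_seq (fun j : 'I_n => step t kmono (Some (true, b l))
    (fun S => run t kmono (mword (map b [seq i : 'I_n <- s | (j < i)%N])) (vac t) S *
       ends (map b [seq i : 'I_n <- s | (i < j)%N]) (b j :: u)) S)); last first.
  move=> j js; rewrite !filter_rcons (allP sl) //.
  have -> : (l < j)%N = false by apply/negbTE; rewrite -leqNgt ltnW // (allP sl).
  rewrite map_rcons /mword map_rcons run_rcons.
  case: S pS => [|[[[] v]|] S] //= _; ring.
rewrite map_rcons /mword map_rcons run_rcons -/(mword _).
case: S pS => [|[[[] v]|] S] //= pS.
  rewrite (IH [:: Some (true, [:: b l])]) // (IH [::]) //.
  rewrite mulr_sumr -!big_split /= mul1r; congr (_ + _).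
  by apply: eq_bigr => j _; rewrite addr0 -/(mword _); ring.
rewrite (IH (Some (true, [:: b l]) :: Some (true, v) :: S)) // (IH (Some (true, v) :: S)) //.
rewrite (IH (Some (true, b l :: v) :: S)) // (IH S) //.
rewrite !mulr_sumr -!big_split /= mul0r addr0.
by apply: eq_bigr => j _; rewrite -/(mword _); ring.
Qed.

Variable w : word.
Implicit Types A C : {set 'I_(size w)}.

Let fw (B : {set 'I_(size w)}) := f (subword B).

Lemma subword_before A C : before A C -> subword (A :|: C) = subword A ++ subword C.
Proof. by move=> AC; rewrite /subword enum_before // map_cat. Qed.

Lemma enum_setI A (B : {set 'I_(size w)}) : enum (A :&: B) = [seq i <- enum A | i \in B].
Proof.
apply: eq_enum_sorted => [|x]; last by rewrite mem_filter mem_enum inE andbC.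
by apply: sorted_filter (enum_sorted A) => y x z; apply: ltn_trans.
Qed.

(** The recursions [psum_rec] and [run_bottom], for an empty [S], match term by term; the complete
    sums are supplied for subsets of [A] only, as the induction in [wsum_model] requires. *)
Lemma psum_model A C :
    (forall B : {set 'I_(size w)}, B \subset A -> wsum fw B = mmodel (subword B)) ->
  before A C -> C != set0 -> psum fw A C = ends (subword A) (subword C).
Proof.
have [p] := ubnP #|A|; elim: p A C => // p IH A C; rewrite ltnS => Ap wA AC C0.
rewrite psum_rec // /ends addrC wA // mulrC; congr (_ + _).
have := @run_bottom _ (tnth (in_tuple w)) (enum A) [::] (subword C) (enum_sorted A) isT.
rewrite /= => ->; rewrite big_enum /=; apply: eq_bigr => j jA.
have jC : before [set j] C by move=> i c; rewrite inE => /eqP-> /(AC _ _ jA).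
rewrite wA ?subsetIl // IH //; first last.
- by apply/set0Pn; exists j; rewrite !inE eqxx.
- move=> i c; rewrite !inE => /andP[iA ij] /orP[/eqP->//|cC].
  exact: AC.
- by move=> B BA; apply: wA; apply: subset_trans BA (subsetIl _ _).
- apply: leq_trans Ap; apply: proper_card; apply/properP; split; first exact: subsetIl.
  by exists j; rewrite // !inE ltnn andbF.
rewrite subword_before // /mmodel /model.
congr (run _ _ (mword _) _ _ * ends _ _).
- by rewrite /subword enum_setI; congr map; apply: eq_filter => i; rewrite inE.
- by rewrite /subword enum_setI; congr map; apply: eq_filter => i; rewrite inE.
- by rewrite {1}/subword enum1.
Qed.

Lemma wsum_model A : wsum fw A = mmodel (subword A).
Proof.
have [m] := ubnP #|A|; elim: m A => // m IH A; rewrite ltnS => Am.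
case: (altP (A =P set0)) => [->|/set0Pn[i0 i0A]].
  rewrite /subword enum_set0 /= /mmodel /model /= /wsum (big_pred1 set0) ?big_set0 //.
  move=> pi; rewrite !inE; apply/andP/eqP => [[/and3P[/eqP c0 _ n0] _]|->].
    apply/setP => B; rewrite inE; apply/negP => Bp.
    have : B \subset cover pi by apply: bigcup_sup.
    by rewrite c0 subset0 => /eqP e; rewrite -e Bp in n0.
  split; last by apply/noncrossingP => B B'; rewrite inE.
  apply/and3P; split; rewrite ?inE // /cover ?big_set0 //.
  by apply/trivIsetP => B B'; rewrite inE.
(* The last letter of the subword opens the first block that is read. *)
case: (@arg_maxnP _ i0 [in A] (@nat_of_ord _) i0A) => j /= jA jmax.
have Aj : before (A :\ j) [set j].
  move=> i c; rewrite !inE => /andP[ij iA] /eqP->.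
  by rewrite ltn_neqAle jmax // andbT; apply: contra ij => /eqP/val_inj->.
have eA : A = (A :\ j) :|: [set j] by rewrite setUC setD1K.
have -> : wsum fw A = psum fw (A :\ j) [set j].
  rewrite /psum -eA /wsum; apply: eq_bigl => pi; apply/esym/andb_idr.
  rewrite inE => /andP[pp _].
  have : j \in cover pi by rewrite (cover_partition pp).
  by case/bigcupP=> B Bp jB; apply/exists_inP; exists B; rewrite ?sub1set.
rewrite psum_model //; last by apply/set0Pn; exists j; rewrite inE.
  have e1 : subword [set j] = [:: tnth (in_tuple w) j] by rewrite /subword enum1.
  by rewrite [in RHS]eA subword_before // e1 cats1 mmodel_rcons.
move=> B BA; apply: IH; apply: leq_trans Am; apply: proper_card.
apply: sub_proper_trans BA _; exact: properD1.
Qed.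

(** The value [t] is arbitrary here: without a projection no mark is pushed. *)
Lemma NC_sum_model :
  \sum_(pi in NC (size w)) \prod_(B in pi) f (subword B) = mmodel w.
Proof.
have e : subword (w := w) setT = w.
  by rewrite /subword enum_setT -enumT map_tnth_enum.
rewrite -[in RHS]e -wsum_model /wsum; apply: eq_bigl => pi.
by rewrite !inE.
Qed.

End Bridge.

(** * Moment-cumulant inversion *)

Section NCSums.
Variable F : comNzRingType.
Implicit Types (f : word -> F) (w : word).

Definition ncsum f w : F := \sum_(pi in NC (size w)) \prod_(B in pi) f (subword B).

Lemma subwordT w : subword [set: 'I_(size w)] = w.
Proof. by rewrite /subword enum_setT -enumT map_tnth_enum. Qed.

Lemma size_subword w (B : {set 'I_(size w)}) : size (subword B) = #|B|.
Proof. by rewrite /subword size_map -cardE. Qed.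

Lemma NC_top w : w != [::] -> [set [set: 'I_(size w)]] \in NC (size w).
Proof.
move=> w0; have s0 : [set: 'I_(size w)] != set0.
  by rewrite -card_gt0 cardsT card_ord lt0n size_eq0.
have := NCp_single s0 [set setT]; rewrite /= eqxx => /andP[].
by rewrite !inE.
Qed.

(** Every partition other than the one with a single block has proper subwords only. The system is
    thus triangular in the length of words, which gives existence ([cumulants]) and uniqueness
    ([ncsum_inj]) of its solution. *)
Lemma ncsum_lead f f' w : (forall v, (size v < size w)%N -> f v = f' v) -> w != [::] ->
  ncsum f w - f w = ncsum f' w - f' w.
Proof.
move=> e w0; have top := NC_top w0.
have main (g : word -> F) : ncsum g w - g w =
    \sum_(pi in NC (size w) | pi != [set setT]) \prod_(B in pi) g (subword B).
  by rewrite /ncsum (bigD1 _ top) /= big_set1 subwordT addrAC subrr add0r.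
rewrite !main; apply: eq_bigr => pi /andP[piN piT]; apply: eq_bigr => B Bp.
apply: e; rewrite size_subword; have := subset_leqif_cards (subsetT B).
case; rewrite cardsT card_ord leq_eqVlt => /orP[/eqP h|//] hh.
have BT : B = setT by apply/eqP; rewrite -hh h.
have s0 : [set: 'I_(size w)] != set0.
  by rewrite -card_gt0 cardsT card_ord lt0n size_eq0.
have := NCp_single s0 pi; rewrite /= -BT Bp andbT BT (negbTE piT) inE.
by move: piN; rewrite inE => ->.
Qed.

Fixpoint cumulants_upto (m : word -> F) n w : F :=
  if n is n'.+1 then
    if size w == n then m w - (ncsum (cumulants_upto m n') w - cumulants_upto m n' w)
    else cumulants_upto m n' w
  else 0.

Definition cumulants m w := cumulants_upto m (size w) w.

Lemma cumulants_uptoE m n w : (size w <= n)%N -> cumulants_upto m n w = cumulants m w.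
Proof.
elim: n => [|n IH]; first by rewrite leqn0 => /eqP s0; rewrite /cumulants s0.
rewrite leq_eqVlt => /orP[/eqP e|]; first by rewrite /cumulants e.
rewrite ltnS => lw; rewrite /= IH //; case: eqP => // e.
by rewrite e ltnn in lw.
Qed.

Lemma cumulantsP m w : w != [::] -> ncsum (cumulants m) w = m w.
Proof.
move=> w0; case e : (size w) => [|n]; first by move: w0; rewrite -size_eq0 e.
have E : cumulants m w = m w - (ncsum (cumulants_upto m n) w - cumulants_upto m n w).
  by rewrite /cumulants e /= e eqxx.
have h := @ncsum_lead (cumulants m) (cumulants_upto m n) w _ w0.
have {}h : ncsum (cumulants m) w - cumulants m w =
    ncsum (cumulants_upto m n) w - cumulants_upto m n w.
  by apply: h => v; rewrite e ltnS => /cumulants_uptoE ->.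
by rewrite -(subrK (cumulants m w) (ncsum _ _)) h E addrC subrK.
Qed.

Lemma cumulants_nil m : cumulants m [::] = 0. Proof. by []. Qed.

Lemma ncsum_inj f f' : f [::] = f' [::] -> (forall w, w != [::] -> ncsum f w = ncsum f' w) ->
  forall w, f w = f' w.
Proof.
move=> e0 e w; have [n] := ubnP (size w); elim: n w => // n IH w; rewrite ltnS => lw.
have [->//|w0] := eqVneq w [::].
have h : ncsum f w - f w = ncsum f' w - f' w.
  by apply: ncsum_lead w0 => v lv; apply: IH; apply: leq_trans lw.
by rewrite e // in h; move/addrI/oppr_inj: h.
Qed.

End NCSums.

Lemma flatten_alternating (l : bool) n :
  path (fun x y : bool => x != y) (~~ l) (flatten (nseq n [:: l; ~~ l])).
Proof. by elim: n => //= n ->; case: l. Qed.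

Lemma alternating_altb w : alternating w -> altb w.
Proof.
case=> m [m0 H]; case: m m0 H => [//|n] _ H.
have {H}[l ->] : exists l, w = flatten (nseq n.+1 [:: l; ~~ l]).
  by case: H => ->; [exists false|exists true].
have h := flatten_alternating l n; rewrite /= h andbT.
have -> : last (~~ l) (flatten (nseq n [:: l; ~~ l])) = ~~ l.
  by elim: (n) => //= n' ->.
by case: l {h}.
Qed.

Lemma altb_alternating w : altb w -> alternating w.
Proof.
case: w => [//|l u] /= /andP[pu lu].
suff [n e] : exists n, l :: u = flatten (nseq n.+1 [:: l; ~~ l]).
  by exists n.+1; split=> //; rewrite e; case: (l); [right|left].
have [m] := ubnP (size u); elim: m u pu lu => // m IH [|l1 [|l2 u]] //=.
- by rewrite eqxx.
- by move=> h _ _; exists 0%N; move: h; case: (l) (l1) => [] [].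
move=> /and3P[h1 h2 pu] lu; rewrite !ltnS => su.
have e1 : l1 = ~~ l by move: h1; case: (l) (l1) => [] [].
have e2 : l2 = l by move: h2; rewrite e1; case: (l) (l2) => [] [].
rewrite {}e2 in pu lu *; have [n en] := IH u pu lu (ltnW su).
by exists n.+1; rewrite e1 en.
Qed.

(** * C*-algebras over pre-Hilbert spaces *)

From mathcomp Require Import complex.
From mathcomp Require Import all_classical all_reals all_analysis.
From mathcomp Require Import finmap.
From mathcomp Require Import -(notations) monalg.

Import numFieldNormedType.Exports.

Local Open Scope complex_scope.

(** * The real-valued modulus and completeness of the complex numbers *)

Section ComplexModulus.
Variable R : realType.
Implicit Types (z : R[i]) (x : R).

Definition cabs z : R := complex.Re `|z|.

Lemma cabsE z : (cabs z)%:C = `|z|.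
Proof. by rewrite /cabs RRe_real // normr_real. Qed.

Lemma cabs_ge0 z : 0 <= cabs z.
Proof. by rewrite -ler0c cabsE. Qed.

Lemma cabsM z1 z2 : cabs (z1 * z2) = cabs z1 * cabs z2.
Proof. by apply: complexI; rewrite rmorphM /= !cabsE normrM. Qed.

Lemma cabsD z1 z2 : cabs (z1 + z2) <= cabs z1 + cabs z2.
Proof. by rewrite -lecR rmorphD /= !cabsE ler_normD. Qed.

Lemma cabs0 : cabs 0 = 0.
Proof. by apply: complexI; rewrite cabsE normr0. Qed.

Lemma cabsN z : cabs (- z) = cabs z.
Proof. by apply: complexI; rewrite !cabsE normrN. Qed.

Lemma cabs_eq0 z : cabs z = 0 -> z = 0.
Proof. by move=> h; apply/normr0_eq0; rewrite -cabsE h. Qed.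

Lemma cabs_conj z : cabs (Num.conj z) = cabs z.
Proof. by apply: complexI; rewrite !cabsE norm_conjC. Qed.

Lemma cabs_real x : cabs x%:C = `|x|.
Proof.
apply: complexI; rewrite cabsE normc_def /= expr0n addr0.
by rewrite sqrtr_sqr.
Qed.

Lemma cabs_sqr z : (cabs z ^+ 2)%:C = z * Num.conj z.
Proof. by rewrite rmorphXn /= cabsE normCK. Qed.

Lemma Re_le_cabs z : `|complex.Re z| <= cabs z.
Proof. by rewrite -lecR cabsE normc_ge_Re. Qed.

Lemma Im_le_cabs z : `|complex.Im z| <= cabs z.
Proof.
by rewrite /cabs normc_def /= -sqrtr_sqr ler_wsqrtr // lerDr sqr_ge0.
Qed.

Lemma cabs_le_ReIm z : cabs z <= `|complex.Re z| + `|complex.Im z|.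
Proof.
rewrite {1}[z]complexE; apply: le_trans (cabsD _ _) _.
rewrite cabsM !cabs_real; apply: lerD => //.
suff -> : cabs 'i = 1 by rewrite mul1r.
by rewrite /cabs normc_def /= expr0n expr1n add0r sqrtr1.
Qed.

Definition seq_cvg (u : nat -> R[i]) (l : R[i]) :=
  forall e : R, 0 < e -> exists N, forall n, (N <= n)%N -> cabs (u n - l) <= e.

Lemma real_cauchy (u : nat -> R) :
  (forall e, 0 < e -> exists N, forall m n, (N <= m)%N -> (N <= n)%N -> `|u m - u n| <= e) ->
  exists l, forall e, 0 < e -> exists N, forall n, (N <= n)%N -> `|u n - l| <= e.
Proof.
move=> hu.
have : cvg (u @ \oo)%classic.
  apply/cauchy_cvgP/cauchy_ballP => e e0.
  have [N hN] := hu (e / 2) (divr_gt0 e0 (ltr0n _ 2)).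
  pose P := [set x | exists2 n, (N <= n)%N & x = u n]%classic.
  exists (P, P); first by split; exists N => // n hn; exists n.
  move=> [x y] [/= [m hm ->] [n hn ->]]; rewrite /ball /=.
  by apply: le_lt_trans (hN _ _ hm hn) _; lra.
move=> /cvg_ex[l /cvgrPdist_le ul]; exists l => e e0.
have [N _ hN] := ul e e0; exists N => n hn.
by rewrite distrC; apply: hN.
Qed.

Lemma complex_cauchy (u : nat -> R[i]) :
  (forall e : R, 0 < e -> exists N, forall m n, (N <= m)%N -> (N <= n)%N ->
     cabs (u m - u n) <= e) ->
  exists l, seq_cvg u l.
Proof.
move=> hu.
have [|a ha] := real_cauchy (u := fun n => complex.Re (u n)).
  move=> e e0; have [N hN] := hu e e0; exists N => m n hm hn.
  by apply: le_trans (hN m n hm hn); rewrite -raddfB; apply: Re_le_cabs.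
have [|b hb] := real_cauchy (u := fun n => complex.Im (u n)).
  move=> e e0; have [N hN] := hu e e0; exists N => m n hm hn.
  by apply: le_trans (hN m n hm hn); rewrite -raddfB; apply: Im_le_cabs.
exists (a +i* b) => e e0.
have e2 : 0 < e / 2 by lra.
have [N1 h1] := ha _ e2; have [N2 h2] := hb _ e2.
exists (maxn N1 N2) => n; rewrite geq_max => /andP[n1 n2].
apply: le_trans (cabs_le_ReIm _) _; rewrite !raddfB /=.
by have := h1 _ n1; have := h2 _ n2; lra.
Qed.

Lemma le_eps x y : (forall e, 0 < e -> x <= y + e) -> x <= y.
Proof. by move=> h; apply/ler_addgt0Pr. Qed.

Lemma cabs_le0 z : (forall e, 0 < e -> cabs z <= e) -> z = 0.
Proof.
move=> h; apply: cabs_eq0; apply/eqP; rewrite eq_le cabs_ge0 andbT.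
by apply: le_eps => e /h; rewrite add0r.
Qed.

End ComplexModulus.

Lemma cconjM (R : realType) (x y : R[i]) : Num.conj (x * y) = Num.conj x * Num.conj y.
Proof. exact: rmorphM. Qed.

Lemma cconjK (R : realType) (x : R[i]) : Num.conj (Num.conj x) = x.
Proof. exact: conjCK. Qed.

Lemma cconj_real (R : realType) (x : R) : Num.conj (x%:C : R[i]) = x%:C.
Proof. exact: conjc_real. Qed.

(** The form is linear in its second argument and may be degenerate, so the kernel on reduced words
    can be used without passing to a quotient or a completion. *)
Record preHilbert (R : realType) := PreHilbert {
  carrier :> lmodType R[i];
  ip : carrier -> carrier -> R[i];
  ipDr : forall u v w, ip u (v + w) = ip u v + ip u w;
  ipZr : forall c u v, ip u (c *: v) = c * ip u v;
  ipC : forall u v, ip v u = Num.conj (ip u v);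
  ip_ge0 : forall u, 0 <= ip u u;
  vacuum : carrier;
  ip_vacuum : ip vacuum vacuum = 1
}.

(** * Adjointable operators and their forms *)

Section PreHilbertTheory.
Variables (R : realType) (V : preHilbert R).
Implicit Types (u v w : V) (c : R[i]) (K e : R).

Local Notation ip := (@ip R V).

Lemma ipDl u v w : ip (u + v) w = ip u w + ip v w.
Proof. by rewrite ipC ipDr rmorphD /= -!ipC. Qed.

Lemma ipZl c u v : ip (c *: u) v = Num.conj c * ip u v.
Proof. by rewrite ipC ipZr rmorphM /= -ipC. Qed.

Lemma ipNr u v : ip u (- v) = - ip u v.
Proof. by rewrite -scaleN1r ipZr mulN1r. Qed.

Lemma ipNl u v : ip (- u) v = - ip u v.
Proof. by rewrite ipC ipNr rmorphN /= -ipC. Qed.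

Definition nrm u : R := Num.sqrt (complex.Re (ip u u)).

Lemma nrm_ge0 u : 0 <= nrm u. Proof. exact: sqrtr_ge0. Qed.

Lemma Re_ip_ge0 u : 0 <= complex.Re (ip u u).
Proof. by have := ip_ge0 u; rewrite lecE /= => /andP[]. Qed.

Lemma ip_self u : ip u u = (nrm u ^+ 2)%:C.
Proof.
rewrite sqr_sqrtr ?Re_ip_ge0 // RRe_real //.
exact: ger0_real (ip_ge0 u).
Qed.

Lemma nrm_vacuum : nrm (vacuum V) = 1.
Proof. by rewrite /nrm ip_vacuum /= sqrtr1. Qed.

Lemma cauchy_schwarz u v : cabs (ip u v) <= nrm u * nrm v.
Proof.
set q := cabs (ip u v); have q0 : 0 <= q := cabs_ge0 _.
(* This is the squared length of [u - s * ip v u *: v]. *)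
have key (s : R) : 0 <= nrm u ^+ 2 - 2 * s * q ^+ 2 + s ^+ 2 * q ^+ 2 * nrm v ^+ 2.
  have := ip_ge0 (u - (s%:C * ip v u) *: v).
  rewrite ipDr ipNr !ipDl !ipNl ipZr !ipZl !ip_self [ip v u]ipC cconjM cconjK cconj_real.
  set X := (X in 0 <= X -> _).
  suff -> : X = (nrm u ^+ 2 - 2 * s * q ^+ 2 + s ^+ 2 * q ^+ 2 * nrm v ^+ 2)%:C by rewrite ler0c.
  have qE : (q ^+ 2)%:C = ip u v * Num.conj (ip u v) := cabs_sqr _.
  have sE : (s ^+ 2)%:C = s%:C * s%:C by rewrite expr2 rmorphM.
  have expand (a s1 Q s2 n2 : R) : (a - 2 * s1 * Q + s2 * Q * n2)%:C =
      a%:C - 2 * s1%:C * Q%:C + s2%:C * Q%:C * n2%:C :> R[i].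
    by rewrite rmorphD rmorphB !rmorphM rmorph_nat.
  by rewrite expand qE sE {}/X ipZr ip_self; ring.
have [v0|v0] := eqVneq (nrm v) 0.
  rewrite v0 mulr0; rewrite leNgt; apply/negP => qp.
  (* For a null vector [v] this parameter makes the squared length equal to [-1]. *)
  have := key ((nrm u ^+ 2 + 1) / (2 * q ^+ 2)).
  rewrite v0 expr0n mulr0 addr0 (_ : 2 * _ * _ = nrm u ^+ 2 + 1); first by lra.
  by field; rewrite gt_eqF.
have vp : 0 < nrm v by rewrite lt_def v0 nrm_ge0.
have := key ((nrm v ^+ 2)^-1).
rewrite (_ : _ + _ = nrm u ^+ 2 - q ^+ 2 / nrm v ^+ 2); last by field.
rewrite subr_ge0 ler_pdivrMr ?exprn_gt0 // -exprMn.
by rewrite ler_sqr // nnegrE ?mulr_ge0 ?nrm_ge0.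
Qed.

Lemma nrmD u v : nrm (u + v) <= nrm u + nrm v.
Proof.
rewrite -ler_sqr ?nnegrE ?addr_ge0 ?nrm_ge0 //.
have : complex.Re (ip (u + v) (u + v)) = nrm u ^+ 2 + nrm v ^+ 2 + 2 * complex.Re (ip u v).
  rewrite ipDr !ipDl !ip_self [ip v u]ipC !raddfD /=.
  by case: (ip u v) => a b /=; ring.
rewrite ip_self /= => ->.
have := cauchy_schwarz u v; have := Re_le_cabs (ip u v); rewrite ler_norml.
by move=> /andP[_ h1] h2; nra.
Qed.

Lemma nrmZ c u : nrm (c *: u) = cabs c * nrm u.
Proof.
apply/eqP; rewrite -(@eqrXn2 _ 2) ?mulr_ge0 ?nrm_ge0 ?cabs_ge0 //; apply/eqP.
have e : ((cabs c * nrm u) ^+ 2)%:C = c * Num.conj c * (nrm u ^+ 2)%:C :> R[i].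
  by rewrite exprMn rmorphM /= cabs_sqr.
by apply: complexI; rewrite e -!ip_self ipZl ipZr; ring.
Qed.

Lemma nrm_dual v K : (forall u, cabs (ip u v) <= K * nrm u) -> nrm v <= K.
Proof.
move=> h; have := h v; rewrite ip_self cabs_real ger0_norm ?exprn_ge0 ?nrm_ge0 //.
rewrite expr2; have [v0 _|v0] := eqVneq (nrm v) 0.
  (* For a null vector it remains to see [0 <= K], which the unit vector [vacuum] shows. *)
  rewrite v0; have := h (vacuum V); rewrite nrm_vacuum mulr1.
  exact: le_trans (cabs_ge0 _).
by rewrite ler_pM2r // lt_def v0 nrm_ge0.
Qed.

(** The adjoint is part of the data because without completeness it cannot be obtained from
    boundedness. It forces [app] to be linear up to null vectors, which is all that [formof]
    sees. *)
Record oper := Oper {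
  app : V -> V;
  adj : V -> V;
  adjE : forall u v, ip u (app v) = ip (adj u) v;
  app_bound : exists2 K, 0 <= K & forall v, nrm (app v) <= K * nrm v
}.

Lemma adj_app (T : oper) u v : ip (app T u) v = ip u (adj T v).
Proof. by rewrite ipC adjE -ipC. Qed.

Lemma adj_bound (T : oper) K : 0 <= K -> (forall v, nrm (app T v) <= K * nrm v) ->
  forall v, nrm (adj T v) <= K * nrm v.
Proof.
move=> K0 h v; apply: nrm_dual => u; rewrite -adj_app.
apply: le_trans (cauchy_schwarz _ _) _; rewrite mulrAC.
by apply: ler_wpM2r; rewrite ?nrm_ge0.
Qed.

Lemma adj_opP (T : oper) : (forall u v, ip u (adj T v) = ip (app T u) v) /\
  exists2 K, 0 <= K & forall v, nrm (adj T v) <= K * nrm v.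
Proof.
split=> [u v|]; first by rewrite adj_app.
by have [K K0 h] := app_bound T; exists K => //; apply: adj_bound.
Qed.

Definition adj_op (T : oper) : oper := Oper (adj_opP T).1 (adj_opP T).2.

Lemma comp_opP (T S : oper) : (forall u v, ip u (app T (app S v)) = ip (adj S (adj T u)) v) /\
  exists2 K, 0 <= K & forall v, nrm (app T (app S v)) <= K * nrm v.
Proof.
split=> [u v|]; first by rewrite !adjE.
have [K K0 h] := app_bound T; have [L L0 g] := app_bound S.
exists (K * L) => [|v]; first exact: mulr_ge0.
by apply: le_trans (h _) _; rewrite -mulrA; apply: ler_wpM2l.
Qed.

Definition comp_op (T S : oper) : oper := Oper (comp_opP T S).1 (comp_opP T S).2.

Lemma lin_opP c (T S : oper) :
  (forall u v, ip u (c *: app T v + app S v) = ip (Num.conj c *: adj T u + adj S u) v) /\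
  exists2 K, 0 <= K & forall v, nrm (c *: app T v + app S v) <= K * nrm v.
Proof.
split=> [u v|]; first by rewrite ipDr ipDl ipZr ipZl conjCK !adjE.
have [K K0 h] := app_bound T; have [L L0 g] := app_bound S.
exists (cabs c * K + L) => [|v]; first by rewrite addr_ge0 ?mulr_ge0 ?cabs_ge0.
apply: le_trans (nrmD _ _) _; rewrite nrmZ mulrDl -mulrA; apply: lerD => //.
by apply: ler_wpM2l; rewrite ?cabs_ge0.
Qed.

Definition lin_op c (T S : oper) : oper := Oper (lin_opP c T S).1 (lin_opP c T S).2.

Lemma scalar_opP c : (forall u v, ip u (c *: v) = ip (Num.conj c *: u) v) /\
  exists2 K, 0 <= K & forall v, nrm (c *: v) <= K * nrm v.
Proof.
split=> [u v|]; first by rewrite ipZr ipZl conjCK.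
by exists (cabs c) => [|v]; rewrite ?nrmZ ?cabs_ge0.
Qed.

Definition scalar_op c : oper := Oper (scalar_opP c).1 (scalar_opP c).2.

Definition formof (T : oper) u v : R[i] := ip u (app T v).

Definition close (F G : V -> V -> R[i]) e :=
  forall u v, cabs (F u v - G u v) <= e * (nrm u * nrm v).

Lemma closeC F G e : close F G e -> close G F e.
Proof. by move=> h u v; rewrite -cabsN opprB. Qed.

Lemma close_trans F G H e e' : close F G e -> close G H e' -> close F H (e + e').
Proof.
move=> h1 h2 u v; rewrite -(subrKA (G u v)); apply: le_trans (cabsD _ _) _.
by rewrite mulrDl; apply: lerD.
Qed.

Lemma close_le F G e e' : e <= e' -> close F G e -> close F G e'.
Proof.
move=> ee h u v; apply: le_trans (h u v) _.
by apply: ler_wpM2r; rewrite ?mulr_ge0 ?nrm_ge0.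
Qed.

Lemma close_eq F G : (forall e, 0 < e -> close F G e) -> forall u v, F u v = G u v.
Proof.
move=> h u v; apply/subr0_eq/cabs_le0 => e e0.
pose k := nrm u * nrm v; have k0 : 0 <= k by rewrite mulr_ge0 ?nrm_ge0.
have k1 : 0 < k + 1 by lra.
apply: le_trans (h (e / (k + 1)) _ u v) _; first exact: divr_gt0.
by rewrite -/k mulrAC ler_pdivrMr // ler_pM2l //; lra.
Qed.

Definition is_form F := forall e, 0 < e -> exists T, close F (formof T) e.

Definition op_lim (T : nat -> oper) F :=
  forall e, 0 < e -> exists N, forall n, (N <= n)%N -> close F (formof (T n)) e.

Lemma inv_small e : 0 < e -> exists N, forall n, (N <= n)%N -> n.+1%:R^-1 <= e :> R.
Proof.
move=> e0; exists (Num.bound e^-1) => n hn.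
rewrite invf_ple ?posrE ?ltr0n //.
apply: le_trans (ltW (archi_boundP _)) _; first by rewrite invr_ge0 ltW.
by rewrite ler_nat; apply: leq_trans hn _.
Qed.

Lemma form_lim F : is_form F -> exists T, op_lim T F.
Proof.
move=> hF; have /choice[T hT] : forall n : nat, exists T, close F (formof T) (n.+1%:R^-1).
  by move=> n; apply: hF; rewrite invr_gt0 ltr0n.
exists T => e e0; have [N hN] := inv_small e0.
by exists N => n /hN hn; apply: close_le hn (hT n).
Qed.

Lemma lim_form T F : op_lim T F -> is_form F.
Proof. by move=> h e /h[N hN]; exists (T N); apply: hN. Qed.

Lemma op_lim_unique T F G : op_lim T F -> op_lim T G -> forall u v, F u v = G u v.
Proof.
move=> hF hG; apply: close_eq => e e0; have e2 : 0 < e / 2 by lra.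
have [N1 h1] := hF _ e2; have [N2 h2] := hG _ e2.
rewrite [e](_ : _ = e / 2 + e / 2); last by lra.
apply: (close_trans (h1 (maxn N1 N2) _)); first exact: leq_maxl.
by apply/closeC/h2; apply: leq_maxr.
Qed.

(** The limit is taken for each pair of vectors; since the Cauchy bound is uniform in the pair, the
    convergence is in norm. *)
Lemma op_complete T :
  (forall e, 0 < e -> exists N, forall m n, (N <= m)%N -> (N <= n)%N ->
     close (formof (T m)) (formof (T n)) e) ->
  exists F, op_lim T F.
Proof.
move=> hT.
have ptw u v : exists l, seq_cvg (fun n => formof (T n) u v) l.
  apply: complex_cauchy => e e0.
  pose k := nrm u * nrm v; have k0 : 0 <= k by rewrite mulr_ge0 ?nrm_ge0.
  have k1 : 0 < k + 1 by lra.
  have [N hN] := hT (e / (k + 1)) (divr_gt0 e0 k1); exists N => m n hm hn.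
  apply: le_trans (hN m n hm hn u v) _.
  by rewrite -/k mulrAC ler_pdivrMr // ler_pM2l //; lra.
have row u : exists f, forall v, seq_cvg (fun n => formof (T n) u v) (f v).
  by have [f hf] := choice (ptw u); exists f.
have [F hF] := choice row.
exists F => e e0; have [N hN] := hT e e0; exists N => n hn u v.
apply: le_eps => d d0; have [M hM] := hF u v d d0.
have := hM (maxn N M) (leq_maxr _ _); have := hN _ n (leq_maxl N M) hn u v.
move=> h1 h2; rewrite -(subrKA (formof (T (maxn N M)) u v)).
apply: le_trans (cabsD _ _) _; rewrite -cabsN opprB addrC.
exact: lerD.
Qed.

End PreHilbertTheory.

(** * Norm limits of operators *)

Section Limits.
Variables (R : realType) (V : preHilbert R).
Implicit Types (u v w : V) (c : R[i]) (K e : R) (F G H : V -> V -> R[i]) (T S : nat -> oper V).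

Definition form_bound F K := forall u v, cabs (F u v) <= K * (nrm u * nrm v).

Lemma oper_form_bound (T : oper V) K : (forall v, nrm (app T v) <= K * nrm v) ->
  form_bound (formof T) K.
Proof.
move=> h u v; apply: le_trans (cauchy_schwarz _ _) _.
by rewrite mulrCA; apply: ler_wpM2l; rewrite ?nrm_ge0.
Qed.

Lemma form_bound_oper (T : oper V) K : form_bound (formof T) K ->
  forall v, nrm (app T v) <= K * nrm v.
Proof. by move=> h v; apply: nrm_dual => u; rewrite -mulrA [_ * nrm u]mulrC; apply: h. Qed.

Lemma close_bound F G e K : close F G e -> form_bound G K -> form_bound F (e + K).
Proof.
move=> h g u v; rewrite -[F u v](subrK (G u v)); apply: le_trans (cabsD _ _) _.
by rewrite mulrDl; apply: lerD.
Qed.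

Lemma is_form_bound F : is_form F -> exists2 K, 0 <= K & form_bound F K.
Proof.
move=> hF; have [T hT] := hF 1 ltr01; have [K K0 h] := app_bound T.
exists (1 + K); first by rewrite addr_ge0.
exact: close_bound hT (oper_form_bound h).
Qed.

Lemma op_lim_bound T F : op_lim T F -> exists2 K, 0 <= K & exists N, forall n, (N <= n)%N ->
  forall v, nrm (app (T n) v) <= K * nrm v.
Proof.
move=> hT; have [K K0 hK] := is_form_bound (lim_form hT).
have [N hN] := hT 1 ltr01; exists (1 + K); first by rewrite addr_ge0.
exists N => n hn; apply: form_bound_oper.
exact: close_bound (closeC (hN n hn)) hK.
Qed.

Lemma op_lim_lin c T S F G : op_lim T F -> op_lim S G ->
  op_lim (fun n => lin_op c (T n) (S n)) (fun u v => c * F u v + G u v).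
Proof.
move=> hT hS e e0; pose k := cabs c + 1.
have k0 : 0 < k by rewrite /k; have := cabs_ge0 c; lra.
have [|N1 h1] := hT (e / 2 / k); first by rewrite !divr_gt0.
have [|N2 h2] := hS (e / 2); first by rewrite divr_gt0.
exists (maxn N1 N2) => n; rewrite geq_max => /andP[n1 n2] u v.
rewrite /formof /= ipDr ipZr opprD addrACA -mulrBr; apply: le_trans (cabsD _ _) _.
have hb := h2 n n2 u v; have ha := h1 n n1 u v.
set X := nrm u * nrm v in ha hb *.
have -> : e * X = e / 2 * X + e / 2 * X by field.
apply: lerD hb; rewrite cabsM.
apply: le_trans (_ : cabs c * (e / 2 / k * X) <= _); first by rewrite ler_wpM2l ?cabs_ge0.
have X0 : 0 <= X by rewrite mulr_ge0 ?nrm_ge0.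
have -> : cabs c * (e / 2 / k * X) = (e / 2 * X) * (cabs c / k) by ring.
apply: ler_piMr; first by rewrite mulr_ge0 // ltW // divr_gt0.
by rewrite ler_pdivrMr // /k; lra.
Qed.

Lemma op_lim_adj T F : op_lim T F ->
  op_lim (fun n => adj_op (T n)) (fun u v => Num.conj (F v u)).
Proof.
move=> hT e e0; have [N hN] := hT e e0; exists N => n hn u v.
rewrite /formof /= -adj_app ipC.
have -> : Num.conj (F v u) - Num.conj (ip v (app (T n) u)) =
  Num.conj (F v u - ip v (app (T n) u)) by rewrite rmorphB.
by rewrite cabs_conj [nrm u * _]mulrC; apply: hN.
Qed.

Lemma op_lim_cst (T : oper V) : op_lim (fun=> T) (formof T).
Proof.
move=> e e0; exists 0%N => n _ u v; rewrite subrr cabs0.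
by rewrite !mulr_ge0 ?nrm_ge0 // ltW.
Qed.

(** The splitting [T S - T' S' = (T - T') S + T' (S - S')], where the outer [T'] is moved to the
    other vector as an adjoint. *)
Lemma close_comp (T T' S S' : oper V) K L e e' :
  0 <= K -> 0 <= e -> 0 <= e' -> (forall v, nrm (app T' v) <= K * nrm v) ->
  (forall v, nrm (app S v) <= L * nrm v) ->
  close (formof T) (formof T') e -> close (formof S) (formof S') e' ->
  close (formof (comp_op T S)) (formof (comp_op T' S')) (e * L + K * e').
Proof.
move=> K0 e0 e'0 hT' hS cT cS u v; rewrite /formof /=.
rewrite -(subrKA (ip u (app T' (app S v)))); apply: le_trans (cabsD _ _) _.
rewrite mulrDl; apply: lerD.
  apply: le_trans (cT _ _) _; rewrite -mulrA; apply: ler_wpM2l => //.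
  by rewrite mulrCA; apply: ler_wpM2l; rewrite ?nrm_ge0.
rewrite !(adjE T'); apply: le_trans (cS _ _) _.
have -> : K * e' * (nrm u * nrm v) = e' * (K * nrm u * nrm v) by ring.
apply: ler_wpM2l => //; apply: ler_wpM2r; first exact: nrm_ge0.
exact: adj_bound.
Qed.

(** Two pairs of sequences with the same limits are compared at different indices: this gives at
    once that products converge and that the limit does not depend on the sequences. *)
Lemma op_lim_comp_close T T' S S' F G : op_lim T F -> op_lim S G -> op_lim T' F -> op_lim S' G ->
  forall e, 0 < e -> exists N, forall m n, (N <= m)%N -> (N <= n)%N ->
    close (formof (comp_op (T m) (S m))) (formof (comp_op (T' n) (S' n))) e.
Proof.
move=> hT hS hT' hS' e e0.
have [K K0 [N1 h1]] := op_lim_bound hT'; have [L L0 [N2 h2]] := op_lim_bound hS.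
pose d := e / (2 * (K + L + 1)).
have d0 : 0 < d by rewrite divr_gt0 //; lra.
have d2 : 0 < d / 2 by lra.
have [N3 h3] := hT _ d2; have [N4 h4] := hT' _ d2.
have [N5 h5] := hS _ d2; have [N6 h6] := hS' _ d2.
exists (maxn (maxn N1 N2) (maxn (maxn N3 N4) (maxn N5 N6))) => m n.
rewrite !geq_max => /andP[/andP[m1 m2] /andP[/andP[m3 m4] /andP[m5 m6]]].
move=> /andP[/andP[n1 n2] /andP[/andP[n3 n4] /andP[n5 n6]]].
apply: close_le (_ : d * L + K * d <= _) _.
  have -> : d * L + K * d = e * ((K + L) / (2 * (K + L + 1))) by rewrite /d; ring.
  by apply: ler_piMr; rewrite ?(ltW e0) // ler_pdivrMr; lra.
have dd : d = d / 2 + d / 2 by field.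
apply: close_comp; rewrite ?(ltW d0) //; try exact: h1; try exact: h2.
  by rewrite dd; apply: close_trans (closeC (h3 _ m3)) (h4 _ n4).
by rewrite dd; apply: close_trans (closeC (h5 _ m5)) (h6 _ n6).
Qed.

Lemma op_lim_comp_ex T S F G : op_lim T F -> op_lim S G ->
  exists H, op_lim (fun n => comp_op (T n) (S n)) H.
Proof. by move=> hT hS; apply: op_complete; exact: (op_lim_comp_close hT hS hT hS). Qed.

Lemma op_lim_comp T T' S S' F G H : op_lim T F -> op_lim S G -> op_lim T' F -> op_lim S' G ->
  op_lim (fun n => comp_op (T n) (S n)) H -> op_lim (fun n => comp_op (T' n) (S' n)) H.
Proof.
move=> hT hS hT' hS' hH e e0; have e2 : 0 < e / 2 by lra.
have [N1 h1] := op_lim_comp_close hT hS hT' hS' e2; have [N2 h2] := hH _ e2.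
exists (maxn N1 N2) => n; rewrite geq_max => /andP[n1 n2].
rewrite [e](_ : _ = e / 2 + e / 2); last by field.
by apply: close_trans (h2 _ n2) (h1 _ _ n1 n1).
Qed.

Lemma is_form_complete (F : nat -> V -> V -> R[i]) : (forall n, is_form (F n)) ->
  (forall e, 0 < e -> exists N, forall m n, (N <= m)%N -> (N <= n)%N -> close (F m) (F n) e) ->
  exists2 G, is_form G & forall e, 0 < e -> exists N, forall n, (N <= n)%N -> close (F n) G e.
Proof.
move=> hF hc.
have /choice[T hT] : forall n : nat, exists T0 : oper V, close (F n) (formof T0) (n.+1%:R^-1).
  by move=> n; apply: hF; rewrite invr_gt0 ltr0n.
have [|G hG] := @op_complete _ _ T.
  move=> e e0; have e3 : 0 < e / 3 by lra.
  have [N1 h1] := inv_small e3; have [N2 h2] := hc _ e3.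
  exists (maxn N1 N2) => m n; rewrite !geq_max => /andP[m1 m2] /andP[n1 n2].
  rewrite [e](_ : _ = e / 3 + (e / 3 + e / 3)); last by field.
  apply: close_trans (closeC (close_le (h1 _ m1) (hT m))) _.
  exact: close_trans (h2 _ _ m2 n2) (close_le (h1 _ n1) (hT n)).
exists G; first exact: lim_form hG.
move=> e e0; have e2 : 0 < e / 2 by lra.
have [N1 h1] := inv_small e2; have [N2 h2] := hG _ e2.
exists (maxn N1 N2) => n; rewrite geq_max => /andP[n1 n2].
rewrite [e](_ : _ = e / 2 + e / 2); last by field.
exact: close_trans (close_le (h1 _ n1) (hT n)) (closeC (h2 _ n2)).
Qed.

End Limits.

(* An operator is represented by its sesquilinear form, and the C*-algebra consists
   of the norm limits of forms of bounded adjointable operators: this avoids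
   completing [V]. *)
Record formOp (R : realType) (V : preHilbert R) := FormOp {
  kform : V -> V -> R[i];
  kformP : is_form kform
}.

Section FormOp.
Variables (R : realType) (V : preHilbert R).
Local Notation A := (formOp V).
Implicit Types (F G H : A) (T S : nat -> oper V) (c : R[i]) (e K : R).

Lemma kform_inj F G : (forall u v, kform F u v = kform G u v) -> F = G.
Proof.
case: F G => [F hF] [G hG] /= h; have e : F = G by apply/funext => u; apply/funext.
by case: G / e hG h => hG _; congr FormOp; apply: Prop_irrelevance.
Qed.

HB.instance Definition _ := gen_eqMixin A.
HB.instance Definition _ := gen_choiceMixin A.

Lemma lim_ex F : exists T, op_lim T (kform F).
Proof. exact: form_lim (kformP F). Qed.

Definition of_op (T : oper V) : A := FormOp (lim_form (op_lim_cst T)).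

Lemma lin_isform c F G : is_form (fun u v => c * kform F u v + kform G u v).
Proof.
have [T hT] := lim_ex F; have [S hS] := lim_ex G.
exact: lim_form (op_lim_lin c hT hS).
Qed.

Definition flin c F G : A := FormOp (lin_isform c F G).

Definition fzero : A := of_op (scalar_op V 0).
Definition fone : A := of_op (scalar_op V 1).

Lemma fzeroE u v : kform fzero u v = 0.
Proof. by rewrite /= /formof /= ipZr mul0r. Qed.

Lemma foneE u v : kform fone u v = ip u v.
Proof. by rewrite /= /formof /= ipZr mul1r. Qed.

Definition fadd F G := flin 1 F G.
Definition fopp F := flin (-1) F fzero.
Definition fscale c F := flin c F fzero.

Lemma faddE F G u v : kform (fadd F G) u v = kform F u v + kform G u v.
Proof. by rewrite /= mul1r. Qed.

Lemma foppE F u v : kform (fopp F) u v = - kform F u v.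
Proof. by rewrite /= mulN1r [formof _ _ _](fzeroE u v) addr0. Qed.

Lemma fscaleE c F u v : kform (fscale c F) u v = c * kform F u v.
Proof. by rewrite /= [formof _ _ _](fzeroE u v) addr0. Qed.

Lemma faddA : associative fadd.
Proof. by move=> F G H; apply: kform_inj => u v; rewrite !faddE addrA. Qed.
Lemma faddC : commutative fadd.
Proof. by move=> F G; apply: kform_inj => u v; rewrite !faddE addrC. Qed.
Lemma fadd0 : left_id fzero fadd.
Proof. by move=> F; apply: kform_inj => u v; rewrite faddE fzeroE add0r. Qed.
Lemma faddN : left_inverse fzero fopp fadd.
Proof. by move=> F; apply: kform_inj => u v; rewrite faddE foppE fzeroE addNr. Qed.

HB.instance Definition _ := GRing.isZmodule.Build A faddA faddC fadd0 faddN.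

(** The product is characterised by all approximating sequences together, so an algebraic identity
    follows from the same identity for operators through [lim_eq]. *)
Lemma prod_ex F G : exists H, forall T S, op_lim T (kform F) -> op_lim S (kform G) ->
  op_lim (fun n => comp_op (T n) (S n)) (kform H).
Proof.
have [T hT] := lim_ex F; have [S hS] := lim_ex G.
have [H hH] := op_lim_comp_ex hT hS; exists (FormOp (lim_form hH)) => T' S' hT' hS'.
exact: op_lim_comp hT hS hT' hS' hH.
Qed.

Definition fmul F G : A := projT1 (cid (prod_ex F G)).

Lemma fmul_lim F G T S : op_lim T (kform F) -> op_lim S (kform G) ->
  op_lim (fun n => comp_op (T n) (S n)) (kform (fmul F G)).
Proof. exact: (projT2 (cid (prod_ex F G))). Qed.

Lemma lim_eq T F G : op_lim T (kform F) -> op_lim T (kform G) -> F = G.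
Proof. by move=> hF hG; apply: kform_inj; apply: op_lim_unique hF hG. Qed.

Lemma op_lim_same T S (F : V -> V -> R[i]) :
    (forall n u v, ip u (app (T n) v) = ip u (app (S n) v)) ->
  op_lim T F -> op_lim S F.
Proof.
move=> TS hT e e0; have [N hN] := hT e e0; exists N => n hn u v.
by rewrite /formof -TS; apply: hN.
Qed.

Lemma fmulA : associative fmul.
Proof.
move=> F G H; have [T hT] := lim_ex F; have [S hS] := lim_ex G; have [U hU] := lim_ex H.
apply: (@lim_eq (fun n => comp_op (T n) (comp_op (S n) (U n)))).
  by apply: fmul_lim hT _; apply: fmul_lim hS hU.
apply: op_lim_same (fmul_lim (fmul_lim hT hS) hU) => n u v //.
Qed.

Lemma of_op_lim (T : oper V) : op_lim (fun=> T) (kform (of_op T)).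
Proof. exact: op_lim_cst. Qed.

Lemma of_opM (T S : oper V) : fmul (of_op T) (of_op S) = of_op (comp_op T S).
Proof. exact: lim_eq (fmul_lim (of_op_lim T) (of_op_lim S)) (of_op_lim _). Qed.

Lemma fmul1 : left_id fone fmul.
Proof.
move=> F; have [T hT] := lim_ex F; apply: lim_eq (fmul_lim (of_op_lim _) hT) _.
by apply: op_lim_same hT => n u v /=; rewrite scale1r.
Qed.

Lemma fmulr1 : right_id fone fmul.
Proof.
move=> F; have [T hT] := lim_ex F; apply: lim_eq (fmul_lim hT (of_op_lim _)) _.
by apply: op_lim_same hT => n u v /=; rewrite !adjE ipZr mul1r.
Qed.

Lemma flin_lim c T S F G : op_lim T (kform F) -> op_lim S (kform G) ->
  op_lim (fun n => lin_op c (T n) (S n)) (kform (flin c F G)).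
Proof. exact: op_lim_lin. Qed.

Lemma fmul_linl c F G H : fmul (flin c F G) H = flin c (fmul F H) (fmul G H).
Proof.
have [T hT] := lim_ex F; have [S hS] := lim_ex G; have [U hU] := lim_ex H.
apply: lim_eq (fmul_lim (flin_lim c hT hS) hU) _.
apply: op_lim_same (flin_lim c (fmul_lim hT hU) (fmul_lim hS hU)) => n u v //.
Qed.

Lemma fmul_linr c F G H : fmul H (flin c F G) = flin c (fmul H F) (fmul H G).
Proof.
have [T hT] := lim_ex F; have [S hS] := lim_ex G; have [U hU] := lim_ex H.
apply: lim_eq (fmul_lim hU (flin_lim c hT hS)) _.
apply: op_lim_same (flin_lim c (fmul_lim hU hT) (fmul_lim hU hS)) => n u v /=.
by rewrite ipDr ipZr !(adjE (U n)) ipDr ipZr.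
Qed.

Lemma fmulDl : left_distributive fmul (fun F G : A => F + G).
Proof. by move=> F G H; rewrite [LHS]fmul_linl. Qed.

Lemma fmulDr : right_distributive fmul (fun F G : A => F + G).
Proof. by move=> F G H; rewrite [LHS]fmul_linr. Qed.

Lemma fone_neq0 : fone != 0.
Proof.
apply/eqP => /(congr1 (fun F => kform F (vacuum V) (vacuum V))).
by rewrite foneE [RHS]fzeroE ip_vacuum => /eqP; rewrite oner_eq0.
Qed.

HB.instance Definition _ := GRing.Zmodule_isNzRing.Build A
  fmulA fmul1 fmulr1 fmulDl fmulDr fone_neq0.

Lemma fscaleA c d F : fscale c (fscale d F) = fscale (c * d) F.
Proof. by apply: kform_inj => u v; rewrite !fscaleE mulrA. Qed.
Lemma fscale1 : left_id 1 fscale.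
Proof. by move=> F; apply: kform_inj => u v; rewrite fscaleE mul1r. Qed.
Lemma fscaleDr : right_distributive fscale +%R.
Proof.
by move=> c F G; apply: kform_inj => u v; rewrite fscaleE [in RHS]faddE !fscaleE faddE mulrDr.
Qed.
Lemma fscaleDl F : {morph fscale^~ F : c d / c + d}.
Proof.
by move=> c d; apply: kform_inj => u v; rewrite fscaleE [in RHS]faddE !fscaleE mulrDl.
Qed.

HB.instance Definition _ := GRing.Zmodule_isLmodule.Build R[i] A fscaleA fscale1 fscaleDr fscaleDl.

Lemma fmul0l F : fmul fzero F = fzero. Proof. exact: (mul0r (F : A)). Qed.
Lemma fmul0r F : fmul F fzero = fzero. Proof. exact: (mulr0 (F : A)). Qed.

Lemma fscaleAl c F G : c *: (F * G) = (c *: F) * G.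
Proof. by rewrite [RHS]fmul_linl fmul0l. Qed.

HB.instance Definition _ := GRing.Lmodule_isLalgebra.Build R[i] A fscaleAl.

Lemma fscaleAr c F G : c *: (F * G) = F * (c *: G).
Proof. by rewrite [RHS]fmul_linr fmul0r. Qed.

HB.instance Definition _ := GRing.Lalgebra_isAlgebra.Build R[i] A fscaleAr.

End FormOp.

(** * Involution, C*-norm and vacuum state *)

Section FormOpStar.
Variables (R : realType) (V : preHilbert R).
Local Notation A := (formOp V).
Implicit Types (F G H : A) (T S : nat -> oper V) (c : R[i]) (e K : R) (u v : V).

Lemma kformD F G u v : kform (F + G) u v = kform F u v + kform G u v.
Proof. exact: faddE. Qed.
Lemma kformZ c F u v : kform (c *: F) u v = c * kform F u v.
Proof. exact: fscaleE. Qed.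
Lemma kform0 u v : kform (0 : A) u v = 0.
Proof. exact: fzeroE. Qed.
Lemma kform1 u v : kform (1 : A) u v = ip u v.
Proof. exact: foneE. Qed.
Lemma kformN F u v : kform (- F) u v = - kform F u v.
Proof. by rewrite -scaleN1r kformZ mulN1r. Qed.
Lemma kformB F G u v : kform (F - G) u v = kform F u v - kform G u v.
Proof. by rewrite kformD kformN. Qed.
Lemma kformM F G T S : op_lim T (kform F) -> op_lim S (kform G) ->
  op_lim (fun n => comp_op (T n) (S n)) (kform (F * G)).
Proof. exact: fmul_lim. Qed.
Lemma of_op_mul (T S : oper V) : of_op T * of_op S = of_op (comp_op T S).
Proof. exact: of_opM. Qed.

Lemma adj_isform F : is_form (fun u v => Num.conj (kform F v u)).
Proof. by have [T hT] := lim_ex F; apply: lim_form (op_lim_adj hT). Qed.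

Definition fstar F : A := FormOp (adj_isform F).

Lemma fstarE F u v : kform (fstar F) u v = Num.conj (kform F v u).
Proof. by []. Qed.

Lemma fstar_lim F T : op_lim T (kform F) -> op_lim (fun n => adj_op (T n)) (kform (fstar F)).
Proof. exact: op_lim_adj. Qed.

Lemma fstarK : involutive fstar.
Proof. by move=> F; apply: kform_inj => u v; rewrite !fstarE cconjK. Qed.

Lemma fstarD : {morph fstar : F G / F + G}.
Proof. by move=> F G; apply: kform_inj => u v; rewrite kformD !fstarE kformD rmorphD. Qed.

Lemma fstarZ c F : fstar (c *: F) = Num.conj c *: fstar F.
Proof. by apply: kform_inj => u v; rewrite kformZ !fstarE kformZ cconjM. Qed.

Lemma fstarM F G : fstar (F * G) = fstar G * fstar F.
Proof.
have [T hT] := lim_ex F; have [S hS] := lim_ex G.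
apply: lim_eq (fstar_lim (kformM hT hS)) _.
exact: op_lim_same (kformM (fstar_lim hS) (fstar_lim hT)).
Qed.

Definition bounds F : set R := [set K | 0 <= K /\ form_bound (kform F) K]%classic.

Definition fnorm F : R := inf (bounds F).

Lemma bounds_has_inf F : has_inf (bounds F).
Proof.
split; last by exists 0 => K [].
by have [K K0 hK] := is_form_bound (kformP F); exists K.
Qed.

Lemma fnorm_ge0 F : 0 <= fnorm F.
Proof. by apply: lb_le_inf => [|K []//]; case: (bounds_has_inf F). Qed.

Lemma fnorm_bound F : form_bound (kform F) (fnorm F).
Proof.
move=> u v; have [k0|k0] := eqVneq (nrm u * nrm v) 0.
  have [K K0 hK] := is_form_bound (kformP F).
  by have := hK u v; rewrite k0 !mulr0.
have kp : 0 < nrm u * nrm v by rewrite lt_def k0 mulr_ge0 ?nrm_ge0.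
rewrite -ler_pdivrMr //; apply: lb_le_inf; first by case: (bounds_has_inf F).
by move=> K [_ hK]; rewrite ler_pdivrMr //; apply: hK.
Qed.

Lemma fnorm_le F K : 0 <= K -> form_bound (kform F) K -> fnorm F <= K.
Proof. by move=> K0 hK; apply: ge_inf; [case: (bounds_has_inf F)|]. Qed.

Lemma fnorm0_eq0 F : fnorm F = 0 -> F = 0.
Proof.
move=> h; apply: kform_inj => u v; rewrite kform0; apply: cabs_eq0; apply/eqP.
have := fnorm_bound F u v; rewrite h mul0r => h0.
by rewrite eq_le h0 cabs_ge0.
Qed.

Lemma fnormD F G : fnorm (F + G) <= fnorm F + fnorm G.
Proof.
apply: fnorm_le => [|u v]; first by rewrite addr_ge0 ?fnorm_ge0.
rewrite kformD; apply: le_trans (cabsD _ _) _; rewrite mulrDl.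
by apply: lerD; apply: fnorm_bound.
Qed.

Lemma fnormZ_le c F : fnorm (c *: F) <= cabs c * fnorm F.
Proof.
apply: fnorm_le => [|u v]; first by rewrite mulr_ge0 ?fnorm_ge0 ?cabs_ge0.
by rewrite kformZ cabsM -mulrA; apply: ler_wpM2l; rewrite ?cabs_ge0 //; apply: fnorm_bound.
Qed.

Lemma fnormZ c F : (fnorm (c *: F))%:C = `|c| * (fnorm F)%:C.
Proof.
rewrite -cabsE -rmorphM /=; congr (_%:C); apply/eqP; rewrite eq_le fnormZ_le /=.
have [->|c0] := eqVneq c 0; first by rewrite cabs0 mul0r fnorm_ge0.
have cp : 0 < cabs c by rewrite lt_def cabs_ge0 andbT; apply: contra_neq c0 => /cabs_eq0.
rewrite mulrC -ler_pdivlMr //; have := fnormZ_le c^-1 (c *: F).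
rewrite scalerA mulVf // scale1r mulrC.
suff -> : cabs c^-1 = (cabs c)^-1 by [].
apply: (mulfI (lt0r_neq0 cp)); rewrite -cabsM divff // divff ?lt0r_neq0 //.
by apply: complexI; rewrite cabsE normr1.
Qed.

Lemma form_bound_le (F : V -> V -> R[i]) K e : K <= e -> form_bound F K -> form_bound F e.
Proof.
move=> Ke h u v; apply: le_trans (h u v) _.
by apply: ler_wpM2r; rewrite ?mulr_ge0 ?nrm_ge0.
Qed.

Lemma fnormM F G : fnorm (F * G) <= fnorm F * fnorm G.
Proof.
have [T hT] := lim_ex F; have [S hS] := lim_ex G.
have hFG := kformM hT hS.
have hb (e : R) : 0 < e -> e <= 1 -> fnorm (F * G) <= e + (e + fnorm F) * (e + fnorm G).
  move=> e0 e1; have [N1 h1] := hT e e0; have [N2 h2] := hS e e0; have [N3 h3] := hFG e e0.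
  pose n := maxn N1 (maxn N2 N3).
  have bT := close_bound (closeC (h1 n (leq_maxl _ _))) (fnorm_bound F).
  have bS : form_bound (formof (S n)) (e + fnorm G).
    apply: close_bound (closeC (h2 n _)) (fnorm_bound G).
    by rewrite /n maxnCA leq_maxl.
  have c3 : close (kform (F * G)) (formof (comp_op (T n) (S n))) e.
    by apply: h3; rewrite /n maxnA leq_maxr.
  have F0 := fnorm_ge0 F; have G0 := fnorm_ge0 G.
  apply: fnorm_le; first by rewrite addr_ge0 ?mulr_ge0 //; lra.
  apply: close_bound c3 _; apply: oper_form_bound => v /=.
  apply: le_trans (form_bound_oper bT _) _; rewrite -mulrA.
  apply: ler_wpM2l; [lra|exact: form_bound_oper].
apply: le_eps => d d0; have F0 := fnorm_ge0 F; have G0 := fnorm_ge0 G.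
(* For [e <= 1] the bound of [hb] exceeds the product of the norms by at most [e * k]. *)
pose k := 2 + fnorm F + fnorm G; have k0 : 0 < k by rewrite /k; lra.
pose e := Num.min 1 (d / k).
have e0 : 0 < e by rewrite lt_min ltr01 divr_gt0.
have e1 : e <= 1 by rewrite ge_min lexx.
have ed : e * k <= d by rewrite -ler_pdivlMr // ge_min lexx orbT.
apply: le_trans (hb e e0 e1) _; move: ed; rewrite /k => ed; nra.
Qed.

Lemma fnorm_star_le F : fnorm (fstar F) <= fnorm F.
Proof.
apply: fnorm_le => [|u v]; first exact: fnorm_ge0.
by rewrite fstarE cabs_conj [nrm u * _]mulrC; apply: fnorm_bound.
Qed.

(** For an operator this is the Cauchy-Schwarz inequality together with
    [nrm (T v) ^+ 2 = ip v (T^* T v)]. It passes to the limit form with an error [e], which is then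
    sent to zero. *)
Lemma cabs_kform_sqr F u v :
  cabs (kform F u v) ^+ 2 <= nrm u ^+ 2 * (fnorm (fstar F * F) * nrm v ^+ 2).
Proof.
have [T hT] := lim_ex F; have hG := kformM (fstar_lim hT) hT.
set B := fnorm _; have B0 : 0 <= B := fnorm_ge0 _.
have FB := fnorm_bound F u v; have F0 := fnorm_ge0 F.
have nu := nrm_ge0 u; have nv := nrm_ge0 v.
have key (e : R) : 0 < e -> e <= 1 ->
    cabs (kform F u v) <= e * (nrm u * nrm v) + Num.sqrt (nrm u ^+ 2 * ((e + B) * nrm v ^+ 2)).
  move=> e0 e1; have [N1 h1] := hT e e0; have [N2 h2] := hG e e0.
  pose n := maxn N1 N2.
  have c1 := h1 n (leq_maxl _ _) u v.
  have c2 := h2 n (leq_maxr _ _).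
  rewrite -[kform F u v](subrK (formof (T n) u v)); apply: le_trans (cabsD _ _) _.
  apply: lerD => //.
  apply: le_trans (cauchy_schwarz _ _) _.
  rewrite -[X in X <= _]ger0_norm ?mulr_ge0 ?nrm_ge0 // -sqrtr_sqr; apply: ler_wsqrtr.
  rewrite exprMn; apply: ler_wpM2l; first exact: exprn_ge0.
  have := close_bound (closeC c2) (fnorm_bound _) v v.
  by rewrite /formof /= -adj_app ip_self cabs_real ger0_norm ?exprn_ge0 ?nrm_ge0 // -expr2.
have key2 (e : R) : 0 < e -> e <= 1 ->
    (cabs (kform F u v) - e * (nrm u * nrm v)) <= Num.sqrt (nrm u ^+ 2 * ((e + B) * nrm v ^+ 2)).
  by move=> e0 e1; have := key e e0 e1; lra.
set a := cabs _ in key key2 FB *; have a0 : 0 <= a := cabs_ge0 _.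
set k := nrm u * nrm v in key2 FB *; have k0 : 0 <= k by rewrite mulr_ge0.
have key3 (e : R) : 0 < e -> e <= 1 -> a ^+ 2 <= k ^+ 2 * (e + B) + 2 * e * k * a.
  move=> e0 e1; have := key2 e e0 e1.
  have -> : nrm u ^+ 2 * ((e + B) * nrm v ^+ 2) = k ^+ 2 * (e + B) by rewrite /k; ring.
  set s := Num.sqrt _ => h.
  have sE : s ^+ 2 = k ^+ 2 * (e + B) by rewrite sqr_sqrtr // mulr_ge0 ?exprn_ge0 //; lra.
  have s0 : 0 <= s := sqrtr_ge0 _.
  rewrite -sE; have [ake|ake] := leP a (e * k).
    by have := sqr_ge0 s; nra.
  have : (a - e * k) ^+ 2 <= s ^+ 2 by rewrite ler_sqr // nnegrE; lra.
  by have := sqr_ge0 (e * k); nra.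
have -> : nrm u ^+ 2 * (B * nrm v ^+ 2) = k ^+ 2 * B by rewrite /k; ring.
apply: le_eps => d d0.
(* The error in [key3] is at most [e * q]; the summand [1] keeps [q] positive. *)
pose q := k ^+ 2 + 2 * k * a + 1; have q0 : 0 < q by rewrite /q; nra.
pose e := Num.min 1 (d / q).
have e0 : 0 < e by rewrite lt_min ltr01 divr_gt0.
have e1 : e <= 1 by rewrite ge_min lexx.
have ed : e * q <= d by rewrite -ler_pdivlMr // ge_min lexx orbT.
apply: le_trans (key3 e e0 e1) _; move: ed; rewrite /q => ed; nra.
Qed.

Lemma fnorm_star F : fnorm (fstar F * F) = fnorm F ^+ 2.
Proof.
apply/eqP; rewrite eq_le; apply/andP; split.
  apply: le_trans (fnormM _ _) _; rewrite expr2; apply: ler_wpM2r; first exact: fnorm_ge0.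
  exact: fnorm_star_le.
set B := fnorm (_ * _); have B0 : 0 <= B := fnorm_ge0 _.
rewrite -[B]sqr_sqrtr // ler_sqr ?nnegrE ?fnorm_ge0 ?sqrtr_ge0 //.
apply: fnorm_le => [|u v]; first exact: sqrtr_ge0.
rewrite -ler_sqr ?nnegrE ?cabs_ge0 ?mulr_ge0 ?nrm_ge0 ?sqrtr_ge0 //.
rewrite !exprMn sqr_sqrtr //; apply: le_trans (cabs_kform_sqr _ _ _) _.
by rewrite -/B le_eqVlt; apply/orP; left; apply/eqP; ring.
Qed.

Lemma fcomplete (F : nat -> A) :
  (forall e : R, 0 < e -> exists N, forall m n,
    (N <= m)%N -> (N <= n)%N -> fnorm (F m - F n) < e) ->
  exists L : A, forall e : R, 0 < e -> exists N, forall n, (N <= n)%N -> fnorm (F n - L) < e.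
Proof.
move=> hF; have [||G hG hlim] := @is_form_complete _ _ (fun n => kform (F n)).
- by move=> n; apply: kformP.
- move=> e e0; have [N hN] := hF e e0; exists N => m n hm hn u v.
  rewrite -kformB; apply: (form_bound_le (ltW (hN m n hm hn))).
  exact: fnorm_bound.
exists (FormOp hG) => e e0; have e2 : 0 < e / 2 by lra.
have [N hN] := hlim _ e2; exists N => n hn.
apply: (@le_lt_trans _ _ (e / 2)); last by lra.
apply: fnorm_le => [|u v]; first exact: ltW.
by rewrite kformB; apply: hN.
Qed.

HB.instance Definition _ := @isCStarAlgebra.Build R A fstar fstarK fstarD fstarZ fstarM
  fnorm fnorm0_eq0 fnormD fnormZ fnormM fnorm_star fcomplete.

Definition vstate F : R[i] := kform F (vacuum V) (vacuum V).

Lemma vstate_is_scalar : scalar vstate.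
Proof. by move=> c F G; rewrite /vstate kformD kformZ. Qed.

HB.instance Definition _ := GRing.isLinear.Build R[i] A R[i] *%R vstate vstate_is_scalar.

(** The value is a limit of the nonnegative reals [nrm (T n vacuum) ^+ 2], and both its real and
    imaginary parts are read off that limit. *)
Lemma vstate_ge0 F : 0 <= vstate (star F * F).
Proof.
have [T hT] := lim_ex F; have hG := kformM (fstar_lim hT) hT.
have hc : seq_cvg (fun n => (nrm (app (T n) (vacuum V)) ^+ 2)%:C) (vstate (star F * F)).
  move=> e e0; have [N hN] := hG e e0; exists N => n hn.
  have := hN n hn (vacuum V) (vacuum V).
  rewrite /formof /= -adj_app ip_self nrm_vacuum mulr1 mulr1 -cabsN opprB; exact.
move: (vstate _) hc => z hc; rewrite lecE /=; apply/andP; split.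
  rewrite -normr_eq0 eq_le normr_ge0 andbT.
  apply: le_eps => e e0; rewrite add0r; have [N hN] := hc e e0.
  apply: le_trans (hN N (leqnn _)); apply: le_trans (Im_le_cabs _).
  by rewrite raddfB /= sub0r normrN.
apply: le_eps => e e0; have [N hN] := hc e e0.
have := le_trans (Re_le_cabs _) (hN N (leqnn _)).
rewrite raddfB /= ler_norml => /andP[_].
by have := sqr_ge0 (nrm (app (T N) (vacuum V))); lra.
Qed.

Lemma vstate1 : vstate 1 = 1.
Proof. by rewrite /vstate kform1 ip_vacuum. Qed.

Definition vacuum_space : cstar_prob_space R :=
  @CStarProbSpace R A vstate vstate_ge0 vstate1.

End FormOpStar.

(** * Square roots and bounds for states *)

Section StarNorm.
Variables (R : realType) (A : cstarAlgType R).
Implicit Types (a b x y : A) (c : R[i]) (e : R).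
Local Notation N := (@cstar_norm R A).

Lemma cnormZ c x : N (c *: x) = cabs c * N x.
Proof. by apply: complexI; rewrite cstar_normZ rmorphM /= cabsE. Qed.

Lemma cnormN x : N (- x) = N x.
Proof. by rewrite -scaleN1r cnormZ cabsN (cabs_real 1) normr1 mul1r. Qed.

Lemma cnorm0 : N 0 = 0.
Proof. by rewrite -(scale0r (0 : A)) cnormZ cabs0 mul0r. Qed.

Lemma cnorm_ge0 x : 0 <= N x.
Proof. by have := cstar_normD x (- x); rewrite subrr cnorm0 cnormN; lra. Qed.

Lemma cnorm_star x : N (star x) = N x.
Proof.
have le y : N y <= N (star y).
  have [->|y0] := eqVneq (N y) 0; first exact: cnorm_ge0.
  have yp : 0 < N y by rewrite lt_def y0 cnorm_ge0.
  rewrite -(ler_pM2r yp) -expr2 -cstar_norm_star; exact: cstar_normM.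
by apply/eqP; rewrite eq_le le andbT; have := le (star x); rewrite starK.
Qed.

Lemma star0 : star (0 : A) = 0.
Proof.
have := starD (0 : A) 0; rewrite addr0 => /(congr1 (fun z => z - star (0 : A))).
by rewrite subrr addrK.
Qed.

Lemma starN x : star (- x) = - star x.
Proof. by apply/eqP; rewrite -addr_eq0 -starD addNr star0. Qed.

Lemma star1 : star (1 : A) = 1.
Proof. by have := starM (star 1 : A) 1; rewrite mulr1 starK mulr1. Qed.

Lemma cnorm_eps x : (forall e, 0 < e -> N x <= e) -> x = 0.
Proof.
move=> h; apply: cstar_norm0_eq0; apply/eqP; rewrite eq_le cnorm_ge0 andbT.
by apply: le_eps => e /h; rewrite add0r.
Qed.

(** A fixed point [b] satisfies [(1 - b) ^+ 2 = 1 - h]. For [h] of norm at most [1/2] the map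
    preserves the ball of radius [1/2] and contracts it by the factor [1/2], so the square root
    needs only completeness. *)
Definition sqrt_step h b : A := (2^-1 : R[i]) *: (h + b * b).
Definition sqrt_seq h n : A := iter n (sqrt_step h) 0.

Lemma cabs_half : cabs (2^-1 : R[i]) = 2^-1.
Proof.
by rewrite (_ : 2^-1 = (2^-1 : R)%:C) ?cabs_real ?ger0_norm ?invr_ge0 // fmorphV rmorph_nat.
Qed.

Lemma cnorm_sqr_sub b b' : N b <= 2^-1 -> N b' <= 2^-1 -> N (b * b - b' * b') <= N (b - b').
Proof.
move=> hb hb'; have -> : b * b - b' * b' = b * (b - b') + (b - b') * b'.
  by rewrite mulrBr mulrBl subrKA.
have h1 := cstar_normM b (b - b'); have h2 := cstar_normM (b - b') b'.
have h3 := cstar_normD (b * (b - b')) ((b - b') * b').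
have h0 := cnorm_ge0 (b - b'); nra.
Qed.

Section SquareRoot.
Variable h : A.
Hypothesis h_small : N h <= 2^-1.
Local Notation s := (sqrt_seq h).

Lemma sqrt_seq_bound n : N (s n) <= 2^-1.
Proof.
elim: n => [|n IH]; first by rewrite cnorm0 invr_ge0.
rewrite /= /sqrt_step cnormZ cabs_half.
have h1 := cstar_normD h (s n * s n); have h2 := cstar_normM (s n) (s n).
have h0 := cnorm_ge0 (s n); move: h_small IH; rewrite -/(s n) => ??.
suff : N (h + s n * s n) <= 1 by lra.
nra.
Qed.

Lemma sqrt_step_contract b b' : N b <= 2^-1 -> N b' <= 2^-1 ->
  N (sqrt_step h b - sqrt_step h b') <= 2^-1 * N (b - b').
Proof.
move=> hb hb'; rewrite -scalerBr cnormZ cabs_half; apply: ler_wpM2l; first by rewrite invr_ge0.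
by rewrite opprD addrACA subrr add0r; apply: cnorm_sqr_sub.
Qed.

Lemma sqrt_seq_step n : N (s n.+1 - s n) <= 2^-1 ^+ n.
Proof.
elim: n => [|n IH]; first by rewrite subr0 expr0; have := sqrt_seq_bound 1; lra.
rewrite exprS; apply: le_trans (sqrt_step_contract (sqrt_seq_bound n.+1) (sqrt_seq_bound n)) _.
by apply: ler_wpM2l; rewrite ?invr_ge0.
Qed.

Lemma sqrt_seq_tail n k : N (s (n + k) - s n) <= 2 * 2^-1 ^+ n.
Proof.
suff : N (s (n + k)%N - s n) <= 2 * 2^-1 ^+ n - 2 * 2^-1 ^+ (n + k).
  have : 0 <= 2^-1 ^+ (n + k) :> R by rewrite exprn_ge0 ?invr_ge0.
  by lra.
elim: k => [|k IH]; first by rewrite addn0 !subrr cnorm0.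
rewrite addnS -(subrKA (s (n + k)%N)); apply: le_trans (cstar_normD _ _) _.
have := sqrt_seq_step (n + k); rewrite exprS; lra.
Qed.

Lemma half_pow_small e : 0 < e -> exists M, forall n, (M <= n)%N -> 2^-1 ^+ n <= e.
Proof.
move=> e0; have [M hM] := inv_small e0; exists M => n /hM; apply: le_trans.
rewrite exprVn lef_pV2 ?posrE ?ltr0n ?exprn_gt0 //.
by rewrite -natrX ler_nat ltn_expl.
Qed.

Lemma sqrt_lim : exists b, forall e, 0 < e -> exists M, forall n, (M <= n)%N -> N (s n - b) < e.
Proof.
(* Two tails of length at most [2 * (e / 5)] stay strictly below [e]. *)
apply: cstar_complete => e e0; have e5 : 0 < e / 5 by lra.
have [M hM] := half_pow_small e5; exists M => m n hm hn.
have t k : (M <= k)%N -> N (s k - s M) <= 2 * (e / 5).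
  move=> hk; rewrite -(subnKC hk); apply: le_trans (sqrt_seq_tail _ _) _.
  by have := hM M (leqnn _); lra.
rewrite -(subrKA (s M)); apply: le_lt_trans (cstar_normD _ _) _.
by rewrite -[N (s M - _)]cnormN opprB; have := t m hm; have := t n hn; lra.
Qed.

Lemma sqrt_seq_self n : star h = h -> star (s n) = s n.
Proof.
move=> hh; elim: n => [|n IH]; first exact: star0.
rewrite /= /sqrt_step starZ starD hh starM -/(s n) IH; congr (_ *: _).
by rewrite (_ : 2^-1 = (2^-1 : R)%:C) ?cconj_real // fmorphV rmorph_nat.
Qed.

Lemma one_sub_sqrt : star h = h -> exists2 d : A, star d = d & d * d = 1 - h.
Proof.
move=> hh; have [b hb] := sqrt_lim.
have bb : star b = b.
  apply/eqP; rewrite -subr_eq0; apply/eqP/cnorm_eps => e e0.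
  have [|M hM] := hb (e / 2); first by rewrite divr_gt0.
  have h1 := hM M (leqnn _).
  rewrite -(subrKA (s M)); apply: le_trans (cstar_normD _ _) _.
  have -> : star b - s M = star (- (s M - b)).
    by rewrite opprB starD starN sqrt_seq_self.
  by rewrite cnorm_star cnormN; lra.
have nb : N b <= 2^-1.
  apply: le_eps => e e0; have [M hM] := hb e e0; have h1 := hM M (leqnn _).
  rewrite -[b](subrK (s M)); apply: le_trans (cstar_normD _ _) _.
  by rewrite -[N (b - _)]cnormN opprB; have := sqrt_seq_bound M; lra.
have fixb : sqrt_step h b = b.
  apply/eqP; rewrite -subr_eq0; apply/eqP/cnorm_eps => e e0.
  have [|M hM] := hb (e / 2); first by rewrite divr_gt0.
  have h1 := hM M (leqnn _); have h2 := hM M.+1 (leqnSn _).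
  rewrite -(subrKA (s M.+1)); apply: le_trans (cstar_normD _ _) _.
  have := sqrt_step_contract nb (sqrt_seq_bound M).
  by rewrite -[N (b - _)]cnormN opprB => h3;
    have := cnorm_ge0 (s M - b); rewrite /= in h2 h3 *; lra.
exists (1 - b); first by rewrite starD starN star1 bb.
have e : b + b = h + b * b.
  rewrite -{1 2}fixb /sqrt_step -scalerDl -[X in X *: _](_ : 1 = _) ?scale1r //.
  by field.
by rewrite mulrBr mulr1 mulrBl mul1r opprB addrA addrAC
  -[1 - b - b]addrA -opprD e opprD addrA subrK.
Qed.

End SquareRoot.
End StarNorm.

(** With [d * d = 1 - K^-1 a^* a] and [d] self-adjoint, positivity of the state on [d * c] is the
    claim divided by [K]. *)
Lemma state_bound (R : realType) (P : cstar_prob_space R) (a : P) :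
  exists2 K : R, 0 <= K & forall c : P,
    state P (star (a * c) * (a * c)) <= K%:C * state P (star c * c).
Proof.
(* The factor [2] brings the norm of [K^-1 a^* a] below the [1/2] required by the square root; the
   summand [1] covers [a = 0]. *)
pose K := 2 * cstar_norm a ^+ 2 + 1.
have na : 0 <= cstar_norm a ^+ 2 by apply: exprn_ge0; apply: cnorm_ge0.
have K0 : 0 < K by rewrite /K; lra.
exists K; first exact: ltW.
pose h : P := (K^-1)%:C *: (star a * a).
have hh : star h = h by rewrite /h starZ starM starK cconj_real.
have [|d dd d2] := @one_sub_sqrt R P h _ hh.
  rewrite /h cnormZ cabs_real ger0_norm ?invr_ge0 ?(ltW K0) // cstar_norm_star.
  by rewrite mulrC ler_pdivrMr // /K; lra.
move=> c; have := state_ge0 (d * c).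
rewrite starM dd -mulrA (mulrA d) d2 mulrBl mul1r mulrBr raddfB /= subr_ge0.
have -> : star c * (h * c) = (K^-1)%:C *: (star (a * c) * (a * c)).
  by rewrite /h -scalerAl -scalerAr starM !mulrA.
rewrite linearZ /= => le1.
have KC : K%:C * (K^-1)%:C = 1 :> R[i] by rewrite -rmorphM divff ?lt0r_neq0.
have KC0 : 0 <= K%:C :> R[i] by rewrite ler0c ltW.
by have := ler_wpM2l KC0 le1; rewrite [K%:C * (_ * _)]mulrA KC mul1r.
Qed.

(** * The free product of C*-probability spaces *)

Section PosDef.
Variable R : realType.
Local Notation C := R[i].

Section Kernel.
Variable X : Type.
Implicit Types (k b : X -> X -> C) (r : seq (C * X)).

Definition qform k r r' : C := \sum_(p <- r) \sum_(q <- r') Num.conj p.1 * q.1 * k p.2 q.2.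

Definition psd k := (forall x y, k y x = Num.conj (k x y)) /\ forall r, 0 <= qform k r r.

Lemma qformDl k r1 r2 r' : qform k (r1 ++ r2) r' = qform k r1 r' + qform k r2 r'.
Proof. by rewrite /qform big_cat. Qed.

Lemma qformDr k r1 r2 r' : qform k r' (r1 ++ r2) = qform k r' r1 + qform k r' r2.
Proof. by rewrite /qform -big_split; apply: eq_bigr => p _; rewrite big_cat. Qed.

Lemma qform1l k c x r : qform k [:: (c, x)] r = Num.conj c * \sum_(q <- r) q.1 * k x q.2.
Proof. by rewrite /qform big_seq1 mulr_sumr; apply: eq_bigr => q _; rewrite mulrA. Qed.

Lemma qform1r k c x r : qform k r [:: (c, x)] = c * \sum_(p <- r) Num.conj p.1 * k p.2 x.
Proof.
rewrite /qform mulr_sumr; apply: eq_bigr => p _; rewrite big_seq1 /=.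
by rewrite mulrA [c * _]mulrC.
Qed.

Lemma eq_qform k b r r' : (forall x y, k x y = b x y) -> qform k r r' = qform b r r'.
Proof. by move=> e; apply: eq_bigr => p _; apply: eq_bigr => q _; rewrite e. Qed.

Lemma qform_lin c k b r r' : qform (fun x y => c * k x y + b x y) r r' =
  c * qform k r r' + qform b r r'.
Proof.
rewrite /qform mulr_sumr -big_split; apply: eq_bigr => p _.
rewrite mulr_sumr -big_split; apply: eq_bigr => q _ /=; ring.
Qed.

Lemma eq_psd k b : (forall x y, k x y = b x y) -> psd k -> psd b.
Proof.
by move=> e [h p]; split=> [x y|r]; [rewrite -!e h|rewrite -(eq_qform _ _ e)].
Qed.

Lemma psdD k b : psd k -> psd b -> psd (fun x y => k x y + b x y).
Proof.
case=> hk pk [hb pb]; split=> [x y|r]; first by rewrite hk hb rmorphD.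
have -> : qform (fun x y => k x y + b x y) r r = qform (fun x y => 1 * k x y + b x y) r r.
  by apply: eq_qform => x y; rewrite mul1r.
by rewrite qform_lin mul1r addr_ge0.
Qed.

Lemma psd0 : psd (fun _ _ => 0).
Proof.
split=> [x y|r]; first by rewrite conjC0.
by rewrite /qform big1 // => p _; rewrite big1 // => q _; rewrite mulr0.
Qed.

Lemma psd_sum (J : Type) (s : seq J) (k : J -> X -> X -> C) :
  (forall j, psd (k j)) -> psd (fun x y => \sum_(j <- s) k j x y).
Proof.
move=> pk; elim: s => [|j s IH].
  by apply: (eq_psd _ psd0) => x y; rewrite big_nil.
by apply: eq_psd (psdD (pk j) IH) => x y; rewrite big_cons.
Qed.

Lemma psd_rank1 (f : X -> C) : psd (fun x y => Num.conj (f x) * f y).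
Proof.
split=> [x y|r]; first by rewrite cconjM cconjK mulrC.
suff -> : qform (fun x y => Num.conj (f x) * f y) r r =
    (\sum_(p <- r) p.1 * f p.2) * Num.conj (\sum_(p <- r) p.1 * f p.2).
  exact: mul_conjC_ge0.
rewrite rmorph_sum mulrC mulr_suml; apply: eq_bigr => p _.
rewrite mulr_sumr; apply: eq_bigr => q _; rewrite rmorphM /=; ring.
Qed.

Lemma psd_diag k x : psd k -> 0 <= k x x.
Proof.
by case=> _ /(_ [:: (1, x)]); rewrite qform1l big_seq1 conjC1 !mul1r.
Qed.

Lemma psd_null k x y : psd k -> k x x = 0 -> k x y = 0.
Proof.
move=> [h p] k0; apply: contraTeq isT => kxy.
set z := k x y in kxy.
have ky : k y x = Num.conj z by rewrite h.
pose m : R := (cabs z ^+ 2).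
have m0 : 0 < m.
  rewrite exprn_gt0 // lt_def cabs_ge0 andbT; apply: contra kxy => /eqP/cabs_eq0->//.
have kyy := psd_diag y (conj h p); pose a := complex.Re (k y y).
have aE : k y y = a%:C by rewrite RRe_real // ger0_real.
(* With this [s] the quadratic form at [(- s z, 1)] would be [a - 2 s m = -1]. *)
pose s : R := (a + 1) / (2 * m).
have := p [:: (- s%:C * z, x); (1, y)].
rewrite (qformDl _ [:: _] [:: _]) !(qformDr _ [:: _] [:: _]) !qform1l !big_seq1 /= k0 -/z ky aE.
rewrite conjC1 rmorphM rmorphN /= [Num.conj (_%:C)]cconj_real.
have zz : z * Num.conj z = m%:C by rewrite -cabs_sqr.
set e := (X in 0 <= X -> _).
have -> : e = (a - 2 * s * m)%:C.
  have ex : (a - 2 * s * m)%:C = a%:C - 2 * s%:C * m%:C :> C.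
    by rewrite rmorphB !rmorphM rmorph_nat.
  by rewrite ex -zz /e; ring.
rewrite ler0c /s.
have -> : a - 2 * ((a + 1) / (2 * m)) * m = -1 by field; rewrite gt_eqF.
by rewrite lerNr oppr0 ler10.
Qed.

(** The Schur complement: what remains of [k] orthogonally to the point [p0]; its row at [p0]
    vanishes. *)
Definition schur k p0 x y := k x y - k x p0 * k p0 y / k p0 p0.

Lemma psd_schur k p0 : psd k -> k p0 p0 != 0 -> psd (schur k p0).
Proof.
move=> pk k0; have [h p] := pk; have kr : Num.conj (k p0 p0) = k p0 p0 by rewrite -h.
split=> [x y|r].
  rewrite /schur rmorphB /= ![Num.conj (_ / _)]cconjM cconjM -!h fmorphV /= kr; ring.
pose S := \sum_(q <- r) q.1 * k p0 q.2.
have SE : \sum_(q <- r) Num.conj q.1 * k q.2 p0 = Num.conj S.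
  by rewrite rmorph_sum; apply: eq_bigr => q _; rewrite rmorphM /= -h.
have := p (r ++ [:: (- (S / k p0 p0), p0)]).
rewrite qformDl !qformDr qform1r !qform1l big_seq1 /= -/S SE.
have e2 : qform (fun x y => k x p0 * k p0 y) r r = Num.conj S * S.
  rewrite -SE mulr_suml; apply: eq_bigr => p' _; rewrite mulr_sumr.
  by apply: eq_bigr => q _; ring.
have -> : qform (schur k p0) r r = - (k p0 p0)^-1 * (Num.conj S * S) + qform k r r.
  by rewrite -e2 -qform_lin; apply: eq_qform => x y; rewrite /schur; ring.
rewrite rmorphN rmorphM fmorphV /= kr.
have cS : Num.conj (- (S / k p0 p0)) = - (Num.conj S / k p0 p0).
  by rewrite rmorphN rmorphM fmorphV /= kr.
rewrite ?cS; set e := (X in 0 <= X -> _).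
by have -> : e = - (k p0 p0)^-1 * (Num.conj S * S) + qform k r r by rewrite /e; field.
Qed.

(** Induction on the number of points. Subtracting the Schur complement at the first point leaves a
    kernel of rank one, and its product with [b] is [b] with rescaled coefficients. The complement
    vanishes at the first point, which then drops out of the form. *)
Lemma psdM k b : psd k -> psd b -> psd (fun x y => k x y * b x y).
Proof.
move=> pk pb; split=> [x y|r]; first by rewrite (proj1 pk) (proj1 pb) rmorphM.
elim: r k pk => [|[c0 x0] r IH] k pk; first by rewrite /qform big_nil.
have drop k' : psd k' -> (forall y, k' x0 y = 0) ->
    0 <= qform (fun x y => k' x y * b x y) ((c0, x0) :: r) ((c0, x0) :: r).
  move=> pk' k'0; rewrite -cat1s qformDl !qformDr !qform1l qform1r.
  have h1 (s : seq (C * X)) : \sum_(q <- s) q.1 * (k' x0 q.2 * b x0 q.2) = 0.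
    by rewrite big1 // => q _; rewrite k'0 mul0r mulr0.
  have h2 : \sum_(q <- r) Num.conj q.1 * (k' q.2 x0 * b q.2 x0) = 0.
    by rewrite big1 // => q _; rewrite (proj1 pk') k'0 conjC0 mul0r mulr0.
  by rewrite !h1 h2 !mulr0 !add0r; apply: IH.
have [k0|k0] := eqVneq (k x0 x0) 0.
  by apply: drop => // y; apply: psd_null.
have -> r' : qform (fun x y => k x y * b x y) r' r' =
    (k x0 x0)^-1 * qform (fun x y => (Num.conj (k x0 x) * k x0 y) * b x y) r' r' +
    qform (fun x y => schur k x0 x y * b x y) r' r'.
  rewrite -qform_lin; apply: eq_qform => x y; rewrite /schur -(proj1 pk); ring.
apply: addr_ge0.
  apply: mulr_ge0; first by rewrite invr_ge0; apply: psd_diag pk.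
  have -> : qform (fun x y => (Num.conj (k x0 x) * k x0 y) * b x y)
      ((c0, x0) :: r) ((c0, x0) :: r) =
    qform b [seq (p.1 * k x0 p.2, p.2) | p <- (c0, x0) :: r]
            [seq (p.1 * k x0 p.2, p.2) | p <- (c0, x0) :: r].
    rewrite /qform big_map; apply: eq_bigr => p _; rewrite big_map.
    by apply: eq_bigr => q _; rewrite cconjM /=; ring.
  exact: (proj2 pb).
apply: drop; first exact: psd_schur.
by move=> y; rewrite /schur; field.
Qed.

End Kernel.

Lemma psd_pullback (X Y : Type) (f : Y -> X) (k : X -> X -> C) :
  psd k -> psd (fun x y => k (f x) (f y)).
Proof.
case=> h p; split=> [x y|r]; first exact: h.
have -> : qform (fun x y => k (f x) (f y)) r r =
    qform k [seq (q.1, f q.2) | q <- r] [seq (q.1, f q.2) | q <- r].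
  by rewrite /qform big_map; apply: eq_bigr => q _; rewrite big_map.
exact: p.
Qed.

End PosDef.

Section Lift.
Open Scope fset_scope.
Open Scope ring_scope.
Variables (F : comNzRingType) (K : choiceType) (W : lmodType F).
Local Notation V := (malg K F).
Local Notation U k := (mkmalgU k (1 : F)).

Definition lift (f : K -> W) (g : V) : W := \sum_(k <- msupp g) mcoeff k g *: f k.

Lemma liftEw f (d : {fset K}) g : msupp g `<=` d -> lift f g = \sum_(k <- d) mcoeff k g *: f k.
Proof.
move=> le; rewrite /lift (big_fset_incl _ le) => //= x xd /mcoeff_outdom ->.
by rewrite scale0r.
Qed.

Lemma lift_is_linear f : linear (lift f).
Proof.
move=> c g1 g2; pose d := msupp g1 `|` msupp g2.
have le1 : msupp g1 `<=` d by apply: fsubsetUl.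
have le2 : msupp g2 `<=` d by apply: fsubsetUr.
have le3 : msupp (c *: g1 + g2) `<=` d.
  apply: fsubset_trans (msuppD_le _ _) _; rewrite fsubUset le2 andbT.
  exact: fsubset_trans (msuppZ_le _ _) le1.
rewrite !(liftEw _ (d := d)) // scaler_sumr -big_split; apply: eq_bigr => k _.
by rewrite mcoeffD mcoeffZ scalerDl scalerA.
Qed.

HB.instance Definition _ f := GRing.isLinear.Build F V W *:%R (lift f) (lift_is_linear f).

Lemma liftU f k : lift f (U k) = f k.
Proof. by rewrite (liftEw _ msuppU_le) big_seq_fset1 mcoeffUU scale1r. Qed.

End Lift.

Section LiftId.
Variables (F : comNzRingType) (K : choiceType).
Local Notation V := (malg K F).

Lemma lift_id (g : V) : g = \sum_(k <- msupp g) mcoeff k g *: (mkmalgU k (1 : F) : V).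
Proof.
rewrite {1}[g]monalgE; apply: eq_bigr => k _; apply/malgP => k'.
by rewrite mcoeffZ !mcoeffU mulr_natr.
Qed.

End LiftId.

Lemma stateZ (R : realType) (P : cstar_prob_space R) c (a : P) : state P (c *: a) = c * state P a.
Proof. exact: linearZ. Qed.

Lemma stateD (R : realType) (P : cstar_prob_space R) (a b : P) :
  state P (a + b) = state P a + state P b.
Proof. exact: raddfD. Qed.

Lemma stateB (R : realType) (P : cstar_prob_space R) (a b : P) :
  state P (a - b) = state P a - state P b.
Proof. exact: raddfB. Qed.

Lemma state_conj (R : realType) (P : cstar_prob_space R) (a : P) :
  state P (star a) = Num.conj (state P a).
Proof.
(* Both numbers are determined by the positivity of phi(x^* x) for x = a + 1 and x = a + i. *)
have real_of (x : P) : complex.Im (state P (star x * x)) = 0.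
  by apply: ger0_Im; apply: state_ge0.
have h1 := real_of (a + 1); have h2 := real_of (a + 'i%C *: 1); have h0 := real_of a.
have h3 := real_of 1.
move: h1 h2; rewrite !starD starZ star1 !mulrDl !mulrDr !mulr1 !mul1r.
rewrite -!scalerAl -!scalerAr !mulr1 !mul1r !scalerA.
rewrite !raddfD /= h0 state1 !linearZ /= state1.
case: (state P a) (state P (star a)) => [x y] [x' y'] /= e1 e2.
by apply/eqP; rewrite eq_complex /=; apply/andP; split; apply/eqP; lra.
Qed.

(** * Reduced words and left multiplication *)

Section FreeProduct.
Variables (R : realType) (I : finType) (P : I -> cstar_prob_space R).
Local Notation C := R[i].

Definition fiber (i : I) : choiceType := cps_alg (P i).
Definition pletter := {i : I & fiber i}.
Implicit Types (e f : pletter) (s t r : seq pletter).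

Definition tagletter i (a : P i) : pletter := Tagged fiber a.

Definition proj i e : P i := untag (0 : P i) (fun x : fiber i => x : P i) e.

Lemma proj_same i (a : P i) : proj i (tagletter a) = a.
Proof. by rewrite /proj (untagE _ _ (erefl : tag (tagletter a) = i)) /=. Qed.

Lemma proj_diff i e : tag e != i -> proj i e = 0.
Proof. exact: untag_dflt. Qed.

(** The inner product of the centred parts, so that letters need not be centred themselves. *)
Definition cov i (a b : P i) : C := state _ (star a * b) - Num.conj (state _ a) * state _ b.

Lemma cov0l i (b : P i) : cov 0 b = 0.
Proof. by rewrite /cov star0 mul0r !raddf0 mul0r subrr. Qed.

Lemma cov0r i (b : P i) : cov b 0 = 0.
Proof. by rewrite /cov mulr0 !raddf0 mulr0 subrr. Qed.

Lemma psd_state i : psd (fun a b : P i => state _ (star a * b)).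
Proof.
split=> [a b|r]; first by rewrite -state_conj starM starK.
pose y := \sum_(p <- r) p.1 *: p.2.
suff -> : qform (fun a b : P i => state _ (star a * b)) r r = state _ (star y * y)
  by apply: state_ge0.
rewrite /y.
have -> : star (\sum_(p <- r) p.1 *: p.2) = \sum_(p <- r) Num.conj p.1 *: star p.2.
  elim: (r) => [|p r' IH]; first by rewrite !big_nil star0.
  by rewrite !big_cons starD starZ IH.
rewrite mulr_suml linear_sum; apply: eq_bigr => p _.
rewrite mulr_sumr linear_sum; apply: eq_bigr => q _.
have -> : Num.conj p.1 *: star p.2 * (q.1 *: q.2) = (Num.conj p.1 * q.1) *: (star p.2 * q.2).
  by rewrite -scalerAl -scalerAr scalerA.
by rewrite stateZ.
Qed.

Lemma psd_cov i : psd (@cov i).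
Proof.
apply: eq_psd (psd_pullback (fun a : P i => a - (state _ a)%:A) (psd_state i)) => a b /=.
set x := state _ a; set y := state _ b.
have -> : star (a - x%:A) * (b - y%:A) =
    star a * b - y *: star a - (Num.conj x *: b - (Num.conj x * y)%:A).
  rewrite starD starN starZ star1 mulrBl !mulrBr -!scalerAl -!scalerAr !mulr1 mul1r.
  by rewrite scalerA.
by rewrite !stateB !stateZ state1 state_conj /cov -/x -/y; ring.
Qed.

(** Only equal tags contribute, since [proj] is zero elsewhere; the form as a sum over all tags
    exhibits a sum of pulled-back positive definite kernels. *)
Definition lcov e f : C := \sum_(i : I) cov (proj i e) (proj i f).

Fixpoint wker s t : C :=
  match s, t with
  | [::], [::] => 1
  | e :: s', f :: t' => lcov e f * wker s' t'
  | _, _ => 0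
  end.

Definition alt s := sorted (fun e f => tag e != tag f) s.

Definition kern s t : C := (alt s)%:R * (alt t)%:R * wker s t.

Definition hproj i s : P i := if s is e :: _ then proj i e else 0.

Definition empt s : C := (s == [::])%:R.

(** A version of [wker] built from sums, products and pullbacks with total functions on words, the
    operations that preserve positive definiteness. It agrees with [wker] once [n] bounds the length
    of the first word. *)
Fixpoint tker n s t : C :=
  if n is n'.+1 then
    empt s * empt t + (\sum_(i : I) cov (hproj i s) (hproj i t)) * tker n' (behead s) (behead t)
  else empt s * empt t.

Lemma psd_empt : psd (fun s t => empt s * empt t).
Proof.
apply: eq_psd (psd_rank1 empt) => s t; congr (_ * _).
by rewrite /empt; case: eqP; rewrite ?conjC1 ?conjC0.
Qed.

Lemma psd_tker n : psd (tker n).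
Proof.
elim: n => [|n IH]; first exact: psd_empt.
apply: psdD psd_empt _; apply: psdM; last exact: psd_pullback.
by apply: psd_sum => i; apply: psd_pullback (psd_cov i).
Qed.

Lemma wker_tker n s t : (size s <= n)%N -> wker s t = tker n s t.
Proof.
elim: n s t => [|n IH] [|e s] [|f t] //= lsn; rewrite /empt /= ?mulr1 ?mul0r ?mulr0 ?add0r //.
- by rewrite big1 ?mul0r ?addr0 // => i _; rewrite cov0l.
- by rewrite big1 ?mul0r ?addr0 // => i _; rewrite cov0l.
- by rewrite big1 ?mul0r ?addr0 // => i _; rewrite cov0r.
- by rewrite IH.
Qed.

Lemma psd_wker : psd wker.
Proof.
split=> [s t|r].
  rewrite (@wker_tker (maxn (size s) (size t))) ?leq_maxr //.
  by rewrite (@wker_tker (maxn (size s) (size t)) s) ?leq_maxl // (proj1 (psd_tker _)).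
pose n := \max_(p <- r) size p.2.
suff -> : qform wker r r = qform (tker n) r r by apply: (proj2 (psd_tker n)).
apply: eq_big_seq => p pr; apply: eq_bigr => q _; rewrite (@wker_tker n) //.
exact: (@leq_bigmax_seq _ r xpredT (fun p => size p.2) p pr).
Qed.

Lemma psd_kern : psd kern.
Proof.
apply: psdM psd_wker; apply: eq_psd (psd_rank1 (fun s => (alt s)%:R)) => s t.
by rewrite conjC_nat.
Qed.

(* [s] is read in (the space of [P i]) (x) (words not starting with [i]): up to
   null vectors it is [hpart i s] followed by [rpart i s]. *)
Definition hpart i s : P i :=
  if alt s then
    if s is e :: _ then
      if tag e == i then proj i e - (state _ (proj i e))%:A else 1
    else 1
  else 0.

Definition rpart i s : seq pletter :=
  if alt s then
    if s is e :: s' then if tag e == i then s' else s else [::]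
  else [::].

Definition avoids i s := alt s && (if s is e :: _ then tag e != i else true).

Lemma avoids_rpart i s : avoids i (rpart i s).
Proof.
rewrite /avoids /rpart; case: ifP => // als; case: s als => [|e s] //= als.
case: eqP => [ei|/eqP ei]; last by rewrite /alt /= als ei.
rewrite /alt (path_sorted als); case: s als => [|f s] //= /andP[+ _].
by rewrite -ei eq_sym.
Qed.

Lemma lcov_tag i (x : P i) e : lcov (tagletter x) e = cov x (proj i e).
Proof.
rewrite /lcov (bigD1 i) //= proj_same big1 ?addr0 // => j ji.
by rewrite proj_diff ?cov0l // eq_sym.
Qed.

Lemma kernC s t : kern t s = Num.conj (kern s t).
Proof. exact: (proj1 psd_kern). Qed.

Lemma kern_avoids i (x : P i) r r' : avoids i r -> avoids i r' -> kern (tagletter x :: r) r' = 0.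
Proof.
move=> _ /andP[_]; rewrite /kern; case: r' => [|f r'] /=; first by rewrite mulr0.
by move=> fi; rewrite lcov_tag proj_diff // cov0r mul0r mulr0.
Qed.

Lemma alt_cons i (x : P i) r : avoids i r -> alt (tagletter x :: r).
Proof. by case/andP; case: r => [|f r] //=; rewrite /alt /= eq_sym => -> ->. Qed.

Lemma kern_same i (x y : P i) r r' : avoids i r -> avoids i r' ->
  kern (tagletter x :: r) (tagletter y :: r') = cov x y * kern r r'.
Proof.
move=> ar ar'; rewrite /kern !alt_cons // /= lcov_tag proj_same.
by case/andP: ar => -> _; case/andP: ar' => -> _; rewrite !mul1r.
Qed.

(** One of the two terms always vanishes: the first when [s] starts with [i], because [hpart] is
    then centred, the second otherwise, because [hpart] is [1] or [0] and has covariance zero with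
    everything. *)
Lemma kern_hpart i s t :
  kern s t = Num.conj (state _ (hpart i s)) * kern (rpart i s) t +
             kern (tagletter (hpart i s) :: rpart i s) t.
Proof.
have z0 (x : P i) (r : seq pletter) : (forall y, cov x y = 0) -> kern (tagletter x :: r) t = 0.
  move=> cx; rewrite /kern; case: t => [|f t] /=; first by rewrite mulr0.
  by rewrite lcov_tag cx mul0r mulr0.
have c1 y : cov (1 : P i) y = 0 by rewrite /cov star1 mul1r state1 conjC1 mul1r subrr.
rewrite /hpart /rpart; case: ifP => als; last first.
  by rewrite z0 ?raddf0 ?conjC0 ?mul0r ?addr0 /kern ?als ?mul0r // => y; rewrite cov0l.
case: s als => [|e s] als; first by rewrite state1 conjC1 mul1r z0 ?addr0.
case: eqP => ei; last by rewrite state1 conjC1 mul1r z0 ?addr0.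
rewrite stateB stateZ state1 mulr1 subrr conjC0 mul0r add0r /kern.
have -> : alt (tagletter (proj i e - (state (P i) (proj i e))%:A) :: s) = alt (e :: s).
  by rewrite /alt /=; case: (s) => //= f s'; rewrite ei.
congr (_ * _); case: t {z0} => [|f t] //=; congr (_ * _).
rewrite lcov_tag /lcov (bigD1 i) //= big1 ?addr0 => [|j ji]; last first.
  by rewrite proj_diff ?cov0l // ei eq_sym.
rewrite /cov starD starN starZ star1 mulrDl mulNr -scalerAl mul1r.
rewrite stateB !stateB !stateZ state1; ring.
Qed.

Definition fp_carrier : lmodType C := malg (seq pletter) C.
Local Notation V := fp_carrier.
Definition base s : V := mkmalgU s (1 : C).

Definition kern_form (u v : V) : C :=
  \sum_(s <- msupp u) \sum_(t <- msupp v) Num.conj (mcoeff s u) * mcoeff t v * kern s t.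

Definition kern_row (u : V) : seq pletter -> C^o := fun t =>
  \sum_(s <- msupp u) Num.conj (mcoeff s u) * kern s t.

Lemma kern_formE u v : kern_form u v = lift (kern_row u) v.
Proof.
rewrite /kern_form exchange_big; apply: eq_bigr => t _.
rewrite /kern_row scaler_sumr; apply: eq_bigr => s _.
by rewrite /GRing.scale /=; ring.
Qed.

Lemma kern_formD u v w : kern_form u (v + w) = kern_form u v + kern_form u w.
Proof. by rewrite !kern_formE raddfD. Qed.

Lemma kern_formZ c u v : kern_form u (c *: v) = c * kern_form u v.
Proof. by rewrite !kern_formE linearZ. Qed.

Lemma kern_formC u v : kern_form v u = Num.conj (kern_form u v).
Proof.
rewrite /kern_form rmorph_sum exchange_big; apply: eq_bigr => s _.
rewrite rmorph_sum; apply: eq_bigr => t _.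
by rewrite /= 2!cconjM cconjK -kernC; ring.
Qed.

Lemma kern_form_ge0 u : 0 <= kern_form u u.
Proof.
have := proj2 psd_kern [seq (mcoeff s u, s) | s <- msupp u].
rewrite /qform big_map; under eq_bigr do rewrite big_map /=.
exact.
Qed.

Lemma kern_form_base s t : kern_form (base s) (base t) = kern s t.
Proof.
rewrite kern_formE /base liftU /kern_row msuppU oner_eq0 big_seq_fset1.
by rewrite mcoeffUU conjC1 mul1r.
Qed.

Lemma kern_form_vacuum : kern_form (base [::]) (base [::]) = 1.
Proof. by rewrite kern_form_base /kern /= !mul1r. Qed.

Definition fp_space : preHilbert R := @PreHilbert R fp_carrier kern_form kern_formD kern_formZ
  kern_formC kern_form_ge0 (base [::]) kern_form_vacuum.

Implicit Types u v w : fp_space.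

Lemma ip_sumr (J : Type) (q : seq J) (c : J -> C) (f : J -> fp_space) u :
  ip u (\sum_(j <- q) c j *: f j) = \sum_(j <- q) c j * ip u (f j).
Proof.
elim: q => [|j q IH]; last by rewrite !big_cons ipDr ipZr IH.
by rewrite !big_nil -(scale0r (0 : fp_space)) ipZr mul0r.
Qed.

Lemma ip_suml (J : Type) (q : seq J) (c : J -> C) (f : J -> fp_space) u :
  ip (\sum_(j <- q) c j *: f j) u = \sum_(j <- q) Num.conj (c j) * ip (f j) u.
Proof.
rewrite ipC ip_sumr rmorph_sum; apply: eq_bigr => j _.
by rewrite [in RHS]ipC -cconjM.
Qed.

Lemma ip_lift (f g : seq pletter -> fp_space) (u v : fp_space) :
  ip (lift f u : fp_space) (lift g v : fp_space) =
  \sum_(s <- msupp u) \sum_(t <- msupp v) Num.conj (mcoeff s u) * mcoeff t v * ip (f s) (g t).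
Proof.
rewrite ip_suml; apply: eq_bigr => s _; rewrite ip_sumr mulr_sumr.
by apply: eq_bigr => t _; rewrite mulrA.
Qed.

Lemma lift_base (u : fp_space) : lift (base : seq pletter -> fp_space) u = u.
Proof. by rewrite [RHS]lift_id. Qed.

Lemma ip_base s t : ip (base s : fp_space) (base t : fp_space) = kern s t.
Proof. exact: kern_form_base. Qed.

(** The elementary tensor of [x] and [r]: its component along [r], plus a letter [x] of which the
    kernel sees the centred part only. *)
Definition vec i (x : P i) r : fp_space := state _ x *: base r + base (tagletter x :: r).

Lemma ip_vec i (x y : P i) r r' : avoids i r -> avoids i r' ->
  ip (vec x r) (vec y r') = state _ (star x * y) * kern r r'.
Proof.
move=> ar ar'; rewrite /vec !ipDr !ipDl !ipZr !ipZl !ip_base kern_same //.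
rewrite (kern_avoids _ ar ar') [kern r (_ :: _)]kernC (kern_avoids _ ar' ar) conjC0 /cov.
ring.
Qed.

Lemma ip_hpart i s w : ip (base s : fp_space) w = ip (vec (hpart i s) (rpart i s)) w.
Proof.
rewrite -(lift_base w) [lift _ _]/lift !ip_sumr; apply: eq_bigr => t _; congr (_ * _).
by rewrite /vec ipDl ipZl !ip_base (kern_hpart i).
Qed.

Definition left_mul i (a : P i) : fp_space -> fp_space :=
  lift (fun t => vec (a * hpart i t) (rpart i t)).

Definition block_form i (a : P i) s t : C :=
  state _ (star (hpart i s) * (a * hpart i t)) * kern (rpart i s) (rpart i t).

Lemma ip_left_mul i (a : P i) u v : ip u (left_mul a v) =
  \sum_(s <- msupp u) \sum_(t <- msupp v) Num.conj (mcoeff s u) * mcoeff t v * block_form a s t.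
Proof.
rewrite -{1}(lift_base u) ip_lift; apply: eq_bigr => s _; apply: eq_bigr => t _.
by rewrite (ip_hpart i) ip_vec ?avoids_rpart.
Qed.

Lemma ip_left_mul2 i (a b : P i) u v : ip (left_mul a u) (left_mul b v) =
  \sum_(s <- msupp u) \sum_(t <- msupp v) Num.conj (mcoeff s u) * mcoeff t v *
     block_form (star a * b) s t.
Proof.
rewrite ip_lift; apply: eq_bigr => s _; apply: eq_bigr => t _.
by rewrite ip_vec ?avoids_rpart // starM /block_form !mulrA.
Qed.

Lemma ip_block i u v : ip u v =
  \sum_(s <- msupp u) \sum_(t <- msupp v) Num.conj (mcoeff s u) * mcoeff t v *
     block_form (1 : P i) s t.
Proof.
rewrite -{1}(lift_base u) -{1}(lift_base v) ip_lift.
apply: eq_bigr => s _; apply: eq_bigr => t _.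
rewrite (ip_hpart i) ipC (ip_hpart i) -ipC ip_vec ?avoids_rpart //.
by rewrite /block_form mul1r.
Qed.

Lemma block_formC i (a : P i) s t : block_form (star a) s t = Num.conj (block_form a t s).
Proof.
rewrite /block_form cconjM -state_conj -kernC; congr (state _ _ * _).
by rewrite !starM starK mulrA.
Qed.

(** By [state_bound] the kernel [K phi(x^* y) - phi((a x)^* (a y))] is positive definite. Its Schur
    product with the kernel of the tails is [K] times the squared norm minus that of the image. *)
Lemma left_mulP i (a : P i) :
  (forall u v, ip u (left_mul a v) = ip (left_mul (star a) u) v) /\
  exists2 K, 0 <= K & forall v, nrm (left_mul a v) <= K * nrm v.
Proof.
split=> [u v|].
  rewrite [RHS]ipC !ip_left_mul exchange_big rmorph_sum; apply: eq_bigr => s _ /=.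
  rewrite rmorph_sum; apply: eq_bigr => t _ /=.
  by rewrite 2!cconjM cconjK block_formC cconjK; ring.
have [K K0 hK] := state_bound a; exists (Num.sqrt K) => [|v]; first exact: sqrtr_ge0.
rewrite -ler_sqr ?nnegrE ?mulr_ge0 ?nrm_ge0 ?sqrtr_ge0 // exprMn (sqr_sqrtr K0).
have eK : (K * nrm v ^+ 2)%:C = K%:C * ip v v by rewrite ip_self -rmorphM.
rewrite -lecR eK -ip_self ip_left_mul2 (ip_block i) -subr_ge0.
pose k (x y : P i) : C := K%:C * state _ (star x * y) - state _ (star (a * x) * (a * y)).
have kq (r : seq (C * P i)) : qform k r r =
      K%:C * qform (fun x y : P i => state _ (star x * y)) r r -
    qform (fun x y : P i => state _ (star (a * x) * (a * y))) r r.
  rewrite -mulN1r addrC.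
  rewrite (@eq_qform _ _ k (fun x y => (-1) * state _ (star (a * x) * (a * y)) +
     (K%:C * state _ (star x * y) + 0))); last by move=> x y; rewrite /k; ring.
  rewrite qform_lin qform_lin; congr (_ + _).
  rewrite (_ : qform (fun _ _ : P i => 0) r r = 0) ?addr0 // /qform big1 // => p _.
  by rewrite big1 // => q _; rewrite mulr0.
have pk : psd k.
  split=> [x y|r].
    by rewrite /k rmorphB /= cconjM cconj_real -!state_conj !starM !starK !mulrA.
  rewrite kq.
  have sq (b : P i) : qform (fun x y : P i => state _ (star (b * x) * (b * y))) r r =
      state _ (star (b * \sum_(p <- r) p.1 *: p.2) * (b * \sum_(p <- r) p.1 *: p.2)).
    rewrite mulr_sumr.
    have -> : star (\sum_(p <- r) b * (p.1 *: p.2)) = \sum_(p <- r) Num.conj p.1 *: star (b * p.2).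
      elim: (r) => [|p r' IH]; first by rewrite !big_nil star0.
      by rewrite !big_cons starD -scalerAr starZ IH.
    rewrite mulr_suml linear_sum; apply: eq_bigr => p _.
    rewrite mulr_sumr linear_sum; apply: eq_bigr => q _.
    have -> : Num.conj p.1 *: star (b * p.2) * (b * (q.1 *: q.2)) =
        (Num.conj p.1 * q.1) *: (star (b * p.2) * (b * q.2)).
      by rewrite -scalerAr -scalerAl -scalerAr scalerA.
    by rewrite stateZ.
  have -> : qform (fun x y : P i => state _ (star x * y)) r r =
      qform (fun x y : P i => state _ (star (1 * x) * (1 * y))) r r.
    by apply: eq_qform => x y; rewrite !mul1r.
  by rewrite !sq !mul1r subr_ge0; apply: hK.
have := proj2 (psdM (psd_pullback (hpart i) pk) (psd_pullback (rpart i) psd_kern))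
   [seq (mcoeff s v, s) | s <- msupp v].
rewrite /qform big_map mulr_sumr -sumrB.
set e := (X in 0 <= X -> _); set e' := (X in _ -> 0 <= X).
suff -> : e = e' by [].
apply: eq_bigr => s _; rewrite big_map mulr_sumr -sumrB; apply: eq_bigr => t _ /=.
rewrite /k /block_form starM mul1r !mulrA; ring.
Qed.

Definition left_op i (a : P i) : oper fp_space := Oper (left_mulP a).1 (left_mulP a).2.

Definition fp_incl i (a : P i) : formOp fp_space := of_op (left_op a).

Lemma fp_inclE i (a : P i) u v : kform (fp_incl a) u v =
  \sum_(s <- msupp u) \sum_(t <- msupp v) Num.conj (mcoeff s u) * mcoeff t v * block_form a s t.
Proof. exact: ip_left_mul. Qed.

Lemma fp_incl_linear i c (a b : P i) : fp_incl (c *: a + b) = c *: fp_incl a + fp_incl b.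
Proof.
apply: kform_inj => u v; rewrite kformD kformZ !fp_inclE mulr_sumr -big_split.
apply: eq_bigr => s _; rewrite mulr_sumr -big_split; apply: eq_bigr => t _ /=.
have e (x y : P i) : x * ((c *: a + b) * y) = c *: (x * (a * y)) + x * (b * y).
  by rewrite mulrDl mulrDr -scalerAl -scalerAr.
by rewrite /block_form e stateD stateZ; ring.
Qed.

Lemma fp_incl1 i : fp_incl (1 : P i) = 1.
Proof. by apply: kform_inj => u v; rewrite kform1 (ip_block i) fp_inclE. Qed.

Lemma fp_inclM i (a b : P i) : fp_incl (a * b) = fp_incl a * fp_incl b.
Proof.
rewrite /fp_incl of_op_mul; apply: kform_inj => u v.
rewrite [LHS]ip_left_mul.
have -> : kform (of_op (comp_op (left_op a) (left_op b))) u v = ip u (left_mul a (left_mul b v)).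
  by [].
by rewrite (left_mulP a).1 ip_left_mul2 starK.
Qed.

Lemma fp_incl_star i (a : P i) : fp_incl (star a) = star (fp_incl a).
Proof.
apply: kform_inj => u v; rewrite [RHS]fstarE !fp_inclE exchange_big rmorph_sum.
apply: eq_bigr => s _ /=; rewrite rmorph_sum; apply: eq_bigr => t _ /=.
by rewrite 2!cconjM cconjK block_formC; ring.
Qed.

Definition fp_prob : cstar_prob_space R := vacuum_space fp_space.

Lemma left_mul_base i (a : P i) s :
  left_mul a (base s : fp_space) = vec (a * hpart i s) (rpart i s).
Proof. by rewrite /left_mul /base liftU. Qed.

Lemma fp_state i (a : P i) : state fp_prob (fp_incl a) = state _ a.
Proof.
have -> : state fp_prob (fp_incl a) =
    ip (base [::] : fp_space) (left_mul a (base [::] : fp_space)) by [].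
rewrite left_mul_base (_ : hpart i [::] = 1) // (_ : rpart i [::] = [::]) //.
by rewrite mulr1 /vec ipDr ipZr !ip_base /kern /= mulr0 addr0 !mulr1.
Qed.

Lemma left_mul_push i (a : P i) s : avoids i s -> state _ a = 0 ->
  left_mul a (base s : fp_space) = base (tagletter a :: s).
Proof.
case/andP=> als hs a0; rewrite left_mul_base.
have -> : hpart i s = 1.
  by rewrite /hpart als; case: s hs {als} => //= e s /negbTE->.
have -> : rpart i s = s.
  by rewrite /rpart als; case: s hs {als} => //= e s /negbTE->.
by rewrite mulr1 /vec a0 scale0r add0r.
Qed.

(** An alternating product of centred elements sends the vacuum to the base vector of a non-empty
    reduced word, which is orthogonal to the vacuum. *)
Lemma fp_free (S : I -> set fp_prob) :
  (forall i x, S i x -> exists a : P i, x = fp_incl a) -> free_sets S.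
Proof.
move=> hS s s0 ss hs.
have inc i x : unital_subalg_gen (S i) x -> exists a : P i, x = fp_incl a.
  move=> hx; apply: (hx [set y | exists a : P i, y = fp_incl a]%classic); split; last exact: hS.
  split.
  - by apply: mem_set; exists 1; rewrite fp_incl1.
  - move=> c y z /set_mem[b ->] /set_mem[d ->]; apply: mem_set; exists (c *: b + d).
    by rewrite fp_incl_linear.
  - by move=> y z /set_mem[b ->] /set_mem[d ->]; apply: mem_set; exists (b * d); rewrite fp_inclM.
have [w [T [ws wh eT]]] :
    exists (w : seq pletter) (T : oper fp_space), [/\ map tag w = map fst s, alt w &
    \prod_(p <- s) p.2 = of_op T /\ app T (base [::] : fp_space) = base w].
  elim: s ss hs {s0} => [|[i x] s IH] ss hs.
    exists [::], (scalar_op fp_space 1); split=> //; split; last by rewrite /= scale1r.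
    by rewrite big_nil.
  have [||w [T [ws wh [eT vT]]]] := IH.
  - exact: path_sorted ss.
  - by move=> p ps; apply: hs; rewrite inE ps orbT.
  have [xg x0] := hs (i, x) (mem_head _ _); have [a ea] := inc _ _ xg.
  have av : avoids i w.
    rewrite /avoids wh /=; case: w ws {wh vT} => [|e w] //;
      case: s ss {IH hs eT} => //= p s + [-> _].
    by case/andP; rewrite eq_sym.
  exists (tagletter a :: w), (comp_op (left_op a) T); split.
  - by rewrite /= ws.
  - exact: alt_cons.
  split; first by rewrite big_cons eT -of_op_mul; congr (_ * _); exact: ea.
  rewrite /= vT left_mul_push //; move: x0; rewrite -fp_state -[(i, x).2]/x => <-;
    congr (state _ _); exact: esym ea.
case: eT => -> vT.
have -> : state fp_prob (of_op T) = ip (base [::] : fp_space) (app T (base [::] : fp_space)) by [].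
rewrite vT ip_base; case: w ws {wh vT} => [|e w]; first by case: (s) s0.
by rewrite /kern /= mulr0.
Qed.

End FreeProduct.

Lemma free_product (R : realType) (I : finType) (P : I -> cstar_prob_space R) :
  exists (Q : cstar_prob_space R) (j : forall i, P i -> Q),
    [/\ forall i (a b : P i), j i (a * b) = j i a * j i b,
        forall i, j i 1 = 1, forall i (a : P i), j i (star a) = star (j i a),
        forall i (a : P i), state Q (j i a) = state _ a &
        forall S : I -> set Q, (forall i x, S i x -> exists a, x = j i a) -> free_sets S].
Proof.
exists (fp_prob P), (fun i a => fp_incl a); split.
- exact: fp_inclM.
- exact: fp_incl1.
- exact: fp_incl_star.
- exact: fp_state.
- exact: fp_free.
Qed.

(** * A projection of prescribed state *)

Section Projection.
Variables (R : realType) (t : R).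
Hypothesis t01 : 0 <= t <= 1.
Local Notation C := R[i].

Definition plane : lmodType C := (C^o * C^o)%type.

(** The weights [t] and [1 - t] make [(1, 1)] a unit vector at which the projection to the first
    coordinate has state [t]. At the endpoints the form is degenerate, and [t = 1] does occur. *)
Definition plane_ip (u v : plane) : C :=
  t%:C * (Num.conj (u.1 : C) * (v.1 : C)) + (1 - t)%:C * (Num.conj (u.2 : C) * (v.2 : C)).

Lemma plane_ipD u v w : plane_ip u (v + w) = plane_ip u v + plane_ip u w.
Proof. by rewrite /plane_ip /=; ring. Qed.

Lemma plane_ipZ c u v : plane_ip u (c *: v) = c * plane_ip u v.
Proof. by rewrite /plane_ip /= /GRing.scale /=; ring. Qed.

Lemma plane_ipC u v : plane_ip v u = Num.conj (plane_ip u v).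
Proof.
rewrite /plane_ip (_ : Num.conj (_ + _) = Num.conj (t%:C * (Num.conj (u.1 : C) * (v.1 : C))) +
  Num.conj ((1 - t)%:C * (Num.conj (u.2 : C) * (v.2 : C)))); last exact: rmorphD.
by rewrite 4!cconjM !cconjK !cconj_real; ring.
Qed.

Lemma plane_ip_ge0 u : 0 <= plane_ip u u.
Proof.
case/andP: t01 => t0 t1.
rewrite /plane_ip addr_ge0 // mulr_ge0 ?ler0c ?subr_ge0 //.
  by rewrite mulrC mul_conjC_ge0.
by rewrite mulrC mul_conjC_ge0.
Qed.

Lemma plane_vacuum : plane_ip (1, 1) (1, 1) = 1.
Proof. by rewrite /plane_ip /= conjC1 !mulr1 -rmorphD /= addrC subrK. Qed.

Definition plane_space : preHilbert R :=
  @PreHilbert R plane plane_ip plane_ipD plane_ipZ plane_ipC plane_ip_ge0 (1, 1) plane_vacuum.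

Definition first_coord (u : plane_space) : plane_space := ((u : plane).1, 0).

Lemma first_coordP : (forall u v, ip u (first_coord v) = ip (first_coord u) v) /\
  exists2 K, 0 <= K & forall v, nrm (first_coord v) <= K * nrm v.
Proof.
split=> [u v|]; first by rewrite /= /plane_ip /= conjC0 !(mulr0, mul0r).
exists 1 => // v; rewrite mul1r -ler_sqr ?nnegrE ?nrm_ge0 // -lecR -!ip_self /= /plane_ip /=.
rewrite !mulr0 addr0 lerDl mulr_ge0 ?ler0c ?subr_ge0 //; first by case/andP: t01.
by rewrite mulrC mul_conjC_ge0.
Qed.

Definition coord_op : oper plane_space := Oper first_coordP.1 first_coordP.2.

Lemma projection_exists : exists (P : cstar_prob_space R) (p : P),
  [/\ p * p = p, star p = p & state P p = t%:C].
Proof.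
exists (vacuum_space plane_space), (of_op coord_op); split.
- by rewrite of_op_mul; apply: kform_inj => u v.
- apply: kform_inj => u v.
  have -> : kform (star (of_op coord_op)) u v = Num.conj (ip v (first_coord u)) by [].
  have -> : kform (of_op coord_op) u v = ip u (first_coord v) by [].
  by rewrite (proj1 first_coordP) -ipC.
- have -> : state (vacuum_space plane_space) (of_op coord_op) =
    plane_ip (1, 1) (1, 0) by [].
  by rewrite /plane_ip /= conjC1 mulr0 !mulr1 mulr0 addr0.
Qed.

End Projection.

(** * Star-distributions and convolutions *)

Section Functionals.
Variable R : realType.
Implicit Types (mu nu : {scalar ncpoly R}) (w : word).

Lemma ZwordE w : Zword R w = mkmalgU (FMonom w) 1.
Proof.
rewrite /Zword; elim: w => [|l w IH]; first by rewrite big_nil -fmoneE.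
rewrite big_cons IH /Zletter fmuE malgM_def fgmulUU mul1r.
by rewrite (_ : mmul _ _ = FMonom (l :: w)) //; apply: fmmulE.
Qed.

Lemma scalar_eq mu nu : mu =1 nu -> mu = nu.
Proof.
move=> /funext e; case: mu e => f cf; case: nu => g cg /= e.
case: g / e cg => cg; congr GRing.Linear.Pack.
case: cf cg => [[a] [b]] [[a'] [b']].
by rewrite (Prop_irrelevance a a') (Prop_irrelevance b b').
Qed.

Lemma functional_ext mu nu : (forall w, mu (Zword R w) = nu (Zword R w)) -> mu = nu.
Proof.
move=> e; apply: scalar_eq => g; rewrite [g]lift_id !linear_sum; apply: eq_bigr => k _.
rewrite !linearZ; congr (_ * _); have := e (k : seq bool).
by rewrite ZwordE fmK.
Qed.

Lemma functional_exists (m : word -> R[i]) :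
  exists mu : {scalar ncpoly R}, forall w, mu (Zword R w) = m w.
Proof.
pose f (k : fmonom bool) : R[i]^o := m (k : seq bool).
have lf : scalar (lift f : ncpoly R -> R[i]).
  by move=> c u v; rewrite linearP.
pose L : {scalar ncpoly R} := HB.pack (lift f : ncpoly R -> R[i])
  (GRing.isLinear.Build R[i] (ncpoly R) R[i] *%R (lift f : ncpoly R -> R[i]) lf).
by exists L => w; rewrite ZwordE; apply: (liftU f).
Qed.
End Functionals.

(** * The R-transform through the model *)

Section RTransform.
Variable R : realType.
Implicit Types (mu nu : {scalar ncpoly R}) (w : word) (f : ncseries R).

Lemma R_transformP mu : is_R_transform mu (R_transform mu).
Proof.
rewrite /R_transform; case: xgetP => // no; exfalso.
apply: (no (cumulants (fun w => mu (Zword R w)))); split; first exact: cumulants_nil.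
by move=> w w0; exact: esym (cumulantsP (fun w => mu (Zword R w)) w0).
Qed.

Lemma R_transform_unique mu f f' : is_R_transform mu f -> is_R_transform mu f' -> f = f'.
Proof.
move=> [f0 hf] [f'0 hf']; apply/funext; apply: ncsum_inj; first by rewrite f0 f'0.
by move=> w w0; rewrite /ncsum -hf -?hf'.
Qed.

Lemma R_transform_eq mu f : is_R_transform mu f -> R_transform mu = f.
Proof. by move=> hf; apply: R_transform_unique hf; apply: R_transformP. Qed.

Lemma is_R_transform_model (t : R[i]) mu f : f [::] = 0 ->
  is_R_transform mu f <-> (forall w, w != [::] -> mu (Zword R w) = mmodel t f w).
Proof.
move=> f0; split=> [[_ h] w /h ->|h]; first exact: NC_sum_model.
by split=> // w /h ->; rewrite (NC_sum_model t).
Qed.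

End RTransform.

Local Open Scope classical_set_scope.

Section Recolour.
Variables (F : comNzRingType) (t : F) (k : bool -> seq bool -> F).

Lemma model_colour c (w : seq bool) :
  model t k (map (fun l => Some (c, l)) w) = mmodel t (k c) w.
Proof.
pose f := fun b : option (bool * seq bool) => omap (fun b => (c, b.2)) b.
pose L (g : stack -> F) (S : stack) := g (map f S).
have Lvac : L (vac t) =1 vac t.
  by rewrite /L; elim=> [|[b|] S IH] //=; rewrite IH.
rewrite /mmodel /model -[LHS]/(L (run t k [seq Some (c, l) | l <- w] (vac t)) [::]).
suff h S : pure true S -> L (run t k [seq Some (c, l) | l <- w] (vac t)) S =
    run t (kmono (k c)) (mword w) (L (vac t)) S.
  by rewrite h // (eq_run _ _ _ Lvac).
elim/last_ind: w S => [|w l IH] S // pS.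
rewrite /mword !map_rcons !run_rcons -/(mword w) /L /=.
rewrite -(IH (Some (true, [:: l]) :: S)) // -(IH S) // /L /=; congr (_ + _).
case: S pS => [|[[c' v]|] S] //= /andP[/eqP-> pS]; rewrite !eqxx.
by rewrite -(IH (Some (true, l :: v) :: S)) // -(IH S).
Qed.

End Recolour.

(** * Two elements and a projection *)

Section FreeTriple.
Variables (R : realType) (P : cstar_prob_space R).
Implicit Types (x y p : P) (w : word).

Definition triple_gen x y p (i : option bool) : set P :=
  match i with
  | Some true => [set x; star x]
  | Some false => [set y; star y]
  | None => [set p]
  end.

Definition free_triple x y p := free_sets (triple_gen x y p).

Definition triple_letter x y p (l : letter) : P :=
  match l with
  | Some (true, l) => star_letter x l
  | Some (false, l) => star_letter y l
  | None => p
  end.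

Lemma gen_incl (S : set P) x : S x -> unital_subalg_gen S x.
Proof. by move=> Sx B [_ /(_ _ Sx)]. Qed.

Lemma gen_closed (S : set P) : GRing.subalg_closed (mem (unital_subalg_gen S)).
Proof.
split.
- apply: mem_set => B [cB _]; apply: set_mem; by case: cB.
- move=> c x y /set_mem hx /set_mem hy; apply: mem_set => B BS.
  by apply: set_mem; case: (BS) => [[_ + _] _]; apply; apply: mem_set; [apply: hx|apply: hy].
- move=> x y /set_mem hx /set_mem hy; apply: mem_set => B BS.
  by apply: set_mem; case: (BS) => [[_ _ +] _]; apply; apply: mem_set; [apply: hx|apply: hy].
Qed.

Lemma gen1 (S : set P) : unital_subalg_gen S 1.
Proof. by apply: set_mem; case: (gen_closed S). Qed.

Lemma genM (S : set P) x y : unital_subalg_gen S x -> unital_subalg_gen S y ->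
  unital_subalg_gen S (x * y).
Proof.
move=> hx hy; apply: set_mem; case: (gen_closed S) => _ _; apply; exact: mem_set.
Qed.

Lemma gen_lin (S : set P) c x y : unital_subalg_gen S x -> unital_subalg_gen S y ->
  unital_subalg_gen S (c *: x + y).
Proof.
move=> hx hy; apply: set_mem; case: (gen_closed S) => _ + _; apply; exact: mem_set.
Qed.

Lemma gen_sub_scalar x : unital_subalg_gen [set (1 : P)] x -> exists c, x = c%:A.
Proof.
move=> hx; apply: (hx [set z | exists c, z = c%:A]); split; last first.
  by move=> z ->; exists 1; rewrite scale1r.
split.
- by apply: mem_set; exists 1; rewrite scale1r.
- move=> c z z' /set_mem[d ->] /set_mem[d' ->]; apply: mem_set; exists (c * d + d').
  by rewrite scalerDl scalerA.
- move=> z z' /set_mem[d ->] /set_mem[d' ->]; apply: mem_set; exists (d * d').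
  by rewrite -scalerAl mul1r scalerA.
Qed.

(** A centred element of the algebra generated by [1] is zero, so products involving that algebra
    vanish and the others are covered by the freeness of the pair. *)
Lemma star_free_triple a a' : star_free a a' -> free_triple a a' 1.
Proof.
move=> fr s s0 ss hs.
have [no|] := boolP (has (fun q => q.1 == None) s); last first.
  move=> /hasPn nN.
  pose s' := [seq (odflt true q.1, q.2) | q <- s].
  have e : \prod_(q <- s) q.2 = \prod_(q <- s') q.2 by rewrite big_map.
  rewrite e; apply: fr.
  - by rewrite /s'; case: (s) s0.
  - rewrite /s' sorted_map; apply: (sub_in_sorted (P := [in s])) ss; last exact/allP.
    move=> [[i|] q] [[j|] q'] h h' //=; by [have := nN _ h | have := nN _ h'|].
  - move=> _ /mapP[[[i|] q] qs ->] /=; last by have := nN _ qs.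
    have := hs _ qs => /= -[h1 h2]; split=> //.
case/hasP: no => -[i q] qs /= /eqP ei; rewrite {}ei in qs.
have [/= /gen_sub_scalar[c ec] q0] := hs _ qs.
have {ec q0} q0 : q = 0 by move: q0; rewrite /= ec stateZ state1 mulr1 => ->; rewrite scale0r.
suff -> : \prod_(r <- s) r.2 = 0 by rewrite raddf0.
rewrite {}q0 in qs; elim: s qs {s0 ss hs} => // r s IH; rewrite inE big_cons.
by case/orP=> [/eqP <-|/IH ->]; rewrite ?mul0r ?mulr0.
Qed.

Lemma eword_star_word x y p c w :
  eword (triple_letter x y p) (map (fun l => Some (c, l)) w) =
  star_word (if c then x else y) w.
Proof. by rewrite /eword /star_word big_map; apply: eq_bigr => l _; case: c. Qed.

Lemma mono_color c (u : seq letter) : mono (Some c) u -> exists w, u = map (fun l => Some (c, l)) w.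
Proof.
case/andP=> _; elim: u => [|[[c' l]|] u IH] //=; first by exists [::].
by case/andP=> /eqP[->] /IH[w ->]; exists (l :: w).
Qed.

(** Centred chunks are centred elements of the generated algebras, so freeness supplies the
    vanishing that [phi_model] asks for; a chunk of projections collapses to [p] by idempotence. *)
Lemma free_triple_model (t : R[i]) (k : bool -> word -> R[i]) x y p :
  free_triple x y p -> p * p = p -> state P p = t ->
  (forall w, state P (star_word x w) = mmodel t (k true) w) ->
  (forall w, state P (star_word y w) = mmodel t (k false) w) ->
  forall u, state P (eword (triple_letter x y p) u) = model t k u.
Proof.
move=> fr pp pt hx hy.
have proj_pow (u : seq letter) : mono None u -> eword (triple_letter x y p) u = p.
  case/andP; elim: u => [|[[c l]|] u IH] //= _ /= un.
  rewrite /eword big_cons /=; have [->|u0] := eqVneq u [::]; first by rewrite big_nil mulr1.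
  by have := IH u0 un; rewrite /eword => ->.
have hmono (u : seq letter) : mono (chunk_color u) u ->
    state P (eword (triple_letter x y p) u) = model t k u.
  case: (chunk_color u) => [c /mono_color[w ->]|un].
    by rewrite eword_star_word model_colour; case: (c).
  by rewrite proj_pow // pt model_mark.
apply: phi_model => //; first exact: state1.
move=> ws ws0 mws sws.
pose s := [seq (chunk_color v, centred (state P) (triple_letter x y p) v) | v <- ws].
have -> : \prod_(v <- ws) centred (state P) (triple_letter x y p) v = \prod_(q <- s) q.2.
  by rewrite big_map.
apply: fr; first by rewrite /s -size_eq0 size_map -lt0n.
  by rewrite /s sorted_map.
move=> _ /mapP[v vws ->] /=; split; last first.
  by rewrite /centred stateB stateZ state1 mulr1 subrr.
rewrite /centred -scaleNr addrC; apply: gen_lin; first exact: gen1.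
have /allP/(_ _ vws)/andP[_] := mws.
move: (chunk_color v) => i; elim: v {vws} => [|l v IH] /=.
  by rewrite /eword big_nil => _; apply: gen1.
case/andP=> /eqP li /IH h; rewrite /eword big_cons; apply: genM h; apply: gen_incl.
by case: l li => [[[] []]|] /= <-; rewrite /star_letter /=; [right|left|right|left|].
Qed.

End FreeTriple.

Lemma star_letterD (R : realType) (A : cstarAlgType R) (a b : A) l :
  star_letter (a + b) l = star_letter a l + star_letter b l.
Proof. by case: l; rewrite /= ?starD. Qed.

Section Convolutions.
Variable R : realType.
Implicit Types (mu nu rho : {scalar ncpoly R}) (w : word) (f : ncseries R).

Lemma dist_model (P : cstar_prob_space R) (a : P) mu f (t : R[i]) :
  is_star_distribution a mu -> is_R_transform mu f ->
  forall w, state P (star_word a w) = mmodel t f w.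
Proof.
move=> ha hf w; rewrite -ha; have [->|w0] := eqVneq w [::].
  by rewrite ha /star_word big_nil state1.
exact: (proj1 (is_R_transform_model t mu (proj1 hf)) hf w w0).
Qed.

Lemma free_add_R mu mu' rho f f' : is_free_add_conv mu mu' rho ->
  is_R_transform mu f -> is_R_transform mu' f' -> is_R_transform rho (fun w => f w + f' w).
Proof.
case=> P [a [a' [ha ha' fr hr]]] hf hf'.
apply/(is_R_transform_model 1); first by rewrite (proj1 hf) (proj1 hf') addr0.
move=> w _; rewrite hr.
pose k (b : bool) := if b then f else f'.
have hm := @free_triple_model R P 1 k a a' 1 (star_free_triple fr) (mulr1 1) (state1 P)
   (dist_model 1 ha hf) (dist_model 1 ha' hf').
rewrite -[RHS](sum_moment hm w) /star_word; congr (state _ _).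
by apply: eq_bigr => l _; rewrite star_letterD.
Qed.

Lemma distribution_exists (P : cstar_prob_space R) (a : P) :
  exists mu, is_star_distribution a mu.
Proof. exact: (functional_exists (fun w => state P (star_word a w))). Qed.

Lemma star_word_hom (P Q : cstar_prob_space R) (j : P -> Q) (a : P) w :
  (forall a b, j (a * b) = j a * j b) -> j 1 = 1 -> (forall a, j (star a) = star (j a)) ->
  star_word (j a) w = j (star_word a w).
Proof.
move=> jM j1 js; rewrite /star_word; elim: w => [|l w IH]; first by rewrite !big_nil j1.
by rewrite !big_cons IH jM; case: l => //=; rewrite js.
Qed.

Lemma free_pair mu mu' : Dc mu -> Dc mu' ->
  exists (P : cstar_prob_space R) (a a' : P),
    [/\ is_star_distribution a mu, is_star_distribution a' mu' & star_free a a'].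
Proof.
move=> [P [a ha]] [P' [a' ha']].
have [Q [j [jM j1 js jst jfr]]] := free_product (fun b : bool => if b then P else P').
exists Q, (j true a), (j false a'); split.
- by move=> w; rewrite star_word_hom //= jst.
- by move=> w; rewrite star_word_hom //= jst.
apply: jfr => -[] x [] ->.
- by exists a.
- by exists (star a); rewrite js.
- by exists a'.
- by exists (star a'); rewrite js.
Qed.

Lemma free_add_convP mu mu' : Dc mu -> Dc mu' -> is_free_add_conv mu mu' (free_add_conv mu mu').
Proof.
move=> h h'; have [P [a [a' [ha ha' fr]]]] := free_pair h h'.
have [rho hr] := distribution_exists (a + a').
rewrite /free_add_conv; case: xgetP => // no; exfalso; apply: (no rho).
by exists P, a, a'.
Qed.

Lemma free_mul_convP mu mu' : Dc mu -> Dc mu' -> is_free_mul_conv mu mu' (free_mul_conv mu mu').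
Proof.
move=> h h'; have [P [a [a' [ha ha' fr]]]] := free_pair h h'.
have [rho hr] := distribution_exists (a * a').
rewrite /free_mul_conv; case: xgetP => // no; exfalso; apply: (no rho).
by exists P, a, a'.
Qed.

Lemma free_add_conv_powP n mu : (0 < n)%N -> Dc mu -> Dc (free_add_conv_pow n mu) /\
  forall w, R_transform (free_add_conv_pow n mu) w = n%:R * R_transform mu w.
Proof.
case: n => // n _ hmu; rewrite /free_add_conv_pow /=; elim: n => [|n [IHd IHr]] /=.
  by split=> // w; rewrite mul1r.
set rho := iter _ _ _ in IHd IHr *.
have hc := free_add_convP IHd hmu; split.
  by case: hc => P [a [a' [_ _ _ hr]]]; exists P, (a + a').
move=> w; have := free_add_R hc (R_transformP rho) (R_transformP mu).
by move=> /R_transform_eq ->; rewrite IHr [n.+2%:R]mulrSr mulrDl mul1r.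
Qed.

Lemma Dc_ext mu nu : Dc mu -> Dc nu -> (forall w, R_transform mu w = R_transform nu w) -> mu = nu.
Proof.
move=> [P [a ha]] [Q [b hb]] e; apply: functional_ext => w.
rewrite ha (dist_model 0 ha (R_transformP mu)) hb (dist_model 0 hb (R_transformP nu)).
by congr mmodel; apply/funext.
Qed.

End Convolutions.

Section Product.
Variable R : realType.
Implicit Types (mu nu rho : {scalar ncpoly R}) (w : word) (f : ncseries R).

Lemma star_word_product (P : cstar_prob_space R) (x y p : P) (t : R) w : star p = p ->
  star_word ((t^-1)%:C *: (x * p * y)) w =
  (t%:C ^- size w) *: eword (triple_letter x y p) (bword w).
Proof.
move=> ps; rewrite /star_word /bword; elim: w => [|l w IH].
  by rewrite big_nil /eword big_nil expr0 invr1 scale1r.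
rewrite big_cons IH [flatten _]/= eword_cat exprS invfM -scalerA.
have -> : star_letter ((t^-1)%:C *: (x * p * y)) l =
    t%:C^-1 *: eword (triple_letter x y p) (bletters l).
  rewrite -fmorphV /eword /bletters !big_cons big_nil.
  case: l; rewrite /= ?mulr1 ?mulrA //.
  by rewrite starZ cconj_real !starM ps !mulrA.
by rewrite -scalerAl -scalerAr.
Qed.

(** The scaling by [t^-1] contributes a power of [t] for each letter, which cancels the one in
    [model_prod]. *)
Lemma R_transform_product (P : cstar_prob_space R) (x y p : P) (t : R)
    (k : bool -> ncseries R) rho :
  t != 0 -> (forall c, rdiag (k c)) -> free_triple x y p -> p * p = p -> star p = p ->
  state P p = t%:C ->
  (forall w, state P (star_word x w) = mmodel t%:C (fun w => t%:C * k true w) w) ->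
  (forall w, state P (star_word y w) = mmodel t%:C (fun w => t%:C * k false w) w) ->
  is_star_distribution ((t^-1)%:C *: (x * p * y)) rho ->
  is_R_transform rho (fun w => t%:C * prod_cumulant k w).
Proof.
move=> t0 kd fr pp ps pt hx hy hr.
have tC : t%:C != 0 :> R[i] by rewrite eq_complex /= negb_and t0.
apply/(is_R_transform_model t%:C); first by rewrite mulr0.
move=> w _; rewrite hr star_word_product // stateZ.
rewrite (@free_triple_model R P t%:C (sk k t%:C)) // model_prod //.
by rewrite mulrA mulVf ?expf_neq0 // mul1r.
Qed.

End Product.

Theorem theorem7p8 (R : realType) (nu nu' : {scalar ncpoly R}) :
  Rc_inf_div nu -> Rc_inf_div nu' -> Rc_inf_div (free_mul_conv nu nu').
Proof.
case=> Dnu rnu inu [Dnu' rnu' inu'].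
pose k (c : bool) := if c then R_transform nu else R_transform nu'.
have kd c : rdiag (k c).
  move=> w nw; have na : ~ Defs.alternating w by move=> /alternating_altb aw; rewrite aw in nw.
  by case: c; rewrite /k; [apply: rnu|apply: rnu'].
set rho := free_mul_conv nu nu'.
have [P [a [a' [ha ha' fr hr]]]] := free_mul_convP Dnu Dnu'.
have Rrho w : R_transform rho w = prod_cumulant k w.
  have one1 (f : ncseries R) : (fun w => (1 : R)%:C * f w) = f.
    by apply/funext => v; rewrite mul1r.
  have h : is_R_transform rho (fun w => (1 : R)%:C * prod_cumulant k w).
    (* The unit serves as the projection, with [t = 1], so that [x p y] is the product itself. *)
    apply: (R_transform_product (oner_neq0 R) kd (star_free_triple fr)).
    - exact: mulr1.
    - exact: star1.
    - exact: state1.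
    - by rewrite one1; apply: dist_model ha (R_transformP nu).
    - by rewrite one1; apply: dist_model ha' (R_transformP nu').
    - by rewrite invr1 scale1r mulr1.
  by rewrite (R_transform_eq h) mul1r.
have Drho : Dc rho by exists P, (a * a').
split=> //.
  move=> w nw; rewrite Rrho; apply: (prod_cumulant_diag kd).
  by apply/negP => /altb_alternating.
move=> n n0; have [m Dm em] := inu n n0; have [m' Dm' em'] := inu' n n0.
(* The same number scales the cumulants of the [n]-th roots and is the state of the projection. *)
pose t : R := n%:R^-1.
have t0 : t != 0 by rewrite invr_eq0 pnatr_eq0 -lt0n.
have tn : t%:C * n%:R = 1 :> R[i].
  rewrite (_ : n%:R = (n%:R : R)%:C) -?rmorphM /= ?mulVf ?pnatr_eq0 -?lt0n //.
  by rewrite rmorph_nat.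
have t01 : 0 <= t <= 1.
  by rewrite invr_ge0 ler0n /= invf_le1 ?ltr0n ?ler1n.
have [P1 [x0 hx0]] := Dm; have [P2 [y0 hy0]] := Dm'.
have [P3 [p0 [pp0 ps0 pt0]]] := projection_exists t01.
pose fam (i : option bool) := match i with Some true => P1 | Some false => P2 | None => P3 end.
have [Q [j [jM j1 js jst jfr]]] := free_product fam.
pose x : Q := j (Some true) x0; pose y : Q := j (Some false) y0; pose p : Q := j None p0.
have [mun hmun] := distribution_exists ((t^-1)%:C *: (x * p * y)).
have root mu q : Dc q -> free_add_conv_pow n q = mu -> forall w,
    R_transform q w = t%:C * R_transform mu w.
  move=> Dq <- w; have [_ ->] := free_add_conv_powP n0 Dq.
  by rewrite mulrA tn mul1r.
have Rmun : is_R_transform mun (fun w => t%:C * prod_cumulant k w).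
  apply: (@R_transform_product _ Q x y p t k) hmun => //.
  - apply: jfr => -[[]|] z /=.
    + by case=> ->; [exists x0|exists (star x0); rewrite js].
    + by case=> ->; [exists y0|exists (star y0); rewrite js].
    + by move=> ->; exists p0.
  - by rewrite /p -jM; congr j.
  - by rewrite /p -js; congr j.
  - by rewrite /p jst.
  - move=> w; rewrite star_word_hom //; first rewrite jst.
    rewrite (dist_model t%:C hx0 (R_transformP m)); congr mmodel.
    by apply/funext => v; apply: root.
  - move=> w; rewrite star_word_hom //; first rewrite jst.
    rewrite (dist_model t%:C hy0 (R_transformP m')); congr mmodel.
    by apply/funext => v; apply: root.
exists mun; first by exists Q, ((t^-1)%:C *: (x * p * y)).
have Dmun : Dc mun by exists Q, ((t^-1)%:C *: (x * p * y)).
(* The [n]-fold convolution has cumulants [n * t = 1] times those of [rho], and these determine a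
   distribution. *)
have [Dpow Rpow] := free_add_conv_powP n0 Dmun.
apply: Dc_ext => // w; rewrite Rpow Rrho (R_transform_eq Rmun) mulrA [n%:R * _]mulrC tn.
by rewrite mul1r.
Qed.
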